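(* Let the sequence $C_n$ be determined by $C_n^4N(C_n)\asymp n^2$. Assume (A1), (A2), (A3), (B1) and (B2). Let $r_n\to0$ be a positive sequence. Then: [1] The separation rates are of the form $r_n^*\asymp C_n^{-1}$. [2] Moreover, let $r_n/r_n^*\to\infty$. Then there exists a sequence $H=H_n\to\infty$ such that the sequence of tests $\psi_n^H=\mathbf 1_{\{U_n>H\}}$ is asymptotically minimax consistent, i.e. $\gamma(\mathcal F,r_n,\psi_n^H)\to0$. Here $$U_n=\frac1n\sum_{1\le i<k\le n}x_ix_k\,G_n(t_i,t_k),\qquad G_n(t',t'')=\sqrt{\frac{2}{N(C_n)}}\sum_{l\in\mathcal N(C_n)}\phi_l(t')\phi_l(t'').$$
   Context: Model. Let $\Delta=[0,1]^d$ with $1\le d\le\infty$ fixed, with the uniform (product Lebesgue) probability measure, and $L_2=L_2(\Delta)$ with norm $\|\cdot\|$. One observes $Z_n=\{z_1,\dots,z_n\}$, $z_i=(x_i,t_i)$, where $x_i=f(t_i)+\xi_i$, $i=1,\dots,n$; the $t_i$ are i.i.d. uniform on $\Delta$, and conditionally on $(t_1,\dots,t_n)$ the $\xi_i$ are i.i.d. $\mathcal N(0,1)$ (known noise variance normalised to $1$). $P_{n,f}$ is the law of $Z_n$ and $E_{n,f}$ its expectation. All limits are as $n\to\infty$; $A_n\asymp B_n$ means the ratio is eventually bounded between two positive constants. Function class. $\mathcal L$ is a denumerable (countably infinite) set, $\{\phi_l\}_{l\in\mathcal L}$ an orthonormal system in $L_2$, and $c_l\ge0$ ($l\in\mathcal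 L$) given coefficients. The ellipsoid is $$\mathcal F=\Big\{f:\ f=\sum_{l\in\mathcal L}\theta_l\phi_l,\ \sum_{l\in\mathcal L}c_l^2\theta_l^2\le1\Big\},\quad f\in L_2,\ \theta_l=\langle f,\phi_l\rangle .$$ For $C>0$: $\mathcal N(C)=\{l\in\mathcal L:c_l<C\}$, $N(C)=\#\mathcal N(C)$. Assumptions. (A1) $N(C)<\infty$ for all $C>0$. (A2) $\sum_{l\in\mathcal N(C)}\phi_l^2(t)=N(C)$ for all $C>0$, $t\in\Delta$. (A3) There is $p>4$ with $\sup_{f\in\mathcal F}\int_\Delta|f|^p<\infty$. (B1) $N(C_n)=o(n)$. (B2) For any fixed $B>0$, $N(C_n)\asymp N(BC_n)$. Testing problem. $H_0:f=0$ is tested against $H_1:f\in\mathcal F(r_n)$, $\mathcal F(r_n)=\{f\in\mathcal F:\|f\|\ge r_n\}$. A test $\psi$ is a measurable function of $Z_n$ with values in $[0,1]$ (the probability of rejecting $H_0$). Set $\alpha(\psi)=E_{n,0}\psi$; $\beta(\mathcal F,r_n,\psi)=\sup_{f\in\mathcal F(r_n)}E_{n,f}(1-\psi)$; $\beta(\mathcal F,r_n,\alpha)=\inf_{\psi:\alpha(\psi)\le\alpha}\beta(\mathcal F,r_n,\psi)$; $\gamma(\mathcal F,r_n,\psi)=\alpha(\psi)+\beta(\mathcal F,r_n,\psi)$; $\gamma(\mathcal F,r_n)=\inf_\psi\gamma(\mathcal F,r_n,\psi)$. A positive sequence $r_n^*\to0$ is a separation rate if $\gamma(\mathcal F,r_n)\to1$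 whenever $r_n/r_n^*\to0$, and $\gamma(\mathcal F,r_n)\to0$ and $\beta(\mathcal F,r_n,\alpha)\to0$ for every $\alpha\in(0,1)$ whenever $r_n/r_n^*\to\infty$ (for positive sequences $r_n\to 0$). *)

(* Defs.v *)
From HB Require Import structures.
From mathcomp Require Import all_boot all_order all_algebra finmap.
From mathcomp Require Import all_classical all_reals all_analysis.

Set Implicit Arguments.
Unset Strict Implicit.
Unset Printing Implicit Defensive.

Import Order.TTheory GRing.Theory Num.Theory.
Import numFieldNormedType.Exports.

Local Open Scope classical_set_scope.
Local Open Scope ring_scope.

(* A dimension 1 <= d <= oo is an [option nat]; [None] stands for d = oo. *)
Definition dim_ge1 (d : option nat) : Prop :=
  if d is Some m then (1 <= m)%N else True.

Definition axis (d : option nat) : choiceType :=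
  if d is Some m then 'I_m : choiceType else nat : choiceType.

Section Cube.
Context {R : realType} (d : option nat).

Definition cylinders : set (set (axis d -> R)) :=
  [set B | exists i A, measurable A /\ B = [set t | A (t i)]].

(* R^d with the product sigma-algebra.  Functions on the cube are represented
   by functions on R^d, and the uniform law on the cube by a probability on
   R^d concentrated on [unit_cube]. *)
Definition rspace := g_sigma_algebraType cylinders.

Definition unit_cube : set rspace := [set t | forall i, 0 <= t i <= 1].

(* The values on finite-dimensional measurable boxes determine [mu]. *)
Definition is_uniform (mu : probability rspace R) : Prop :=
  forall (J : {fset axis d}) (A : axis d -> set R),
    (forall i, measurable (A i)) ->
    mu [set t : rspace | forall i, i \in J -> A i (t i)] =
    (\prod_(i <- J) lebesgue_measure (A i `&` `[0%R, 1%R]))%E.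

End Cube.
Arguments rspace : clear implicits.
Arguments unit_cube : clear implicits.

Section IID.
Context {R : realType} {dT : measure_display} {T : measurableType dT}.

Definition tuple_cons (n : nat) (x : T * n.-tuple T) : n.+1.-tuple T :=
  [tuple of x.1 :: x.2].

Lemma measurable_tuple_cons n : measurable_fun setT (@tuple_cons n).
Proof.
exact: (measurable_cons (@measurable_fst _ _ T (n.-tuple T))
                        (@measurable_snd _ _ T (n.-tuple T))).
Qed.

HB.instance Definition _ n :=
  isMeasurableFun.Build _ _ _ _ (@tuple_cons n) (@measurable_tuple_cons n).

(* The n-fold product of [P]. *)
Fixpoint iid_law (P : probability T R) (n : nat) : probability (n.-tuple T) R :=
  if n is m.+1 then distribution (P \x iid_law P m)%E (@tuple_cons m)
  else dirac [tuple].

End IID.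

Section Ellipsoid.
Context {R : realType} {d : option nat} (mu : probability (rspace R d) R).
Context {L : choiceType}.
Implicit Types (phi : L -> rspace R d -> R) (c : L -> R) (f : rspace R d -> R).

Definition orthonormal_system phi : Prop :=
  (forall l, phi l \in Lfun mu 2%:E) /\
  (forall l m, \int[mu]_t (phi l t * phi m t) = (l == m)%:R).

Definition fcoef phi f (l : L) : R := \int[mu]_t (f t * phi l t).

Definition fourier_sum phi f (B : set L) (t : rspace R d) : R :=
  \sum_(l \in B) fcoef phi f l * phi l t.

(* f = \sum_l theta_l phi_l in L_2, as an unordered sum. *)
Definition is_expansion phi f : Prop :=
  forall e : R, 0 < e -> exists A : set L, finite_set A /\
    forall B : set L, finite_set B -> A `<=` B ->
      ('N[mu]_2%:E[EFin \o (f \- fourier_sum phi f B)%R] < e%:E)%E.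

Definition ellipsoid phi c : set (rspace R d -> R) :=
  [set f | [/\ f \in Lfun mu 2%:E,
               is_expansion phi f &
               (\esum_(l in [set: L]) (c l ^+ 2 * fcoef phi f l ^+ 2)%:E
                 <= 1)%E]].

Definition separated_class (F : set (rspace R d -> R)) (r : R) :=
  F `&` [set f | (r%:E <= 'N[mu]_2%:E[EFin \o f])%E].

Definition level_set c (C : R) : set L := [set l | c l < C].

Definition card_level c (C : R) : nat := #|` fset_set (level_set c C)|.

End Ellipsoid.

Section Testing.
Context {R : realType} {d : option nat} (mu : probability (rspace R d) R).
Notation obs := ((measurableTypeR R * rspace R d)%type).

(* The law of n independent pairs (xi_i, t_i). *)
Definition noise_design (n : nat) : probability (n.-tuple obs) R :=
  iid_law (normal_prob (0%R : R) 1%R \x mu)%E n.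

(* Sends (xi_i, t_i) to z_i = (x_i, t_i), so the law of [obs_sample f] under
   [noise_design n] is P_{n,f}. *)
Definition obs_sample (f : rspace R d -> R) (n : nat) (w : n.-tuple obs) :
    n.-tuple obs :=
  [tuple of map (fun v : obs => (f v.2 + (v.1 : R), v.2)) w].

Definition expect_obs (n : nat) (f : rspace R d -> R) (g : n.-tuple obs -> R) : R :=
  \int[noise_design n]_w g (obs_sample f w).

Definition is_test (n : nat) (psi : n.-tuple obs -> R) : Prop :=
  measurable_fun setT psi /\ forall z, 0 <= psi z <= 1.

Definition alpha_err (n : nat) (psi : n.-tuple obs -> R) : R :=
  expect_obs (fun=> 0) psi.

(* If no f in F has norm at least r, the supremum is 0. *)
Definition beta_err (F : set (rspace R d -> R)) (r : R) (n : nat)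
    (psi : n.-tuple obs -> R) : R :=
  sup [set expect_obs f (fun z => 1 - psi z) | f in separated_class mu F r].

Definition beta_inf (F : set (rspace R d -> R)) (r : R) (n : nat) (a : R) : R :=
  inf [set beta_err F r psi |
       psi in [set psi : n.-tuple obs -> R | is_test psi /\
                                             alpha_err psi <= a]].

Definition gamma_err (F : set (rspace R d -> R)) (r : R) (n : nat)
    (psi : n.-tuple obs -> R) : R :=
  alpha_err psi + beta_err F r psi.

Definition gamma_inf (F : set (rspace R d -> R)) (r : R) (n : nat) : R :=
  inf [set gamma_err F r psi | psi in @is_test n].

Definition positive_seq (r : nat -> R) : Prop := forall n, 0 < r n.

Definition is_separation_rate (F : set (rspace R d -> R)) (rs : nat -> R) :
    Prop :=
  [/\ positive_seq rs,
      rs @ \oo --> 0,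
      (forall r : nat -> R, positive_seq r -> r @ \oo --> 0 ->
        r n / rs n @[n --> \oo] --> 0 ->
        gamma_inf F (r n) n @[n --> \oo] --> (1 : R)) &
      (forall r : nat -> R, positive_seq r -> r @ \oo --> 0 ->
        r n / rs n @[n --> \oo] --> +oo ->
        gamma_inf F (r n) n @[n --> \oo] --> (0 : R) /\
        forall a : R, 0 < a < 1 ->
          beta_inf F (r n) n a @[n --> \oo] --> (0 : R))].

Definition asymp (A B : nat -> R) : Prop :=
  exists a b : R, [/\ 0 < a, 0 < b & \forall n \near \oo, a <= A n / B n <= b].

End Testing.

Section Statistic.
Context {R : realType} {d : option nat} {L : choiceType}.
Variables (phi : L -> rspace R d -> R) (c : L -> R) (C : nat -> R).
Notation obs := ((measurableTypeR R * rspace R d)%type).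

Definition G_kernel (n : nat) (t' t'' : rspace R d) : R :=
  Num.sqrt (2 / (card_level c (C n))%:R) *
  \sum_(l \in level_set c (C n)) phi l t' * phi l t''.

Definition U_stat (n : nat) (z : n.-tuple obs) : R :=
  n%:R^-1 *
  \sum_(i < n) \sum_(k < n | (i < k)%N)
    ((tnth z i).1 : R) * ((tnth z k).1 : R) *
    G_kernel n (tnth z i).2 (tnth z k).2.

Definition U_test (n : nat) (H : R) : n.-tuple obs -> R :=
  \1_[set z | H < U_stat z].

End Statistic.

(* Main.v *)
Require Import Defs.
From HB Require Import structures.
From mathcomp Require Import all_boot all_order all_algebra finmap.
From mathcomp Require Import all_classical all_reals all_analysis.
From mathcomp Require Import measurable_realfun.
From mathcomp Require Import lra.

Set Implicit Arguments.
Unset Strict Implicit.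
Unset Printing Implicit Defensive.

Import Order.TTheory GRing.Theory Num.Theory.
Import numFieldNormedType.Exports.

Local Open Scope classical_set_scope.
Local Open Scope ring_scope.

(** Write [N] for the cardinal of the level set of [C n] and [F] for the
    squared norm of a regression function [f]. Both halves of the theorem come
    from two bounds that are uniform in the radius [r] and involve it only
    through the product [r * C n]: an upper bound on the errors of the test
    when this product is large, and a lower bound close to one on the minimax
    error when it is small.

    Upper bound. [U] is a U-statistic whose kernel is the sum over the level
    set of products of the scores [x_i * phi_l(t_i)], which have means
    [theta_l]. Hoeffding's decomposition ([pair_sum_center]) splits it into
    its mean, which is of order [n / sqrt N] times the energy of [f] in the
    level set, a linear part and a degenerate part, whose pairs are
    orthogonal. The second moments of both parts are expressed, apart from the
    noise, through the matrix of the integrals of [f^2 phi_l phi_m]. Since the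
    squares of the [phi_l] sum to the constant [N], the trace of this matrix
    is [N * F] ([phi_energy]), and Cauchy-Schwarz controls all the rest by the
    trace ([U_score_variance]). Outside of the level set [c_l >= C n], so a
    member of the ellipsoid has energy at most [C n ^- 2] there
    ([tail_energy]); if [r * C n] is large, at least half of the energy
    remains inside. With [C n ^ 4 * N] of order [n ^ 2], the mean exceeds a
    threshold of order [(r * C n) ^ 2], and the variance is negligible
    relative to the square of the mean when [r * C n] is large and [N / n]
    small ([power_arith]). Under the null hypothesis the mean vanishes and the
    variance is bounded. Chebyshev's inequality concludes on both sides.

    Lower bound. Put on the coefficients in the level set independent random
    signs times [r / sqrt N]. If [r * C n <= 1], the resulting functions
    belong to the ellipsoid and have norm [r], so the minimax error is at
    least the Bayes error against this prior ([bayes_lower_bound]). By the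
    Cameron-Martin formula, the law of the sample under [f] has a density,
    [lik], with respect to the null law. Given the design, the product of the
    likelihood ratios of two sign vectors [e] and [e'] has mean the
    exponential of a bilinear form in [e] and [e'], whose matrix is the
    multiple by [r^2/N] of the Gram matrix of the [phi_l] at the design
    points. Averaging over [e'] and then over [e] by sub-Gaussian bounds
    ([rad_mean_linear], [rad_mean_quadratic]) gives a second moment close to
    one as soon as the squared Frobenius norm of this matrix is small. Its
    mean is at most [r^4*(n+n^2/N)], hence the designs on which it is not
    small have small probability ([Pgood_ge]), and they are discarded before
    taking second moments. On the remaining designs the exponents are bounded,
    so that second moments of the Gram matrix suffice.

    Rates. Every sequence of the order of [1 / C n] is a separation rate by
    the two bounds. Conversely, suppose that [rs] is a separation rate and
    that [rs n * C n] is unbounded. Multiply [rs] by a sequence that tends to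
    zero so slowly that the product with [C n] stays unbounded
    ([slow_sequence]). The radii so obtained are negligible with respect to
    [rs], so the minimax error should tend to one, while the upper bound makes
    it small along a subsequence. The other direction divides [rs] by a slow
    sequence and uses the lower bound. *)

(** * Square integrable functions under a probability *)

Section SquareIntegrable.
Context {d : measure_display} {T : measurableType d} {R : realType}.
Variable P : probability T R.
Implicit Types f g : T -> R.

Lemma L2_measurable f : f \in Lfun P 2%:E -> measurable_fun setT f.
Proof. by rewrite inE => /andP[]; rewrite inE. Qed.

Lemma L2_intM f g : f \in Lfun P 2%:E -> g \in Lfun P 2%:E ->
  P.-integrable setT (EFin \o (fun x => f x * g x)).
Proof. by move=> f2 g2; apply/Lfun1_integrable/Lfun2_mul_Lfun1. Qed.

Lemma L2_int f : f \in Lfun P 2%:E -> P.-integrable setT (EFin \o f).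
Proof.
move=> f2; apply/Lfun1_integrable/Lfun_subset12 => //.
by rewrite fin_num_measure.
Qed.

Lemma L2P f : measurable_fun setT f ->
  P.-integrable setT (EFin \o (fun x => f x * f x)) -> f \in Lfun P 2%:E.
Proof.
move=> mf /integrableP[_ f2]; rewrite inE; apply/andP; split; rewrite inE//=.
rewrite /finite_norm unlock poweR_lty//; apply: le_lt_trans f2.
apply: ge0_le_integral => //=.
- apply/measurable_EFinP/(@measurableT_comp _ _ _ _ _ _ (@powR R ^~ 2)) => //.
  exact: measurableT_comp.
- by do 2 apply: measurableT_comp => //; exact: measurable_funM.
- by move=> x _; rewrite lee_fin powR_mulrn// -expr2 normrX.
Qed.

Lemma L2_cst c : (fun=> c) \in Lfun P 2%:E.
Proof. exact: Lfun_cst. Qed.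

Lemma int01 f : measurable_fun setT f -> (forall x, 0 <= f x <= 1) ->
  P.-integrable setT (EFin \o f).
Proof.
move=> mf f01.
apply: (le_integrable measurableT) (L2_int (L2_cst 1)).
  exact/measurable_EFinP.
by move=> x _ /=; have /andP[h1 h2] := f01 x; rewrite lee_fin normr1 ger0_norm.
Qed.

Lemma L2D f g : f \in Lfun P 2%:E -> g \in Lfun P 2%:E ->
  (fun x => f x + g x) \in Lfun P 2%:E.
Proof. by move=> f2 g2; apply: (Lfun_addr_closed P (lee1n 2)).2. Qed.

Lemma L2Z c f : f \in Lfun P 2%:E -> (fun x => c * f x) \in Lfun P 2%:E.
Proof.
move=> f2.
have -> : (fun x => c * f x) = (c \o* f) by apply/funext => x /=; rewrite mulrC.
by apply: Lfun_scale => //; rewrite ler1n.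
Qed.

Lemma L2B f g : f \in Lfun P 2%:E -> g \in Lfun P 2%:E ->
  (fun x => f x - g x) \in Lfun P 2%:E.
Proof.
move=> f2 g2; have := L2D f2 (L2Z (-1) g2).
by under eq_fun do rewrite mulN1r.
Qed.

Lemma L2_sum (I : Type) (s : seq I) (F : I -> T -> R) :
  (forall i, F i \in Lfun P 2%:E) ->
  (fun x => \sum_(i <- s) F i x) \in Lfun P 2%:E.
Proof.
move=> F2; elim: s => [|i s IH].
  by under eq_fun do rewrite big_nil; exact: L2_cst.
by under eq_fun do rewrite big_cons; exact: L2D.
Qed.

Lemma intD f g : P.-integrable setT (EFin \o f) ->
  P.-integrable setT (EFin \o g) ->
  P.-integrable setT (EFin \o (fun x => f x + g x)).
Proof. by move=> f1 g1; exact: (integrableD _ f1 g1). Qed.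

Lemma intB f g : P.-integrable setT (EFin \o f) ->
  P.-integrable setT (EFin \o g) ->
  P.-integrable setT (EFin \o (fun x => f x - g x)).
Proof. by move=> f1 g1; exact: (integrableB _ f1 g1). Qed.

Lemma intZ c f : P.-integrable setT (EFin \o f) ->
  P.-integrable setT (EFin \o (fun x => c * f x)).
Proof. by move=> f1; exact: (integrableZl _ _ f1). Qed.

Lemma int_sum (I : Type) (s : seq I) (F : I -> T -> R) :
  (forall i, P.-integrable setT (EFin \o F i)) ->
  P.-integrable setT (EFin \o (fun x => \sum_(i <- s) F i x)).
Proof.
move=> F1; elim: s => [|i s IH].
  by under eq_fun do rewrite big_nil; apply: L2_int; exact: L2_cst.
under eq_fun do rewrite big_cons.
exact: intD.
Qed.

Lemma Rintegral_sum (I : Type) (s : seq I) (F : I -> T -> R) :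
  (forall i, P.-integrable setT (EFin \o F i)) ->
  \int[P]_x (\sum_(i <- s) F i x) = \sum_(i <- s) \int[P]_x F i x.
Proof.
move=> F1; elim: s => [|i s IH].
  by under eq_Rintegral do rewrite big_nil; rewrite Rintegral_cst// big_nil mul0r.
under eq_Rintegral do rewrite big_cons.
by rewrite RintegralD// ?IH ?big_cons//; exact: int_sum.
Qed.

Lemma Rintegral_1 c : \int[P]_x c = c.
Proof. by rewrite Rintegral_cst//= probability_setT mulr1. Qed.

Lemma EFin_Rintegral f : P.-integrable setT (EFin \o f) ->
  (\int[P]_x f x)%:E = (\int[P]_x (f x)%:E)%E.
Proof. by move=> f1; rewrite /Rintegral fineK//; exact: integrable_fin_num. Qed.

End SquareIntegrable.

Section Tensor.
Context {d1 d2 : measure_display} {T1 : measurableType d1}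
  {T2 : measurableType d2} {R : realType}.
Variables (P : probability T1 R) (Q : probability T2 R).
Implicit Types (f : T1 -> R) (g : T2 -> R).

(** Tonelli applied to the modulus, whose iterated integral factors. *)
Lemma int_tensor f g :
  P.-integrable setT (EFin \o f) -> Q.-integrable setT (EFin \o g) ->
  (P \x Q)%E.-integrable setT (EFin \o (fun z => f z.1 * g z.2)).
Proof.
move=> f1 g1.
have mf : measurable_fun setT f by apply/measurable_EFinP; exact: measurable_int f1.
have mg : measurable_fun setT g by apply/measurable_EFinP; exact: measurable_int g1.
apply/integrable12ltyP.
  apply/measurable_EFinP; apply: measurable_funM.
    exact: measurableT_comp.
  exact: measurableT_comp.
rewrite (eq_integral (fun x => `|f x|%:E * \int[Q]_y `|g y|%:E)%E); last first.
  move=> x _; rewrite -ge0_integralZl//=.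
  - by apply: eq_integral => y _; rewrite normrM EFinM.
  - by do 2 apply: measurableT_comp.
case/integrableP: f1 => _ f1; case/integrableP: g1 => _ g1.
rewrite ge0_integralZr//=.
- by rewrite lte_mul_pinfty// ?integral_ge0// ge0_fin_numE// integral_ge0.
- by do ?apply: measurableT_comp => //.
- exact: integral_ge0.
Qed.

Lemma Rintegral_tensor f g :
  P.-integrable setT (EFin \o f) -> Q.-integrable setT (EFin \o g) ->
  \int[(P \x Q)%E]_z (f z.1 * g z.2) = (\int[P]_x f x) * \int[Q]_y g y.
Proof.
move=> f1 g1; apply: EFin_inj; rewrite EFinM !EFin_Rintegral//; last exact: int_tensor.
rewrite -integral12_prod_meas1; last exact: int_tensor.
rewrite -[in RHS](EFin_Rintegral g1) -integralZr//.
apply: eq_integral => x _; rewrite EFin_Rintegral// -integralZl//.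
Qed.

Lemma int_fst f : P.-integrable setT (EFin \o f) ->
  (P \x Q)%E.-integrable setT (EFin \o (fun z => f z.1)).
Proof.
move=> f1; have := int_tensor f1 (L2_int (L2_cst Q 1)).
by under eq_fun do rewrite mulr1.
Qed.

Lemma int_snd g : Q.-integrable setT (EFin \o g) ->
  (P \x Q)%E.-integrable setT (EFin \o (fun z => g z.2)).
Proof.
move=> g1; have := int_tensor (L2_int (L2_cst P 1)) g1.
by under eq_fun do rewrite mul1r.
Qed.

Lemma Rintegral_fst f : P.-integrable setT (EFin \o f) ->
  \int[(P \x Q)%E]_z f z.1 = \int[P]_x f x.
Proof.
move=> f1; have := Rintegral_tensor f1 (L2_int (L2_cst Q 1)).
by under eq_Rintegral do rewrite mulr1; rewrite Rintegral_1 mulr1.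
Qed.

Lemma Rintegral_snd g : Q.-integrable setT (EFin \o g) ->
  \int[(P \x Q)%E]_z g z.2 = \int[Q]_y g y.
Proof.
move=> g1; have := Rintegral_tensor (L2_int (L2_cst P 1)) g1.
by under eq_Rintegral do rewrite mul1r; rewrite Rintegral_1 mul1r.
Qed.

Lemma L2_tensor f g : f \in Lfun P 2%:E -> g \in Lfun Q 2%:E ->
  (fun z => f z.1 * g z.2) \in Lfun (P \x Q)%E 2%:E.
Proof.
move=> f2 g2; apply: L2P.
  apply: measurable_funM.
    by apply: measurableT_comp => //; exact: L2_measurable f2.
  by apply: measurableT_comp => //; exact: L2_measurable g2.
have := int_tensor (L2_intM f2 f2) (L2_intM g2 g2).
by under eq_fun do rewrite mulrACA.
Qed.

Lemma L2_fst f : f \in Lfun P 2%:E -> (fun z => f z.1) \in Lfun (P \x Q)%E 2%:E.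
Proof.
move=> f2; have := L2_tensor f2 (L2_cst Q 1).
by under eq_fun do rewrite mulr1.
Qed.

Lemma L2_snd g : g \in Lfun Q 2%:E -> (fun z => g z.2) \in Lfun (P \x Q)%E 2%:E.
Proof.
move=> g2; have := L2_tensor (L2_cst P 1) g2.
by under eq_fun do rewrite mul1r.
Qed.

End Tensor.

(** * Sums over pairs of independent observations *)

Section PairSum.
Context {T : Type} {R : realType}.
Implicit Types (K : T -> T -> R) (u : T -> R) (z : seq T).

(** The recursion on the sequence matches that of [iid_law], so moments are
    computed by adding one observation at a time. *)
Fixpoint pair_sum K z : R :=
  if z is x :: z' then \sum_(y <- z') K x y + pair_sum K z' else 0.

Lemma pair_sumE K n (z : n.-tuple T) :
  \sum_(i < n) \sum_(k < n | (i < k)%N) K (tnth z i) (tnth z k) = pair_sum K z.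
Proof.
elim: n z => [|n IH] z; first by rewrite big_ord0 tuple0.
case/tupleP: z => x z; rewrite big_ord_recl /= -IH; congr (_ + _).
  rewrite big_mkcond big_ord_recl/= add0r big_tuple; apply: eq_bigr => i _.
  by rewrite tnth0 tnthS.
apply: eq_bigr => i _; rewrite big_mkcond big_ord_recl/= add0r.
rewrite [RHS]big_mkcond; apply: eq_bigr => k _ /=.
by rewrite ltnS !tnthS.
Qed.

(** Hoeffding's decomposition of a kernel of finite rank. When [th] is the
    mean of [u], the three terms are the mean, the linear part and the
    degenerate part of the statistic. *)
Lemma pair_sum_center (I : Type) (s : seq I) (u : I -> T -> R) (th : I -> R) z :
  pair_sum (fun x y => \sum_(l <- s) u l x * u l y) z =
  'C(size z, 2)%:R * \sum_(l <- s) th l ^+ 2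
  + (size z).-1%:R * \sum_(x <- z) \sum_(l <- s) th l * (u l x - th l)
  + pair_sum (fun x y => \sum_(l <- s) (u l x - th l) * (u l y - th l)) z.
Proof.
elim: z => [|x z IH] /=; first by rewrite big_nil mul0r mulr0 !addr0.
rewrite {}IH big_cons binS bin1 natrD.
set A := \sum_(l <- s) th l ^+ 2; set V := \sum_(j <- z) \sum_(l <- s) th l * _.
set vx := \sum_(i <- s) th i * (u i x - th i).
set W := pair_sum _ _; set Wx := \sum_(i <- z) \sum_(i0 <- s) (_ - _) * (_ - _).
have -> : \sum_(y <- z) \sum_(l <- s) u l x * u l y =
    (size z)%:R * A + (size z)%:R * vx + V + Wx.
  rewrite /A /V /vx /Wx {W Wx vx V A}; elim: z => [|y z IH].
    by rewrite !big_nil !mul0r !addr0.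
  rewrite !big_cons IH /=.
  suff -> : \sum_(l <- s) u l x * u l y = \sum_(l <- s) th l ^+ 2
      + \sum_(i <- s) th i * (u i x - th i) + \sum_(i <- s) th i * (u i y - th i)
      + \sum_(i <- s) (u i x - th i) * (u i y - th i).
    by rewrite -natr1; lra.
  by rewrite -!big_split/=; apply: eq_bigr => i _; lra.
case: z @V @W @Wx => [|y z] V W Wx /=.
  by rewrite /V /W /Wx !big_nil; lra.
by rewrite -!natr1; lra.
Qed.

End PairSum.

Section IIDMoments.
Context {d : measure_display} {T : measurableType d} {R : realType}.
Variable P : probability T R.
Implicit Types (u v : T -> R) (n : nat).

(** Adding an observation: integrals against [iid_law] unfold into integrals
    against a product of two laws, to which the tensor lemmas apply. *)
Lemma iid_int n (F : n.+1.-tuple T -> R) (G : T * n.-tuple T -> R) :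
  F \o @tuple_cons d T n = G -> measurable_fun setT F ->
  (P \x iid_law P n)%E.-integrable setT (EFin \o G) ->
  (iid_law P n.+1).-integrable setT (EFin \o F) /\
  \int[iid_law P n.+1]_z F z = \int[(P \x iid_law P n)%E]_z G z.
Proof.
move=> <- /measurable_EFinP mF intF; split; last first.
  by congr fine; exact: integral_distribution.
exact: (integrable_pushforward (@measurable_tuple_cons d T n) mF intF).
Qed.

Lemma iid_L2 n (F : n.+1.-tuple T -> R) :
  measurable_fun setT F ->
  F \o @tuple_cons d T n \in Lfun (P \x iid_law P n)%E 2%:E ->
  F \in Lfun (iid_law P n.+1) 2%:E.
Proof.
move=> mF F2; apply: L2P => //; apply: (iid_int erefl _ _).1.
  exact: measurable_funM.
exact: (L2_intM F2 F2).
Qed.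


Lemma measurable_lsum n u : measurable_fun setT u ->
  measurable_fun setT (fun z : n.-tuple T => \sum_(x <- z) u x).
Proof.
move=> mu; under eq_fun do rewrite big_tuple.
apply: measurable_sum => i; apply: measurableT_comp => //.
exact: measurable_tnth.
Qed.

Lemma measurable_pair_sum n (I : Type) (s : seq I) (u : I -> T -> R) :
  (forall l, measurable_fun setT (u l)) ->
  measurable_fun setT (fun z : n.-tuple T =>
    pair_sum (fun x y => \sum_(l <- s) u l x * u l y) z).
Proof.
move=> mu; under eq_fun do rewrite -pair_sumE.
apply: measurable_sum => i; under eq_fun do rewrite big_mkcond.
apply: measurable_sum => k; case: (i < k)%N; last exact: measurable_cst.
apply: measurable_sum => l; apply: measurable_funM; apply: measurableT_comp => //;
  exact: measurable_tnth.
Qed.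

Lemma L2_lsum n u : u \in Lfun P 2%:E ->
  (fun z : n.-tuple T => \sum_(x <- z) u x) \in Lfun (iid_law P n) 2%:E.
Proof.
move=> u2; elim: n => [|n IH].
  rewrite (_ : (fun _ => _) = fun=> 0); first exact: L2_cst.
  by apply/funext => z; rewrite tuple0 big_nil.
apply: iid_L2; first by apply: measurable_lsum; exact: L2_measurable u2.
rewrite [X in X \in _](_ : _ = fun z : T * n.-tuple T => u z.1 + \sum_(x <- z.2) u x).
  by apply: L2D; [exact: L2_fst | exact: L2_snd IH].
by apply/funext => z; rewrite /= big_cons.
Qed.

Lemma Rintegral_lsum n u : u \in Lfun P 2%:E ->
  \int[iid_law P n]_z (\sum_(x <- z) u x) = n%:R * \int[P]_x u x.
Proof.
move=> u2; elim: n => [|n IH].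
  rewrite mul0r -[RHS](Rintegral_1 (iid_law P 0)).
  by apply: eq_Rintegral => z _; rewrite tuple0 big_nil.
have u1 := L2_int u2; have s1 := L2_int (L2_lsum n u2).
have eF : (fun z : n.+1.-tuple T => \sum_(x <- z) u x) \o @tuple_cons d T n =
    (fun z : T * n.-tuple T => u z.1 + \sum_(x <- z.2) u x).
  by apply/funext => z; rewrite /= big_cons.
rewrite (iid_int eF _ _).2.
- rewrite RintegralD//; [|exact: int_fst|exact: int_snd s1].
  by rewrite Rintegral_fst// (Rintegral_snd _ s1) IH -natr1; lra.
- by apply: measurable_lsum; exact: L2_measurable u2.
- by apply: intD; [exact: int_fst|exact: int_snd s1].
Qed.

Lemma Rintegral_lsumM n u v : u \in Lfun P 2%:E -> v \in Lfun P 2%:E ->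
  \int[iid_law P n]_z ((\sum_(x <- z) u x) * (\sum_(x <- z) v x)) =
  n%:R * (\int[P]_x (u x * v x)) +
  n%:R * (n%:R - 1) * ((\int[P]_x u x) * \int[P]_x v x).
Proof.
move=> u2 v2; elim: n => [|n IH].
  rewrite !mul0r addr0 -[RHS](Rintegral_1 (iid_law P 0)).
  by apply: eq_Rintegral => z _; rewrite tuple0 !big_nil mul0r.
have u1 := L2_int u2; have v1 := L2_int v2.
have su := L2_lsum n u2; have sv := L2_lsum n v2.
have su1 := L2_int su; have sv1 := L2_int sv.
have iuv := L2_intM u2 v2; have isuv := L2_intM su sv.
have eF : (fun z : n.+1.-tuple T =>
      (\sum_(x <- z) u x) * (\sum_(x <- z) v x)) \o @tuple_cons d T n =
    (fun z : T * n.-tuple T => (u z.1 * v z.1 + u z.1 * \sum_(x <- z.2) v x) +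
      (v z.1 * (\sum_(x <- z.2) u x) +
      (\sum_(x <- z.2) u x) * (\sum_(x <- z.2) v x))).
  by apply/funext => z; rewrite /= !big_cons; lra.
have i1 := int_fst (iid_law P n) iuv.
have i2 := int_tensor u1 sv1.
have i3 := int_tensor v1 su1.
have i4 := int_snd P isuv.
rewrite (iid_int eF _ _).2.
- rewrite RintegralD//; [|exact: intD|exact: intD].
  rewrite RintegralD// RintegralD//.
  rewrite (Rintegral_fst _ iuv) (Rintegral_tensor u1 sv1) (Rintegral_tensor v1 su1).
  rewrite (Rintegral_snd _ isuv) IH !Rintegral_lsum// -natr1; lra.
- by apply: measurable_funM; apply: measurable_lsum;
    [exact: L2_measurable u2|exact: L2_measurable v2].
- by apply: intD; apply: intD.
Qed.

Lemma L2_pair_sum n (I : Type) (s : seq I) (u : I -> T -> R) :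
  (forall l, u l \in Lfun P 2%:E) ->
  (fun z : n.-tuple T => pair_sum (fun x y => \sum_(l <- s) u l x * u l y) z)
    \in Lfun (iid_law P n) 2%:E.
Proof.
move=> u2; elim: n => [|n IH].
  rewrite (_ : (fun _ => _) = fun=> 0); first exact: L2_cst.
  by apply/funext => z; rewrite tuple0.
apply: iid_L2.
  by apply: measurable_pair_sum => l; exact: L2_measurable (u2 l).
rewrite [X in X \in _](_ : _ = fun z : T * n.-tuple T =>
    (\sum_(l <- s) u l z.1 * \sum_(x <- z.2) u l x) +
    pair_sum (fun x y => \sum_(l <- s) u l x * u l y) z.2).
  apply: L2D; last exact: L2_snd IH.
  by apply: L2_sum => l; exact: (L2_tensor (u2 l) (L2_lsum n (u2 l))).
apply/funext => z /=; rewrite exchange_big/=; congr (_ + _).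
by apply: eq_bigr => l _; rewrite mulr_sumr.
Qed.

(** The factors are centred, so distinct pairs of observations are orthogonal:
    of the square of the sum only the [n choose 2] diagonal terms remain. *)
Lemma Rintegral_pair_sum_sqr n (I : Type) (s : seq I) (u : I -> T -> R) :
  (forall l, u l \in Lfun P 2%:E) -> (forall l, \int[P]_x u l x = 0) ->
  \int[iid_law P n]_z
    (pair_sum (fun x y => \sum_(l <- s) u l x * u l y) z) ^+ 2 =
  'C(n, 2)%:R * \sum_(l <- s) \sum_(m <- s) (\int[P]_x (u l x * u m x)) ^+ 2.
Proof.
move=> u2 u0; set W := pair_sum _; elim: n => [|n IH].
  rewrite bin0n mul0r -[RHS](Rintegral_1 (iid_law P 0)).
  by apply: eq_Rintegral => z _; rewrite tuple0 /W/= expr0n.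
have u1 l := L2_int (u2 l).
have r2 l := L2_lsum n (u2 l).
have r1 l := L2_int (r2 l).
have w2 : (fun z : n.-tuple T => W z) \in Lfun (iid_law P n) 2%:E.
  exact: L2_pair_sum.
pose Rl l (z : n.-tuple T) := \sum_(x <- z) u l x.
have eF : (fun z : n.+1.-tuple T => W z ^+ 2) \o @tuple_cons d T n =
    (fun z : T * n.-tuple T =>
      (\sum_(l <- s) \sum_(m <- s) (u l z.1 * u m z.1) * (Rl l z.2 * Rl m z.2)
       + \sum_(l <- s) u l z.1 * (2 * (Rl l z.2 * W z.2))) + W z.2 * W z.2).
  apply/funext => z; rewrite /comp /W /= -/W.
  have -> : \sum_(y <- z.2) \sum_(l <- s) u l z.1 * u l y =
      \sum_(l <- s) u l z.1 * Rl l z.2.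
    by rewrite exchange_big/=; apply: eq_bigr => l _; rewrite mulr_sumr.
  have -> : \sum_(l <- s) \sum_(m <- s) u l z.1 * u m z.1 * (Rl l z.2 * Rl m z.2)
      = (\sum_(l <- s) u l z.1 * Rl l z.2) ^+ 2.
    rewrite expr2 mulr_suml; apply: eq_bigr => l _.
    by rewrite mulr_sumr; apply: eq_bigr => m _; rewrite mulrACA.
  have -> : \sum_(l <- s) u l z.1 * (2 * (Rl l z.2 * W z.2)) =
      2 * W z.2 * \sum_(l <- s) u l z.1 * Rl l z.2.
    by rewrite mulr_sumr; apply: eq_bigr => l _; lra.
  lra.
have iA l m := int_tensor (L2_intM (u2 l) (u2 m)) (L2_intM (r2 l) (r2 m)).
have iB l := int_tensor (u1 l) (intZ 2 (L2_intM (r2 l) w2)).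
have iC := int_snd P (L2_intM w2 w2).
have iA' : (P \x iid_law P n)%E.-integrable setT (EFin \o (fun z : T * n.-tuple T =>
    \sum_(l <- s) \sum_(m <- s) (u l z.1 * u m z.1) * (Rl l z.2 * Rl m z.2))).
  by apply: int_sum => l; apply: int_sum => m; exact: iA.
have iB' : (P \x iid_law P n)%E.-integrable setT (EFin \o (fun z : T * n.-tuple T =>
    \sum_(l <- s) u l z.1 * (2 * (Rl l z.2 * W z.2)))).
  by apply: int_sum => l; exact: iB.
rewrite (iid_int eF _ _).2; first last.
- by apply: intD => //; apply: intD.
- apply: measurable_funX; apply: measurable_pair_sum => l.
  exact: L2_measurable (u2 l).
rewrite RintegralD//; last by apply: intD.
rewrite RintegralD// (Rintegral_snd P (L2_intM w2 w2)).
under [X in _ + X]eq_Rintegral do rewrite -expr2.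
rewrite IH Rintegral_sum; last by move=> l; apply: int_sum => m; exact: iA.
rewrite [X in _ + X + _]Rintegral_sum; last by move=> l; exact: iB.
rewrite [X in _ + X + _]big1 ?addr0; last first.
  by move=> l _; rewrite (Rintegral_tensor (u1 l) (intZ 2 (L2_intM (r2 l) w2))) u0 mul0r.
rewrite binS bin1 natrD mulrDl addrC; congr (_ + _).
rewrite mulr_sumr; apply: eq_bigr => l _.
rewrite Rintegral_sum ?mulr_sumr; last by move=> m; exact: iA.
apply: eq_bigr => m _.
rewrite (Rintegral_tensor (L2_intM (u2 l) (u2 m)) (L2_intM (r2 l) (r2 m))).
by rewrite Rintegral_lsumM// !u0; lra.
Qed.

End IIDMoments.

(** * Gaussian shifts and moments *)

Section Density.
Context {d : measure_display} {T : measurableType d} {R : realType}.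
Variables (mu nu : {measure set T -> \bar R}) (p : T -> R).
Hypothesis p0 : forall x, 0 <= p x.
Hypothesis mp : measurable_fun setT p.
Hypothesis nuE : forall A, measurable A -> nu A = (\int[mu]_(x in A) (p x)%:E)%E.

Import HBNNSimple.

Let density_nnsfun (h : {nnsfun T >-> R}) :
  (\int[nu]_x (h x)%:E = \int[mu]_x ((h x)%:E * (p x)%:E))%E.
Proof.
transitivity (\int[nu]_x (\sum_(y \in range h) (y * \1_(h @^-1` [set y]) x)%:E))%E.
  by apply: eq_integral => x _; rewrite fsumEFin// -fimfunE.
transitivity (\int[mu]_x (\sum_(y \in range h)
    ((y * \1_(h @^-1` [set y]) x)%:E * (p x)%:E)))%E; last first.
  apply: eq_integral => x _; rewrite -ge0_mule_fsuml.
    by rewrite fsumEFin// -fimfunE.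
  by move=> y; exact: nnfun_muleindic_ge0.
have mI y : measurable_fun setT (fun x => (y * \1_(h @^-1` [set y]) x)%:E).
  by apply/measurable_EFinP; exact: measurable_funM.
rewrite !ge0_integral_fsum//.
- apply: eq_fsbigr => y _.
  rewrite integralZl_indic_nnsfun// integral_indic// setIT nuE//.
  transitivity (\int[mu]_x (y%:E * ((p x)%:E * (\1_(h @^-1` [set y]) x)%:E)))%E; last first.
    by apply: eq_integral => x _; rewrite EFinM -muleA [(_%:E * (p x)%:E)%E]muleC.
  have [y0|yn0] := ltP y 0.
    have -> : h @^-1` [set y] = set0.
      by apply/seteqP; split => // x /= hx; move: y0; rewrite -hx ltNge fun_ge0.
    rewrite integral_set0 mule0 integral0_eq// => x _.
    by rewrite indic0 mule0 mule0.
  rewrite ge0_integralZl//; last first.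
  - by move=> x _; rewrite mule_ge0 ?lee_fin.
  - by apply: emeasurable_funM; apply/measurable_EFinP.
  congr (_ * _)%E; rewrite integral_mkcond; apply: eq_integral => x _.
  by rewrite patchE indicE; case: ifPn => _; rewrite ?mule1 ?mule0.
- by move=> y; apply: emeasurable_funM => //; exact/measurable_EFinP.
- by move=> y x _; apply: mule_ge0; [exact: nnfun_muleindic_ge0|rewrite lee_fin].
- by move=> y x _; exact: nnfun_muleindic_ge0.
Qed.

(** The hypothesis on measurable sets is the case of indicators; it extends to
    simple functions by linearity and to nonnegative functions by monotone
    convergence. *)
Lemma ge0_integral_density (g : T -> \bar R) :
  measurable_fun setT g -> (forall x, 0 <= g x)%E ->
  (\int[nu]_x g x = \int[mu]_x (g x * (p x)%:E))%E.
Proof.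
move=> mg g0.
pose h := nnsfun_approx measurableT mg.
have gE x : g x = lim ((h n x)%:E @[n --> \oo]).
  by apply/esym/cvg_lim => //; exact: cvg_nnsfun_approx.
transitivity (lim (\int[nu]_x (h n x)%:E @[n --> \oo])%E).
  rewrite -monotone_convergence//=.
  - by apply: eq_integral => x _.
  - by move=> n; exact/measurable_EFinP/measurable_funTS.
  - by move=> n x _; rewrite lee_fin.
  - by move=> x _ a b ab; rewrite lee_fin; exact/lefP/nd_nnsfun_approx.
transitivity (lim (\int[mu]_x ((h n x)%:E * (p x)%:E) @[n --> \oo])%E).
  by apply: congr_lim; apply/funext => n; exact: density_nnsfun.
rewrite -monotone_convergence//=.
- apply: eq_integral => x _; apply/cvg_lim => //; apply: cvgeZr => //.
  exact: cvg_nnsfun_approx.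
- by move=> n; apply: emeasurable_funM; exact/measurable_EFinP.
- by move=> n x _; rewrite mule_ge0 ?lee_fin.
- by move=> x _ a b ab; rewrite lee_wpmul2r ?lee_fin//; exact/lefP/nd_nnsfun_approx.
Qed.

End Density.

Section Gauss.
Context {R : realType}.
Notation gauss := (normal_prob (0%R : R) 1%R).

Lemma lebesgue_measure_shift (a : R) (A : set (measurableTypeR R)) :
  measurable A -> lebesgue_measure A =
  pushforward lebesgue_measure
    ((fun x : R => x + a) : measurableTypeR R -> measurableTypeR R) A.
Proof.
have ma : measurable_fun setT
    ((fun x : R => x + a) : measurableTypeR R -> measurableTypeR R).
  exact: measurable_funD.
pose f : {mfun (measurableTypeR R) >-> (measurableTypeR R)} :=
  HB.pack (fun x : R => x + a) (isMeasurableFun.Build _ _ _ _ _ ma).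
apply: (@lebesgue_measure_unique R (pushforward lebesgue_measure f)) => _ [[u v]] _ <-.
have fE : f @^-1` `]u, v] = `](u - a), (v - a)]%classic.
  by apply/seteqP; split => x /=; rewrite !in_itv/= ltrBlDr lerBrDr.
rewrite -[RHS]/(lebesgue_measure (f @^-1` `]u, v]%classic)) fE.
rewrite !lebesgue_measure_itv/= !lte_fin ltrD2r; case: ifP => // _.
by rewrite -!EFinD; congr (_%:E); lra.
Qed.

Lemma normal_pdf1E (a x : R) :
  normal_pdf a 1 x = normal_peak 1 * expR (- (x - a) ^+ 2 / 2).
Proof. by rewrite normal_pdfE ?oner_eq0// /normal_fun expr1n. Qed.

Lemma gauss_density (g : R -> \bar R) : measurable_fun setT g ->
  (forall x, 0 <= g x)%E ->
  (\int[gauss]_x g x =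
   \int[lebesgue_measure]_x (g x * (normal_pdf 0 1 x)%:E))%E.
Proof.
move=> mg g0; apply: ge0_integral_density => //.
- by move=> x; exact: normal_pdf_ge0.
- exact: measurable_normal_pdf.
Qed.

Lemma ge0_integral_shift (a : R) (h : R -> \bar R) : measurable_fun setT h ->
  (forall x, 0 <= h x)%E ->
  (\int[lebesgue_measure]_x h (x + a)%R = \int[lebesgue_measure]_x h x)%E.
Proof.
move=> mh h0.
have ma : measurable_fun setT
    ((fun x : R => x + a) : measurableTypeR R -> measurableTypeR R).
  exact: measurable_funD.
pose f : {mfun (measurableTypeR R) >-> (measurableTypeR R)} :=
  HB.pack (fun x : R => x + a) (isMeasurableFun.Build _ _ _ _ _ ma).
rewrite [RHS](eq_measure_integral (pushforward lebesgue_measure f)); last first.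
  by move=> A mA _; exact: lebesgue_measure_shift.
by rewrite ge0_integral_pushforward.
Qed.

(** The Cameron-Martin formula in dimension one: the weight on the right is
    the likelihood ratio of the normal laws with means [a] and [0]. *)
Lemma gauss_shift (a : R) (g : R -> \bar R) : measurable_fun setT g ->
  (forall x, 0 <= g x)%E ->
  (\int[gauss]_x g (x + a)%R =
   \int[gauss]_x (g x * (expR (x * a - a ^+ 2 / 2))%:E))%E.
Proof.
move=> mg g0.
have mga : measurable_fun setT (fun x : R => g (x + a)).
  by apply: measurableT_comp => //; exact: measurable_funD.
have me : measurable_fun setT (fun x : R => expR (x * a - a ^+ 2 / 2)).
  apply: measurableT_comp => //; apply: measurable_funB => //.
  exact: measurable_funM.
rewrite gauss_density//.
rewrite gauss_density; last 2 first.
- by apply: emeasurable_funM => //; exact/measurable_EFinP.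
- by move=> x; rewrite mule_ge0// lee_fin expR_ge0.
have mp x : measurable_fun setT (fun y : R => (normal_pdf x 1 y)%:E).
  by apply/measurable_EFinP; exact: measurable_normal_pdf.
transitivity (\int[lebesgue_measure]_x (g x * (normal_pdf a 1 x)%:E))%E.
  rewrite -(ge0_integral_shift a (h := fun x => g x * (normal_pdf a 1 x)%:E))%E.
  - by apply: eq_integral => x _; rewrite !normal_pdf1E addrK subr0.
  - exact: (emeasurable_funM mg (mp a)).
  - by move=> y; rewrite mule_ge0// lee_fin normal_pdf_ge0.
apply: eq_integral => x _; rewrite -muleA -EFinM; congr (_ * _%:E)%E.
rewrite !normal_pdf1E mulrCA -expRD.
by congr (_ * expR _); lra.
Qed.

Lemma gauss_mgf (a : R) :
  (\int[gauss]_x (expR (x * a))%:E = (expR (a ^+ 2 / 2))%:E)%E.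
Proof.
have e1 : (\int[gauss]_x (expR (x * a - a ^+ 2 / 2))%:E = 1)%E.
  transitivity (\int[gauss]_x (1 * (expR (x * a - a ^+ 2 / 2))%:E))%E.
    by apply: eq_integral => x _; rewrite mul1e.
  rewrite -(@gauss_shift a (fun=> 1%E))//.
  by rewrite integral_cst//= probability_setT mule1.
have me b : measurable_fun setT (fun x : R => (expR (x * a - b))%:E).
  apply/measurable_EFinP; apply: measurableT_comp => //; apply: measurable_funB => //.
  exact: measurable_funM.
transitivity (\int[gauss]_x
    ((expR (a ^+ 2 / 2))%:E * (expR (x * a - a ^+ 2 / 2))%:E))%E.
  by apply: eq_integral => x _; rewrite -EFinM -expRD addrC subrK.
rewrite ge0_integralZl// ?lee_fin ?expR_ge0//; first by rewrite e1 mule1.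
exact: me.
Qed.

Lemma gauss_exp_int (a : R) : gauss.-integrable setT (fun x => (expR (x * a))%:E).
Proof.
apply/integrableP; split.
  by apply/measurable_EFinP; apply: measurableT_comp => //; exact: measurable_funM.
under eq_integral do rewrite gee0_abs ?lee_fin ?expR_ge0//.
by rewrite gauss_mgf ltry.
Qed.

Lemma Rgauss_mgf (a : R) : \int[gauss]_x (expR (x * a)) = expR (a ^+ 2 / 2).
Proof. by rewrite /Rintegral gauss_mgf. Qed.

(** Dominating the square by exponentials reduces moments to the moment
    generating function. *)
Lemma sqr_le_expR (x : R) : x ^+ 2 <= 2 * (expR (x * 1) + expR (x * (-1))) - 2.
Proof.
wlog x0 : x / 0 <= x => [H|].
  have [/H//|x0] := leP 0 x.
  by have := H (- x) _; rewrite sqrrN !mulr1 !mulrN1 opprK oppr_ge0 => /(_ (ltW x0)); lra.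
have := @expR_ge1Dxn _ x 1 x0; rewrite (_ : (2`!)%:R = 2)// mulr1.
by have := expR_ge0 (x * -1); lra.
Qed.

Lemma expR_half_le2 : expR (1 / 2 : R) <= 2.
Proof.
have := expR_ge1Dx (- (1 / 2) : R); rewrite expRN => h.
have e0 := expR_gt0 (1 / 2 : R).
by have := ler_wpM2l (ltW e0) h; rewrite divff ?gt_eqF//; lra.
Qed.

Lemma gauss_L2 : (fun x : R => x) \in Lfun gauss 2%:E.
Proof.
apply: L2P => //.
have i3 := intZ 2 (intD (gauss_exp_int 1) (gauss_exp_int (-1))).
apply: le_integrable i3 => //=.
- by apply/measurable_EFinP; exact: measurable_funM.
- move=> x _; rewrite lee_fin -expr2.
  rewrite !ger0_norm ?sqr_ge0 ?mulr_ge0 ?addr_ge0 ?expR_ge0//.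
  by have := sqr_le_expR x; lra.
Qed.

(** The second moment enters only through constants, so any absolute bound
    serves, and this one comes from the moment generating function. *)
Lemma gauss_second_moment : 0 <= \int[gauss]_x (x ^+ 2) <= 6.
Proof.
apply/andP; split; first by apply: Rintegral_ge0 => x _; exact: sqr_ge0.
have i1 := gauss_exp_int 1; have i2 := gauss_exp_int (-1).
have i0 := L2_int (L2_cst gauss (-2)).
apply: (@le_trans _ _ (\int[gauss]_x
    (2 * (expR (x * 1) + expR (x * (-1))) + (- 2)))).
  apply: le_Rintegral => //.
  - by under eq_fun do rewrite expr2; exact: (L2_intM gauss_L2 gauss_L2).
  - by apply: intD => //; apply: intZ; exact: intD.
  - by move=> x _; exact: sqr_le_expR.
rewrite RintegralD//; last by apply: intZ; exact: intD.
rewrite Rintegral_1 RintegralZl//; last exact: intD.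
rewrite RintegralD// !Rgauss_mgf sqrrN expr1n.
by have := expR_half_le2; lra.
Qed.

(** Since [1 + b * x <= expR (b * x)], the moment generating function bounds
    [b * m] by a multiple of [b ^ 2], where [m] is the mean. Small [b] of
    either sign forces [m = 0]. *)
Lemma gauss_mean : \int[gauss]_x x = 0.
Proof.
set m := \int[gauss]_x x.
have H (b : R) : b ^+ 2 < 2 -> (1 + b * m) * (1 - b ^+ 2 / 2) <= 1.
  move=> b2.
  have : 1 + b * m <= expR (b ^+ 2 / 2).
    rewrite -Rgauss_mgf -RintegralZl//; last exact: L2_int gauss_L2.
    have ib := intZ b (L2_int gauss_L2); have i1 := L2_int (L2_cst gauss 1).
    rewrite -[1 in X in X + _](Rintegral_1 gauss) -RintegralD//.
    apply: le_Rintegral => //; first exact: intD.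
      exact: gauss_exp_int.
    by move=> x _; rewrite (mulrC b); exact: expR_ge1Dx.
  have := expR_ge1Dx (- (b ^+ 2 / 2)); rewrite expRN => h1 h2.
  have e0 := expR_gt0 (b ^+ 2 / 2).
  apply: le_trans (ler_wpM2r _ h2) _; first lra.
  by rewrite -ler_pdivlMl// mulr1.
have small (a : R) : 0 < a -> a <= 1 -> `|m| <= a.
  move=> a0 a1; rewrite ler_norml.
  have a2 : a ^+ 2 <= 1 by rewrite expr_le1// ltW.
  have := H a; have := H (- a); rewrite sqrrN => h1 h2.
  have {}h1 := h1 ltac:(lra); have {}h2 := h2 ltac:(lra).
  have k x : (1 + a * x) * (1 - a ^+ 2 / 2) <= 1 -> x <= a.
    move=> h; have : a * (x * (1 - a ^+ 2 / 2)) <= a * (a / 2) by lra.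
    rewrite ler_pM2l// => {}h; have [x0|x0] := leP x 0; first lra.
    by have := mulr_ge0 (ltW x0) (_ : 0 <= 1 / 2 - a ^+ 2 / 2); lra.
  have := k m h2; have := k (- m); rewrite mulrN -mulNr => /(_ h1); lra.
apply/eqP/negPn/negP => m0.
have := small (Num.min 1 (`|m| / 2)).
rewrite lt_min ltr01 /= divr_gt0 ?normr_gt0//= ge_min lexx => /(_ isT isT).
rewrite leNgt gt_min.
have m1 : 0 < `|m| by rewrite normr_gt0.
by rewrite (_ : `|m| / 2 < `|m|) ?orbT//; lra.
Qed.

End Gauss.

(** * Moments of the scores and of the test statistic *)

Section RealLemmas.
Context {R : realType}.

(** The arithmetic-geometric mean inequality without square roots. *)
Lemma ler_mean_of_sqr (c p q : R) : 0 <= p -> 0 <= q -> c ^+ 2 <= p * q ->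
  c <= (p + q) / 2.
Proof.
move=> p0 q0 h; rewrite real_leNgt ?num_real//; apply/negP => h1.
have := sqr_ge0 (p - q) => h2.
have : ((p + q) / 2) ^+ 2 < c ^+ 2.
  by rewrite ltrXn2r// ?nnegrE; lra.
lra.
Qed.

Lemma natr_bin2 n : 'C(n, 2)%:R = n%:R * (n%:R - 1) / 2 :> R.
Proof.
case: n => [|n]; first by rewrite !mul0r.
rewrite -[in n.+1%:R - 1]natr1 addrK -natrM.
have -> : (n.+1 * n = 'C(n.+1, 2) * 2)%N by rewrite bin_ffact ffactnS ffactn1.
by rewrite natrM mulfK.
Qed.

Lemma sum_delta n : \sum_(i < n) \sum_(j < n) (i == j)%:R = n%:R :> R.
Proof.
rewrite -[in RHS](card_ord n) -sumr_const; apply: eq_bigr => i _.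
rewrite (bigD1 i)//= eqxx big1 ?addr0// => j ji.
by rewrite eq_sym (negbTE ji).
Qed.

(** The arithmetic that turns the second moments [IV] of the linear part and
    [IW] of the degenerate part into the variance bound. Here [m] is the
    sample size and [a / m] the normalisation of the statistic. *)
Lemma variance_arith (a m N F tau IV IW : R) : a ^+ 2 * N = 2 -> 1 <= N ->
  1 <= m -> 0 <= F -> tau <= F -> 0 <= IV ->
  IV <= m * (tau * (6 + N * F)) ->
  IW <= m * (m - 1) / 2 * (3 * ((N * F) ^+ 2 + 36 * N + F ^+ 2)) ->
  2 * (a / m) ^+ 2 * (m - 1) ^+ 2 * IV + 2 * (a / m) ^+ 2 * IW <=
  24 * (m * F / N) + 4 * (m * F ^+ 2) + 12 * (N * F ^+ 2) + 216.
Proof.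
move=> aN N1 m1 F0 tauF IV0 EV EW.
have N0 : 0 < N by exact: lt_le_trans N1.
have m0 : 0 < m by exact: lt_le_trans m1.
have NF0 : 0 <= N * F by rewrite mulr_ge0// ltW.
have NiN : N * N^-1 = 1 by rewrite divff// gt_eqF.
have iN1 : N^-1 <= 1 by rewrite invf_le1.
have bE : (a / m) ^+ 2 * m ^+ 2 = 2 * N^-1.
  by rewrite -exprMn divfK ?gt_eqF// -aN mulfK// gt_eqF.
have FF := sqr_ge0 F.
set b := (a / m) ^+ 2 in bE *; set iN := N^-1 in NiN iN1 bE *.
have b0 : 0 <= b by exact: sqr_ge0.
set Q := 3 * _ in EW.
have Q0 : 0 <= Q by rewrite mulr_ge0// !addr_ge0 ?sqr_ge0// mulr_ge0// ltW.
have h1 : b * (m - 1) ^+ 2 * IV <= 2 * iN * (m * (F * (6 + N * F))).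
  apply: ler_pM => //; first by rewrite mulr_ge0 ?sqr_ge0.
    by rewrite -bE; apply: ler_wpM2l => //; clear - m1; lra.
  apply: le_trans EV _; apply: ler_wpM2l; first exact: ltW.
  by apply: ler_wpM2r => //; clear - NF0; lra.
have h2 : 2 * (b * IW) <= 2 * iN * Q.
  apply: le_trans (_ : 2 * (b * (m * (m - 1) / 2 * Q)) <= _).
    by rewrite ler_pM2l// ler_wpM2l.
  rewrite -bE.
  have := mulr_ge0 (mulr_ge0 b0 (ltW m0)) Q0; clear; lra.
have e1 : iN * (m * (F * (N * F))) = m * F ^+ 2.
  by transitivity ((N * iN) * (m * F ^+ 2)); [clear; lra|rewrite NiN mul1r].
have e2 : iN * (N * F) ^+ 2 = N * F ^+ 2.
  by transitivity ((N * iN) * (N * F ^+ 2)); [clear; lra|rewrite NiN mul1r].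
have e3 : iN * F ^+ 2 <= N * F ^+ 2.
  by apply: ler_wpM2r => //; exact: le_trans iN1 N1.
move: h1 h2; rewrite /Q; clear - NiN e1 e2 e3; lra.
Qed.

End RealLemmas.

Section CauchySchwarz.
Context {d : measure_display} {T : measurableType d} {R : realType}.
Variable P : probability T R.

(** The quadratic function [x |-> x ^ 2 * A + 2 * x * B + C] is the integral
    of a square. It is evaluated at its minimum, or, if [A = 0], at a point
    where it would be negative unless [B = 0]. *)
Lemma Rintegral_cauchy_schwarz (f g : T -> R) : f \in Lfun P 2%:E -> g \in Lfun P 2%:E ->
  (\int[P]_x (f x * g x)) ^+ 2 <=
  (\int[P]_x (f x * f x)) * \int[P]_x (g x * g x).
Proof.
move=> f2 g2.
set A := \int[P]_x (f x * f x); set B := \int[P]_x (f x * g x).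
set C := \int[P]_x (g x * g x).
have q x : 0 <= x ^+ 2 * A + 2 * x * B + C.
  have := @Rintegral_ge0 _ _ _ P setT (fun t => (x * f t + g t) ^+ 2)
    (fun t _ => sqr_ge0 _).
  congr (_ <= _).
  rewrite (_ : (fun t => _) = (fun t => x ^+ 2 * (f t * f t) +
      2 * x * (f t * g t) + g t * g t)); last by apply/funext => t; lra.
  have iA := L2_intM f2 f2; have iB := L2_intM f2 g2; have iC := L2_intM g2 g2.
  rewrite RintegralD//; last by apply: intD; exact: intZ.
  by rewrite RintegralD ?RintegralZl//; exact: intZ.
have A0 : 0 <= A by apply: Rintegral_ge0 => x _; rewrite -expr2 sqr_ge0.
have [Az|An] := eqVneq A 0.
  have [->|Bn] := eqVneq B 0; first by rewrite expr0n/= Az mul0r.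
  have := q (- (C + 1) / (2 * B)); rewrite Az mulr0 add0r.
  rewrite (_ : 2 * (- (C + 1) / (2 * B)) * B = - (C + 1)); first by lra.
  transitivity (- (C + 1) * ((2 * B)^-1 * (2 * B))); first by lra.
  by rewrite mulVf ?mulr1// mulf_neq0.
have Ap : 0 < A by rewrite lt_def An.
have := q (- B / A); rewrite -(pmulr_rge0 _ Ap).
rewrite (_ : A * _ = A * C - B ^+ 2); first by rewrite subr_ge0.
have Ai : A * A^-1 = 1 by rewrite divff// gt_eqF.
transitivity ((A * A^-1) ^+ 2 * B ^+ 2 - 2 * (A * A^-1) * B ^+ 2 + A * C).
  by lra.
by rewrite Ai; lra.
Qed.

End CauchySchwarz.

Section SignalMoments.
Context {d : measure_display} {T : measurableType d} {R : realType}.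
Variable mu : probability T R.
Variables (N : nat) (phi : 'I_N -> T -> R).
Hypothesis phi2 : forall i, phi i \in Lfun mu 2%:E.
Hypothesis phiO : forall i j, \int[mu]_t (phi i t * phi j t) = (i == j)%:R.
Hypothesis phiN : {ae mu, forall t, \sum_i phi i t ^+ 2 = N%:R}.

(** The constant sum of squares makes each [phi i] essentially bounded. *)
Lemma mul_phi_L2 g i : g \in Lfun mu 2%:E ->
  (fun t => g t * phi i t) \in Lfun mu 2%:E.
Proof.
move=> g2; have mg := L2_measurable g2; have mi := L2_measurable (phi2 i).
apply: L2P; first exact: measurable_funM.
have iN := intZ N%:R (L2_intM g2 g2).
have mm : measurable_fun setT (fun t => (g t * phi i t) * (g t * phi i t)).
  by apply: measurable_funM; exact: measurable_funM.
case/integrableP: (iN) => _ Noo; apply/integrableP; split.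
  exact/measurable_EFinP.
apply: le_lt_trans Noo; apply: ae_ge0_le_integral => //=.
- by apply/measurable_EFinP; exact: measurableT_comp mm.
- apply/measurable_EFinP; apply: measurableT_comp => //.
  by apply/measurable_EFinP; exact: measurable_int iN.
apply: filterS phiN => t eN _; rewrite lee_fin.
rewrite !ger0_norm; [|by rewrite mulr_ge0// -expr2 sqr_ge0|
  by rewrite -expr2 sqr_ge0].
rewrite -eN mulrACA -!expr2 mulrC ler_wpM2r ?sqr_ge0//.
by rewrite (bigD1 i)//= lerDl sumr_ge0// => j _; exact: sqr_ge0.
Qed.

(** The trace of the matrix [B] below. All the second moments of the scores
    are bounded through it. *)
Lemma phi_energy g : g \in Lfun mu 2%:E ->
  \sum_i \int[mu]_t ((g t * phi i t) * (g t * phi i t)) =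
  N%:R * \int[mu]_t (g t * g t).
Proof.
move=> g2; have i1 i := L2_intM (mul_phi_L2 i g2) (mul_phi_L2 i g2).
rewrite -Rintegral_sum// -RintegralZl//; last exact: L2_intM.
congr fine; apply: ae_eq_integral => //=.
- exact: measurable_int (int_sum _ i1).
- exact: measurable_int (intZ N%:R (L2_intM g2 g2)).
apply: filterS phiN => t eN _; congr (_%:E).
by rewrite -eN mulr_suml; apply: eq_bigr => i _; lra.
Qed.

Variable f : T -> R.
Hypothesis f2 : f \in Lfun mu 2%:E.

Let th i := \int[mu]_t (f t * phi i t).
Let F := \int[mu]_t (f t * f t).

(** Pythagoras for the projection on the span of the [phi i]. *)
Lemma residual_energy : \int[mu]_t ((f t - \sum_i th i * phi i t) *
  (f t - \sum_i th i * phi i t)) = F - \sum_i th i ^+ 2.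
Proof.
have s2 : (fun t => \sum_i th i * phi i t) \in Lfun mu 2%:E.
  by apply: L2_sum => i; exact: L2Z.
have is2 := L2_intM s2 s2; have ifs := L2_intM f2 s2; have iff := L2_intM f2 f2.
have e1 : \int[mu]_t (f t * \sum_i th i * phi i t) = \sum_i th i ^+ 2.
  under eq_Rintegral do rewrite mulr_sumr.
  under eq_Rintegral do under eq_bigr do rewrite mulrCA.
  have i1 i := intZ (th i) (L2_intM f2 (phi2 i)).
  rewrite Rintegral_sum//; apply: eq_bigr => i _.
  by rewrite RintegralZl//; exact: L2_intM.
have e2 : \int[mu]_t ((\sum_i th i * phi i t) * \sum_i th i * phi i t) =
    \sum_i th i ^+ 2.
  have i1 i j := intZ (th i * th j) (L2_intM (phi2 i) (phi2 j)).
  under eq_Rintegral do rewrite mulr_suml.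
  under eq_Rintegral do under eq_bigr do rewrite mulr_sumr.
  under eq_Rintegral do under eq_bigr do under eq_bigr do rewrite mulrACA.
  rewrite Rintegral_sum; last by move=> i; exact: int_sum.
  apply: eq_bigr => i _; rewrite Rintegral_sum// (bigD1 i)//= big1 ?addr0.
    by rewrite RintegralZl ?phiO ?eqxx ?mulr1//; exact: L2_intM.
  move=> j ji; rewrite RintegralZl ?phiO//; last exact: L2_intM.
  by rewrite eq_sym (negbTE ji) mulr0.
have i2 := intZ (-2) ifs.
have i3 := intD i2 is2.
transitivity (F + (- 2 * (\sum_i th i ^+ 2) + \sum_i th i ^+ 2)); last by lra.
rewrite -[X in _ + (_ + X)]e2 -[X in _ * X]e1 -RintegralZl// -RintegralD//.
rewrite -RintegralD//.
by apply: eq_Rintegral => t _; lra.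
Qed.

Lemma bessel : \sum_i th i ^+ 2 <= F.
Proof.
rewrite -subr_ge0 -residual_energy.
by apply: Rintegral_ge0 => t _; rewrite -expr2 sqr_ge0.
Qed.

Let B i j := \int[mu]_t ((f t * phi i t) * (f t * phi j t)).

Let B_ge0 i : 0 <= B i i.
Proof. by apply: Rintegral_ge0 => t _; rewrite -expr2 sqr_ge0. Qed.

Let B_CS i j : B i j ^+ 2 <= B i i * B j j.
Proof. by apply: Rintegral_cauchy_schwarz; exact: mul_phi_L2. Qed.

Lemma sum_cross_energy_sqr : \sum_i \sum_j B i j ^+ 2 <= (N%:R * F) ^+ 2.
Proof.
rewrite -(phi_energy f2) expr2 mulr_suml; apply: ler_sum => i _.
by rewrite mulr_sumr; apply: ler_sum => j _; exact: B_CS.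
Qed.

(** By Cauchy-Schwarz [B i j ^ 2 <= B i i * B j j], so [B] acts on [th] at
    most like its trace. *)
Lemma cross_energy_form : \sum_i \sum_j (th i * th j) * B i j <= (\sum_i th i ^+ 2) * (N%:R * F).
Proof.
have h i j : (th i * th j) * B i j <= (th i ^+ 2 * B j j + th j ^+ 2 * B i i) / 2.
  apply: ler_mean_of_sqr; [by rewrite mulr_ge0 ?sqr_ge0 ?B_ge0|
    by rewrite mulr_ge0 ?sqr_ge0 ?B_ge0|].
  rewrite !exprMn [leRHS](_ : _ = th i ^+ 2 * th j ^+ 2 * (B i i * B j j)); last by lra.
  apply: ler_wpM2l; [by rewrite mulr_ge0 ?sqr_ge0|exact: B_CS].
apply: le_trans (ler_sum _ (fun i _ => ler_sum _ (fun j _ => h i j))) _.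
rewrite -(phi_energy f2).
under eq_bigr do rewrite -mulr_suml big_split/= -mulr_sumr -mulr_suml.
rewrite -mulr_suml big_split/= -mulr_suml -mulr_sumr.
by rewrite le_eqVlt; apply/orP; left; apply/eqP; lra.
Qed.

Notation gauss := (normal_prob (0%R : R) 1%R).
Notation obs := ((measurableTypeR R * T)%type).
Let P := (gauss \x mu)%E.

(** The factors of the statistic: the contribution to the empirical
    coefficient [i] of an observation with noise [v.1] and design point [v.2].
    *)
Definition score i (v : obs) : R := (f v.2 + v.1) * phi i v.2.

Lemma score_L2 i : score i \in Lfun P 2%:E.
Proof.
rewrite (_ : score i = fun v => f v.2 * phi i v.2 + v.1 * phi i v.2).
  apply: L2D; first exact: (L2_snd gauss (mul_phi_L2 i f2)).
  exact: (L2_tensor (@gauss_L2 R) (phi2 i)).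
by apply/funext => v; rewrite /score mulrDl.
Qed.

Lemma score_mean i : \int[P]_v score i v = th i.
Proof.
have i1 := L2_int (mul_phi_L2 i f2).
have g1 := L2_int (@gauss_L2 R); have p1 := L2_int (phi2 i).
under eq_Rintegral do rewrite /score mulrDl.
rewrite RintegralD//; [|exact: (int_snd gauss i1)|exact: (int_tensor g1 p1)].
rewrite (Rintegral_snd gauss i1) (Rintegral_tensor g1 p1).
by rewrite gauss_mean mul0r addr0.
Qed.

Let sg := \int[gauss]_x (x * x).

Let sg_le : 0 <= sg <= 6.
Proof.
have := @gauss_second_moment R; rewrite /sg.
by under eq_Rintegral do rewrite expr2.
Qed.

Lemma score_second_moment i j :
  \int[P]_v (score i v * score j v) = B i j + sg * (i == j)%:R.
Proof.
have g1 := L2_int (@gauss_L2 R); have g2 := L2_intM (@gauss_L2 R) (@gauss_L2 R).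
have fij := L2_intM (mul_phi_L2 i f2) (mul_phi_L2 j f2).
have h1 := intZ 2 (L2_intM (mul_phi_L2 i f2) (phi2 j)).
have pij := L2_intM (phi2 i) (phi2 j).
have iA := int_snd gauss fij.
have iB := int_tensor g1 h1.
have iC := int_tensor g2 pij.
transitivity (\int[P]_v ((f v.2 * phi i v.2) * (f v.2 * phi j v.2) +
    (v.1 * (2 * ((f v.2 * phi i v.2) * phi j v.2)) +
     (v.1 * v.1) * (phi i v.2 * phi j v.2)))).
  by apply: eq_Rintegral => v _; rewrite /score; lra.
rewrite RintegralD//; last exact: intD.
rewrite RintegralD// (Rintegral_snd gauss fij) (Rintegral_tensor g1 h1).
by rewrite (Rintegral_tensor g2 pij) gauss_mean mul0r add0r phiO.
Qed.

Definition cscore i v := score i v - th i.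

Lemma cscore_L2 i : cscore i \in Lfun P 2%:E.
Proof. exact: L2B (score_L2 i) (L2_cst _ _). Qed.

Lemma cscore_mean i : \int[P]_v cscore i v = 0.
Proof.
have i1 := L2_int (score_L2 i); have i2 := L2_int (L2_cst P (th i)).
by rewrite (RintegralB _ i1 i2)// score_mean Rintegral_1 subrr.
Qed.

Lemma score_covariance i j : \int[P]_v (cscore i v * cscore j v) =
  B i j + sg * (i == j)%:R - th i * th j.
Proof.
have i2 := L2_intM (score_L2 i) (score_L2 j).
have i3 := intZ (- th j) (L2_int (score_L2 i)).
have i4 := intZ (- th i) (L2_int (score_L2 j)).
have i5 := L2_int (L2_cst P (th i * th j)).
have i34 := intD i3 i4; have i345 := intD i34 i5.
transitivity (\int[P]_v (score i v * score j v +
   ((- th j * score i v + - th i * score j v) + th i * th j))).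
  by apply: eq_Rintegral => v _; rewrite /cscore; lra.
have i1 k := L2_int (score_L2 k).
rewrite RintegralD// RintegralD// RintegralD// (RintegralZl _ _ (i1 i))//.
rewrite (RintegralZl _ _ (i1 j))//.
by rewrite !score_mean score_second_moment Rintegral_1; lra.
Qed.

Let tau := \sum_i th i ^+ 2.

(** The covariance matrix of the scores is [B + sg * I - th th^T]; the three
    Hilbert-Schmidt norms are bounded separately. *)
Lemma sum_covariance_sqr :
  \sum_i \sum_j (\int[P]_v (cscore i v * cscore j v)) ^+ 2 <=
  3 * ((N%:R * F) ^+ 2 + 36 * N%:R + F ^+ 2).
Proof.
have [sg0 sg6] := andP sg_le.
have h i j : (\int[P]_v (cscore i v * cscore j v)) ^+ 2 <=
    3 * (B i j ^+ 2 + (36 * (i == j)%:R + th i ^+ 2 * th j ^+ 2)).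
  rewrite score_covariance.
  have e : (sg * (i == j)%:R) ^+ 2 <= 36 * (i == j)%:R.
    case: eqP => _; last by rewrite !mulr0 expr0n.
    by rewrite !mulr1 (_ : 36 = 6 ^+ 2) ?lerXn2r ?nnegrE//; lra.
  move: e; set x := B i j; set y := sg * _; set z := th i; set w := th j.
  move=> e; have := sqr_ge0 (x - y); have := sqr_ge0 (x + z * w).
  have := sqr_ge0 (y + z * w); lra.
apply: le_trans (ler_sum _ (fun i _ => ler_sum _ (fun j _ => h i j))) _.
under eq_bigr do rewrite -mulr_sumr.
rewrite -mulr_sumr ler_pM2l//.
under eq_bigr do rewrite !big_split/= -!mulr_sumr.
rewrite !big_split/= -!mulr_sumr -mulr_suml -/tau.
rewrite sum_delta -addrA; apply: lerD; first exact: sum_cross_energy_sqr.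
apply: lerD => //; rewrite -expr2 lerXn2r ?nnegrE//; last exact: bessel.
  by apply: sumr_ge0 => i _; exact: sqr_ge0.
by apply: Rintegral_ge0 => t _; rewrite -expr2 sqr_ge0.
Qed.

(** The projection of the degree-two kernel on functions of a single
    observation. *)
Definition linear_part v := \sum_i th i * cscore i v.

Lemma linear_part_L2 : linear_part \in Lfun P 2%:E.
Proof. by apply: L2_sum => i; exact: L2Z (cscore_L2 i). Qed.

(** The term [th th^T] of the covariance only lowers the variance in the
    direction [th]; the two others are controlled by [cross_energy_form] and
    by the bound on the noise. *)
Lemma linear_part_sqr :
  \int[P]_v (linear_part v * linear_part v) <= tau * (6 + N%:R * F).
Proof.
have [sg0 sg6] := andP sg_le.
have i1 i j := intZ (th i * th j) (L2_intM (cscore_L2 i) (cscore_L2 j)).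
have -> : \int[P]_v (linear_part v * linear_part v) =
    \sum_i \sum_j (th i * th j) * \int[P]_v (cscore i v * cscore j v).
  transitivity (\int[P]_v \sum_i \sum_j
      (th i * th j) * (cscore i v * cscore j v)).
    apply: eq_Rintegral => v _; rewrite /linear_part mulr_suml.
    apply: eq_bigr => i _; rewrite mulr_sumr; apply: eq_bigr => j _.
    exact: mulrACA.
  rewrite Rintegral_sum; last by move=> i; exact: int_sum (i1 i).
  apply: eq_bigr => i _; rewrite Rintegral_sum; last exact: i1.
  apply: eq_bigr => j _; rewrite RintegralZl//.
  exact: L2_intM (cscore_L2 i) (cscore_L2 j).
apply: (@le_trans _ _ (\sum_i \sum_j ((th i * th j) * B i j +
    (6 * ((th i * th j) * (i == j)%:R) - th i ^+ 2 * th j ^+ 2)))).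
  apply: ler_sum => i _; apply: ler_sum => j _; rewrite score_covariance.
  have [->|] := eqVneq i j; last by move=> _; rewrite !mulr0; lra.
  have := ler_wpM2r (sqr_ge0 (th j)) sg6; rewrite !mulr1; lra.
under eq_bigr do rewrite big_split/= sumrB -!mulr_sumr.
rewrite big_split/= sumrB -!mulr_sumr -mulr_suml -/tau.
have -> : \sum_i \sum_j th i * th j * (i == j)%:R = tau.
  apply: eq_bigr => i _; rewrite (bigD1 i)//= eqxx mulr1 big1 ?addr0 ?expr2// => j ji.
  by rewrite eq_sym (negbTE ji) mulr0.
have := cross_energy_form; rewrite -/tau => h; have := sqr_ge0 tau.
lra.
Qed.

Definition U_score n (a : R) (w : n.-tuple obs) : R :=
  a / n%:R * pair_sum (fun x y => \sum_i score i x * score i y) w.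

Definition U_center n (a : R) : R := a / n%:R * ('C(n, 2)%:R * tau).

Lemma U_scoreB n a (w : n.-tuple obs) : U_score a w - U_center n a =
  a / n%:R * (n.-1%:R * \sum_(x <- w) linear_part x +
    pair_sum (fun x y => \sum_i cscore i x * cscore i y) w).
Proof.
rewrite /U_score /U_center (pair_sum_center _ _ th) size_tuple -/tau.
rewrite /linear_part /cscore; lra.
Qed.

Lemma U_score_L2 n a :
  (fun w => @U_score n a w - U_center n a) \in Lfun (iid_law P n) 2%:E.
Proof.
under eq_fun do rewrite U_scoreB.
apply: L2Z; apply: L2D; last exact: L2_pair_sum cscore_L2.
by apply: L2Z; apply: L2_lsum; exact: linear_part_L2.
Qed.

(** The square of the sum of the linear and the degenerate part is at most
    twice the sum of their squares, which leaves the two second moments. *)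
Lemma U_score_variance n a : (0 < n)%N -> a ^+ 2 * N%:R = 2 ->
  \int[iid_law P n]_w ((U_score a w - U_center n a) *
    (U_score a w - U_center n a)) <=
  24 * (n%:R * F / N%:R) + 4 * (n%:R * F ^+ 2) + 12 * (N%:R * F ^+ 2) + 216.
Proof.
move=> n0 aN.
pose V (w : n.-tuple obs) := \sum_(x <- w) linear_part x.
pose W (w : n.-tuple obs) := pair_sum (fun x y => \sum_i cscore i x * cscore i y) w.
have V2 : V \in Lfun (iid_law P n) 2%:E by exact: L2_lsum linear_part_L2.
have W2 : W \in Lfun (iid_law P n) 2%:E by exact: L2_pair_sum cscore_L2.
have iV := intZ (2 * (a / n%:R) ^+ 2 * n.-1%:R ^+ 2) (L2_intM V2 V2).
have iW := intZ (2 * (a / n%:R) ^+ 2) (L2_intM W2 W2).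
have iU := L2_intM (U_score_L2 n a) (U_score_L2 n a).
apply: le_trans (le_Rintegral _ iU (intD iV iW) _) _ => //.
  move=> w _; rewrite U_scoreB -/(V w) -/(W w).
  have := mulr_ge0 (sqr_ge0 (a / n%:R)) (sqr_ge0 (n.-1%:R * V w - W w)).
  lra.
rewrite RintegralD// !RintegralZl//; [|exact: (L2_intM W2 W2)|exact: (L2_intM V2 V2)].
have EV : \int[iid_law P n]_w (V w * V w) <= n%:R * (tau * (6 + N%:R * F)).
  rewrite Rintegral_lsumM; [|exact: linear_part_L2|exact: linear_part_L2].
  have -> : \int[P]_v linear_part v = 0.
    have i1 i := intZ (th i) (L2_int (cscore_L2 i)).
    rewrite Rintegral_sum// big1// => i _.
    by rewrite RintegralZl ?cscore_mean ?mulr0//; exact: (L2_int (cscore_L2 i)).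
  by rewrite mulr0 mulr0 addr0 ler_wpM2l// linear_part_sqr.
have EW : \int[iid_law P n]_w (W w * W w) <=
    'C(n, 2)%:R * (3 * ((N%:R * F) ^+ 2 + 36 * N%:R + F ^+ 2)).
  under eq_Rintegral do rewrite -expr2.
  rewrite Rintegral_pair_sum_sqr; [|exact: cscore_L2|exact: cscore_mean].
  by rewrite ler_wpM2l// sum_covariance_sqr.
have F0 : 0 <= F by apply: Rintegral_ge0 => t _; rewrite -expr2 sqr_ge0.
have IV0 : 0 <= \int[iid_law P n]_w (V w * V w).
  by apply: Rintegral_ge0 => w _; rewrite -expr2 sqr_ge0.
have nE : n.-1%:R = n%:R - 1 :> R by rewrite -subn1 natrB.
have N1 : 1 <= N%:R :> R.
  rewrite ler1n lt0n; apply/eqP => e; move: aN; rewrite e mulr0 => /eqP.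
  by rewrite eq_sym pnatr_eq0.
rewrite natr_bin2 in EW; rewrite nE.
by apply: variance_arith aN N1 _ F0 bessel IV0 EV EW; rewrite ler1n.
Qed.

End SignalMoments.

(** * The ellipsoid and its level sets *)

Section L2norm.
Context {d : measure_display} {T : measurableType d} {R : realType}.
Variable mu : probability T R.

Lemma L2_normE (f : T -> R) : f \in Lfun mu 2%:E ->
  ('N[mu]_2%:E[EFin \o f])%E = (Num.sqrt (\int[mu]_t (f t * f t)))%:E.
Proof.
move=> f2; have f1 := L2_intM f2 f2.
rewrite unlock /Lnorm (_ : (\int[mu]_x _)%E = (\int[mu]_t (f t * f t))%:E).
  by rewrite poweR_EFin powR12_sqrt// Rintegral_ge0// => t _; rewrite -expr2 sqr_ge0.
rewrite EFin_Rintegral//; apply: eq_integral => t _ /=; congr (_%:E).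
by rewrite powR_mulrn// -expr2 real_normK ?num_real.
Qed.

End L2norm.

Section Cube.
Context {R : realType} {d : option nat} (mu : probability (rspace R d) R).
Hypothesis hmu : is_uniform mu.

Lemma uniform_axis (i : axis d) : {ae mu, forall t : rspace R d, 0 <= t i <= 1}.
Proof.
have mI : measurable (`[0%R, 1%R]%classic : set R) by exact: measurable_itv.
pose A := [set t : rspace R d | 0 <= t i <= 1].
have mA : measurable A.
  apply: sub_sigma_algebra; exists i, `[0%R, 1%R]%classic; split => //.
have A1 : mu A = 1%E.
  have := hmu [fset i]%fset (fun _ => mI).
  rewrite big_seq_fset1 setIid lebesgue_measure_itv/= lte01 oppr0 adde0 => <-.
  congr (mu _); apply/seteqP; split => t /=; rewrite /A/=.
    by move=> h j; rewrite inE => /eqP ->; rewrite in_itv.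
  by move=> /(_ i); rewrite inE eqxx in_itv => /(_ isT).
exists (~` A); split => //.
- exact: measurableC.
- by rewrite probability_setC// A1 subee.
Qed.

(** The cube is a countable intersection of the conditions on single
    coordinates, including in infinite dimension. *)
Lemma uniform_cube : {ae mu, forall t, unit_cube R d t}.
Proof.
move: mu hmu uniform_axis; case: d => [m|] nu hnu h.
- have /ae_foralln : forall k : nat, {ae nu, forall t : rspace R (Some m),
      if insub k is Some i then 0 <= t i <= 1 else true}.
    move=> k; case: insubP => [i _ _|_]; first exact: h.
    exact/aeW.
  apply: filterS => t ht i.
  by have := ht i; rewrite valK.
- exact: ae_foralln h.
Qed.

End Cube.

Section Family.
Context {R : realType} {d : option nat} (mu : probability (rspace R d) R).
Context {L : choiceType} (phi : L -> rspace R d -> R) (c : L -> R).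
Hypothesis hphi : orthonormal_system mu phi.
Implicit Types (s : seq L) (f : rspace R d -> R).

(** The moment bounds concern families indexed by ordinals; the level set
    enters them through this enumeration. *)
Definition subfamily s (i : 'I_(size s)) : rspace R d -> R :=
  phi (tnth (in_tuple s) i).

Lemma subfamily_L2 s i : subfamily (s := s) i \in Lfun mu 2%:E.
Proof. exact: hphi.1. Qed.

Lemma subfamily_orthonormal s i j : uniq s ->
  \int[mu]_t (subfamily (s := s) i t * subfamily j t) = (i == j)%:R.
Proof.
move=> us; rewrite hphi.2; congr (_%:R); congr nat_of_bool.
by apply/eqP/eqP => [|->//]; apply: (elimT (tuple_uniqP (in_tuple s))).
Qed.

Lemma fourier_sumE f (B : set L) t : finite_set B ->
  fourier_sum mu phi f B t = \sum_(i < size (fset_set B))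
    fcoef mu phi f (tnth (in_tuple (fset_set B)) i) * subfamily i t.
Proof. by move=> fB; rewrite /fourier_sum fsbig_finite// big_tnth. Qed.

(** Outside of the level set [c l >= C], so the squared coefficients sum there
    to at most [C ^- 2]. The Fourier sum over a large finite set approximates
    [f], and [residual_energy] expresses the error through the coefficients.
    *)
Lemma tail_energy f (C : R) : ellipsoid mu phi c f -> 0 < C ->
  finite_set (level_set c C) ->
  \int[mu]_t (f t * f t) <=
  \sum_(l <- fset_set (level_set c C)) fcoef mu phi f l ^+ 2 + (C ^+ 2)^-1.
Proof.
move=> [f2 fexp fell] C0 fA; set A := level_set c C in fA *.
set F := \int[mu]_t _.
apply/ler_addgt0Pr => e e0.
have [A0 [fA0 hA0]] := fexp (Num.sqrt e) ltac:(by rewrite sqrtr_gt0).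
pose B := A0 `|` A.
have fB : finite_set B by rewrite finite_setU.
have {hA0} := hA0 B fB (@subsetUl _ _ _).
set sB := fset_set B; set sA := fset_set A.
have uB : uniq sB by exact: fset_uniq.
have r2 : (f \- fourier_sum mu phi f B)%R \in Lfun mu 2%:E.
  apply: L2B => //; rewrite (funext (fun t => fourier_sumE f t fB)).
  by apply: L2_sum => i; apply: L2Z; exact: subfamily_L2.
rewrite L2_normE// lte_fin ltr_sqrt// => hr.
have eF : \int[mu]_t ((f \- fourier_sum mu phi f B) t * (f \- fourier_sum mu phi f B) t)
    = F - \sum_(l <- sB) fcoef mu phi f l ^+ 2.
  rewrite big_tnth.
  rewrite -(residual_energy (@subfamily_L2 sB) (fun i j => subfamily_orthonormal i j uB) f2).
  by apply: eq_Rintegral => t _; rewrite /= fourier_sumE.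
rewrite eF in hr.
suff : \sum_(l <- sB) fcoef mu phi f l ^+ 2 <=
    \sum_(l <- sA) fcoef mu phi f l ^+ 2 + (C ^+ 2)^-1 by lra.
have hc : \sum_(l <- sB) c l ^+ 2 * fcoef mu phi f l ^+ 2 <= 1.
  rewrite -lee_fin; apply: le_trans fell; apply: esum_ge; exists B => //.
  by rewrite fsbig_finite//= -sumEFin.
have C2 : 0 < C ^+ 2 by rewrite exprn_gt0.
rewrite (bigID (mem sA))/=; apply: lerD.
  rewrite -big_filter le_eqVlt; apply/orP; left; apply/eqP; apply: perm_big.
  apply: uniq_perm; [exact: filter_uniq|exact: fset_uniq|move=> l].
  rewrite mem_filter !in_fset_set//; apply/andP/idP => [[]//|lA].
  by split => //; rewrite in_setU; apply/orP; right.
rewrite -[leRHS]mul1r ler_pdivlMr// mulrC mulr_sumr; apply: le_trans hc.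
rewrite [leRHS](bigID (mem sA))/= -[leLHS]add0r; apply: lerD.
  by apply: sumr_ge0 => l _; rewrite mulr_ge0 ?sqr_ge0.
apply: ler_sum => l; rewrite in_fset_set// notin_setE/= => /negP.
rewrite -leNgt => Cl; rewrite ler_wpM2r ?sqr_ge0// lerXn2r ?nnegrE//; first exact: ltW.
exact: (le_trans (ltW C0) Cl).
Qed.

End Family.

(** * Separation of mean and threshold *)

Section PowerArith.
Context {R : realType}.

(** The deterministic core of the power bound. Here [nn] is the sample size,
    [NN] the cardinal of the level set of [K], [F] the energy of the signal,
    [tau] its part in the level set, and [V] bounds the variance of the
    statistic. The mean [h] is at least twice the threshold [H], whose
    constant [12 * b] is chosen for that; each term of [V] is then compared
    with [(h - H) ^ 2]. *)
Lemma power_arith (a nn NN K r F tau b V : R) :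
  0 <= a -> a ^+ 2 * NN = 2 -> 1 <= NN -> 2 <= nn -> NN <= nn -> 0 < K ->
  0 < r -> 1 <= b -> 2 <= (r * K) ^+ 2 -> r ^+ 2 <= F ->
  F <= tau + (K ^+ 2)^-1 -> K ^+ 4 * NN <= b * nn ^+ 2 ->
  V <= 24 * (nn * F / NN) + 4 * (nn * F ^+ 2) + 12 * (NN * F ^+ 2) + 216 ->
  let h := a * (nn - 1) * tau / 2 in
  let H := (r * K) ^+ 2 / (12 * b) in
  H < h /\
  V / (h - H) ^+ 2 <= 128 * (240 * (b / (r * K) ^+ 2) + 16 * (NN / nn)).
Proof.
move=> a0 aN N1 n2 Nn K0 r0 b1 x2 rF Ft Cb hV h H.
have K2 : 0 < K ^+ 2 by rewrite exprn_gt0.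
have F0 : 0 < F by apply: lt_le_trans rF; rewrite exprn_gt0.
set x := (r * K) ^+ 2 in x2 H *.
have xG : x <= F * K ^+ 2 by rewrite /x exprMn ler_wpM2r// ltW.
clearbody x.
have KF : (K ^+ 2)^-1 <= F / 2.
  have := ler_wpM2r (_ : 0 <= (K ^+ 2)^-1) (le_trans x2 xG).
  by rewrite mulfK ?gt_eqF// invr_ge0 => /(_ (ltW K2)); lra.
have tF : F / 2 <= tau by lra.
have y0 : 0 < nn * F by apply: mulr_gt0 => //; lra.
have yE : nn * F = nn * F by [].
set y := {1}(nn * F) in yE; rewrite -yE in y0 hV; clearbody y.
have S1 : NN * x ^+ 2 <= b * y ^+ 2.
  apply: (@le_trans _ _ (NN * (F * K ^+ 2) ^+ 2)).
    apply: ler_wpM2l; first lra.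
    by rewrite lerXn2r ?nnegrE; lra.
  by have := ler_wpM2r (sqr_ge0 F) Cb ; rewrite yE; lra.
have yb0 : 0 <= y ^+ 2 by exact: sqr_ge0.
have S2 : x ^+ 2 <= b * y ^+ 2.
  by apply: le_trans S1; apply: ler_peMl => //; exact: sqr_ge0.
set p := a * y.
have a1 : 0 < a.
  rewrite lt_def a0 andbT; apply/eqP => e; move: aN; rewrite e expr0n/= mul0r; lra.
have p0 : 0 < p by exact: mulr_gt0.
have pE : p ^+ 2 * NN = 2 * y ^+ 2 by rewrite /p exprMn mulrAC aN.
have b0 : 0 < b by lra.
have S3 : 256 * H ^+ 2 <= p ^+ 2.
  have NN0 : 0 < NN by lra.
  have bb : 0 < (12 * b) ^+ 2 by apply: exprn_gt0; lra.
  have Hb : H * (12 * b) = x by rewrite /H divfK// gt_eqF//; lra.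
  have Hx : NN * (H * (12 * b)) ^+ 2 = NN * x ^+ 2 by rewrite Hb.
  rewrite -(ler_pM2r NN0) -(ler_pM2r bb) pE; clearbody H.
  have : b * y ^+ 2 <= b ^+ 2 * y ^+ 2 by apply: ler_wpM2r => //; rewrite expr2 ler_peMr//; lra.
  have := mulr_ge0 (ltW b0) yb0.
  lra.
have H0 : 0 <= H by apply: divr_ge0; lra.
have Hp : H <= p / 16.
  rewrite -(@ler_pXn2r _ 2) ?nnegrE//; first lra.
  by apply: divr_ge0 => //; exact: ltW.
have hp : p / 8 <= h.
  have : a * (nn / 2 * (F / 2)) <= a * ((nn - 1) * tau).
    apply: ler_wpM2l => //; apply: ler_pM; clear - n2 F0 tF; lra.
  by rewrite /h /p yE; lra.
split; first lra.
have hH : (p / 16) ^+ 2 <= (h - H) ^+ 2.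
  by rewrite lerXn2r ?nnegrE; clear - p0 hp Hp; clearbody h H; lra.
have hH0 : 0 < (h - H) ^+ 2 by apply: exprn_gt0; lra.
rewrite ler_pdivrMr//.
have x0 : 0 < x by lra.
have nn0 : 0 < nn by lra.
have T0 : 0 <= 128 * (240 * (b / x) + 16 * (NN / nn)).
  have e1 := divr_ge0 (ltW b0) (ltW x0).
  have e2 := divr_ge0 (le_trans ler01 N1) (ltW nn0).
  by clear - e1 e2; lra.
apply: le_trans (ler_wpM2l T0 hH).
clear T0 hH0 hH hp Hp H0 S3 h H KF xG.
have NN0 : 0 < NN by exact: lt_le_trans N1.
have x1 : 1 <= x by clear -x2; lra.
rewrite -(ler_pM2r NN0).
rewrite (_ : _ * (p / 16) ^+ 2 * NN = (240 * (b / x) + 16 * (NN / nn)) * y ^+ 2); last first.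
  transitivity ((128 * (240 * (b / x) + 16 * (NN / nn))) / 256 * (p ^+ 2 * NN)).
    by clear; lra.
  by rewrite pE; clear; lra.
apply: le_trans (ler_wpM2r (ltW NN0) hV) _.
have xby : x <= b * y.
  have by0 : 0 <= b * y by rewrite mulr_ge0// ltW.
  rewrite -(@ler_pXn2r _ 2) ?nnegrE//; last exact: ltW.
  apply: le_trans S2 _; rewrite exprMn; apply: ler_wpM2r => //.
  by rewrite expr2 ler_peMr// ltW.
have i1 : y <= y ^+ 2 * (b / x).
  rewrite mulrA ler_pdivlMr//; have := ler_wpM2l (ltW y0) xby.
  by clear; lra.
have i2 : NN <= y ^+ 2 * (b / x).
  rewrite mulrA ler_pdivlMr//.
  have : NN * x <= NN * x ^+ 2.
    by rewrite ler_pM2l// expr2 ler_peMr// ltW.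
  by move: S1; clear; lra.
have i3 : NN * nn * F ^+ 2 = NN / nn * y ^+ 2.
  transitivity (NN * (nn * F ^+ 2) * (nn / nn)).
    by rewrite divff ?gt_eqF// mulr1 mulrA.
  by rewrite yE; clear; lra.
have i4 : NN * NN * F ^+ 2 <= NN * nn * F ^+ 2.
  by rewrite ler_wpM2r ?sqr_ge0// ler_wpM2l// ltW.
have i5 : y / NN * NN = y by rewrite divfK// gt_eqF.
clear - i1 i2 i3 i4 i5.
lra.
Qed.

End PowerArith.

(** * Errors of the test *)

Section Chebyshev.
Context {d : measure_display} {T : measurableType d} {R : realType}.
Variable P : probability T R.
Implicit Types X : T -> R.

Lemma measurable_gt_set X (H : R) : measurable_fun setT X ->
  measurable [set w | H < X w].
Proof.
move=> mX; rewrite (_ : [set w | H < X w] = setT `&` X @^-1` `]H, +oo[%classic).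
  by apply: mX => //; exact: measurable_itv.
by rewrite setTI; apply/seteqP; split => w /=; rewrite in_itv/= andbT.
Qed.

Lemma int_indic (A : set T) : measurable A ->
  P.-integrable setT (EFin \o (\1_A : T -> R)).
Proof. by move=> mA; apply: integrable_indic => //; rewrite probability_setT ltry. Qed.

Lemma chebyshev_right X (H : R) : X \in Lfun P 2%:E -> 0 < H ->
  \int[P]_w \1_[set w | H < X w] w <= (\int[P]_w (X w * X w)) / H ^+ 2.
Proof.
move=> X2 H0; have mX := L2_measurable X2.
rewrite mulrC -RintegralZl//; last exact: L2_intM.
apply: le_Rintegral => //.
- exact/int_indic/measurable_gt_set.
- by apply: intZ; exact: L2_intM.
move=> w _; rewrite indicE; case: (boolP (_ \in _)) => [|_]; last first.
  by rewrite mulr_ge0 ?invr_ge0 ?sqr_ge0// -expr2 sqr_ge0.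
rewrite inE/= => HX; rewrite mulrC ler_pdivlMr ?exprn_gt0// mul1r -expr2.
by rewrite lerXn2r ?nnegrE; lra.
Qed.

Lemma chebyshev_left X (H h : R) : (fun w => X w - h) \in Lfun P 2%:E -> H < h ->
  \int[P]_w (1 - \1_[set w | H < X w] w) <=
  (\int[P]_w ((X w - h) * (X w - h))) / (h - H) ^+ 2.
Proof.
move=> X2 Hh.
have mX : measurable_fun setT X.
  have -> : X = (fun w => (X w - h) + h) by apply/funext => w; lra.
  by apply: measurable_funD => //; exact: L2_measurable X2.
rewrite mulrC -RintegralZl//; last exact: L2_intM.
apply: le_Rintegral => //.
- apply: intB; first exact: L2_int (L2_cst P 1).
  exact/int_indic/measurable_gt_set.
- by apply: intZ; exact: L2_intM.
move=> w _; rewrite indicE; case: (boolP (_ \in _)) => [_|].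
  by rewrite subrr mulr_ge0 ?invr_ge0 ?sqr_ge0// -expr2 sqr_ge0.
rewrite notin_setE/= => /negP; rewrite -leNgt => XH.
have hH : 0 < h - H by lra.
rewrite subr0 mulrC ler_pdivlMr ?exprn_gt0// mul1r -expr2 -sqrrN.
by rewrite (_ : - (h - H) = H - h) ?opprB// -sqrrN -[leRHS]sqrrN lerXn2r ?nnegrE; lra.
Qed.

End Chebyshev.

Lemma obs_sample0 {R : realType} {d : option nat} n
    (w : n.-tuple (measurableTypeR R * rspace R d)%type) :
  obs_sample (fun=> 0) w = w.
Proof.
apply: val_inj => /=; rewrite -[RHS]map_id; apply: eq_map => -[x t] /=.
by rewrite add0r.
Qed.

Section TestBounds.
Context {R : realType} {d : option nat} (mu : probability (rspace R d) R).
Hypothesis hmu : is_uniform mu.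
Context {L : choiceType} (phi : L -> rspace R d -> R) (c : L -> R).
Hypothesis hphi : orthonormal_system mu phi.
Variables (C : nat -> R) (n : nat).
Notation obs := ((measurableTypeR R * rspace R d)%type).
Hypothesis C0 : 0 < C n.
Hypothesis fA : finite_set (level_set c (C n)).
Hypothesis A2 : forall t, unit_cube R d t ->
  \sum_(l \in level_set c (C n)) phi l t ^+ 2 = (card_level c (C n))%:R.

Let s : seq L := fset_set (level_set c (C n)).
Let N := size s.
Let a : R := Num.sqrt (2 / N%:R).
Let fam := @subfamily R d L phi s.

Let fam2 i : fam i \in Lfun mu 2%:E.
Proof. exact: (subfamily_L2 hphi). Qed.

Let famO i j : \int[mu]_t (fam i t * fam j t) = (i == j)%:R.
Proof. by apply: (subfamily_orthonormal hphi); exact: fset_uniq. Qed.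

Let famN : {ae mu, forall t, \sum_i fam i t ^+ 2 = N%:R}.
Proof.
apply: filterS (uniform_cube hmu) => t /A2.
by rewrite fsbig_finite// big_tnth.
Qed.

Lemma U_stat_obs f (w : n.-tuple obs) :
  U_stat phi c C (obs_sample f w) = U_score fam f a w.
Proof.
rewrite /U_stat /U_score -pair_sumE (mulrC a) -mulrA; congr (_ * _).
rewrite mulr_sumr; apply: eq_bigr => i _.
rewrite mulr_sumr; apply: eq_bigr => k _.
rewrite !tnth_map /G_kernel/= mulrCA; congr (_ * _).
rewrite fsbig_finite//= big_tnth mulr_sumr; apply: eq_bigr => l _.
by rewrite /score /fam/= /subfamily; lra.
Qed.

Lemma U_test_obs f H (w : n.-tuple obs) :
  U_test phi c C H (obs_sample f w) = \1_[set w | H < U_score fam f a w] w.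
Proof.
rewrite /U_test !indicE; congr ((nat_of_bool _)%:R).
by apply/idP/idP => /set_mem h; apply/mem_set; move: h; rewrite /= U_stat_obs.
Qed.

Let zero2 : (fun=> 0 : R) \in Lfun mu 2%:E.
Proof. exact: L2_cst. Qed.

Lemma U_test_is_test H : is_test (@U_test R d L phi c C n H).
Proof.
split; last first.
  by move=> z; rewrite /U_test indicE; case: (_ \in _); rewrite !lexx ler01.
have -> : @U_test R d L phi c C n H = \1_[set w | H < U_score fam (fun=> 0) a w].
  by apply/funext => z; rewrite -{1}(obs_sample0 z) U_test_obs.
apply: measurable_indic; apply: measurable_gt_set.
have U2 := U_score_L2 fam2 famN zero2 n a.
have -> : @U_score _ _ _ _ fam (fun=> 0) n a = fun w => (U_score fam (fun=> 0) a w -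
    U_center mu fam (fun=> 0) n a) + U_center mu fam (fun=> 0) n a.
  by apply/funext => w; rewrite subrK.
by apply: measurable_funD => //; exact: L2_measurable U2.
Qed.

Hypothesis n0 : (0 < n)%N.
Hypothesis N0 : (0 < N)%N.

Let aN : a ^+ 2 * N%:R = 2.
Proof. by rewrite sqr_sqrtr ?divr_ge0// divfK// pnatr_eq0 -lt0n. Qed.

Let zero_center : U_center mu fam (fun=> 0) n a = 0.
Proof.
rewrite /U_center big1 ?mulr0// => i _.
by under eq_Rintegral do rewrite mul0r; rewrite Rintegral_1 expr0n.
Qed.

(** Under the null hypothesis the mean is zero and only the constant term of
    the variance bound remains. *)
Lemma test_level H : 0 < H -> alpha_err mu (@U_test R d L phi c C n H) <= 216 / H ^+ 2.
Proof.
move=> H0; rewrite /alpha_err /expect_obs.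
under eq_Rintegral do rewrite U_test_obs.
have U2 := U_score_L2 fam2 famN zero2 n a; rewrite zero_center in U2.
have eU : (fun w => U_score fam (fun=> 0) a w - 0) = @U_score _ _ _ _ fam (fun=> 0) n a.
  by apply/funext => w; rewrite subr0.
rewrite eU in U2.
apply: le_trans (chebyshev_right U2 H0) _.
apply: ler_wpM2r; first by rewrite invr_ge0 sqr_ge0.
have := U_score_variance fam2 famO famN zero2 n0 aN; rewrite zero_center.
under eq_Rintegral do rewrite subr0.
have -> : \int[mu]_t (0 * 0 : R) = 0.
  by under eq_Rintegral do rewrite mul0r; rewrite Rintegral_1.
by rewrite !expr0n /= !mulr0 mul0r mulr0 !add0r.
Qed.

(** The threshold [(r * C n) ^+ 2 / (12 * b)] depends on [f] only through the
    radius, while the mean of the statistic under [f] exceeds twice this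
    threshold for every [f] in the class. *)
Lemma test_power f (b r : R) : ellipsoid mu phi c f ->
  (r%:E <= 'N[mu]_2%:E[EFin \o f])%E ->
  0 < r -> 1 <= b -> 2 <= (r * C n) ^+ 2 -> (1 < n)%N -> (N <= n)%N ->
  C n ^+ 4 * N%:R <= b * n%:R ^+ 2 ->
  expect_obs mu f (fun z : n.-tuple obs => 1 - U_test phi c C ((r * C n) ^+ 2 / (12 * b)) z) <=
  128 * (240 * (b / (r * C n) ^+ 2) + 16 * (N%:R / n%:R)).
Proof.
move=> fE fr r0 b1 x2 n1 Nn Cb.
have f2 : f \in Lfun mu 2%:E by case: fE.
set H := _ / _; rewrite /expect_obs.
under eq_Rintegral do rewrite U_test_obs.
set F := \int[mu]_t (f t * f t).
set h := U_center mu fam f n a.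
have F0 : 0 <= F by apply: Rintegral_ge0 => t _; rewrite -expr2 sqr_ge0.
have rF : r ^+ 2 <= F.
  move: fr; rewrite L2_normE// lee_fin => fr.
  by rewrite -(sqr_sqrtr F0) lerXn2r ?nnegrE ?sqrtr_ge0// ltW.
have tail := tail_energy hphi fE C0 fA.
have U2 := U_score_L2 fam2 famN f2 n a.
have := U_score_variance fam2 famO famN f2 n0 aN.
set V := \int[_]_w _; rewrite -/F => hV.
set tau := \sum_(l <- _) _ in tail.
have hE : h = a * (n%:R - 1) * tau / 2.
  rewrite /h /U_center -[\sum_i _](_ : tau = _); last by rewrite /tau big_tnth.
  have nn : n%:R^-1 * n%:R = 1 :> R by rewrite mulVf// pnatr_eq0 -lt0n.
  rewrite natr_bin2; transitivity ((n%:R^-1 * n%:R) * (a * (n%:R - 1) * tau / 2)); first lra.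
  by rewrite nn mul1r.
have N1 : 1 <= N%:R :> R by rewrite ler1n.
have n2 : 2 <= n%:R :> R by rewrite ler_nat.
have NnR : N%:R <= n%:R :> R by rewrite ler_nat.
have [Hh hp] := power_arith (sqrtr_ge0 _) aN N1 n2 NnR C0 r0 b1 x2 rF tail Cb hV.
rewrite -hE in Hh hp.
exact: le_trans (chebyshev_left U2 Hh) hp.
Qed.

End TestBounds.

(** * Rademacher averages *)

Section Rademacher.
Context {R : realType}.

(** The mean over independent random signs, taken over the first sign last.
    Sign vectors are sequences, so that induction on [n] needs no reindexing.
    *)
Fixpoint rad_mean n (F : seq R -> R) : R :=
  if n is m.+1 then
    (rad_mean m (fun e => F (1 :: e)) + rad_mean m (fun e => F (- 1 :: e))) / 2
  else F [::].

Definition signs n (e : seq R) := (size e == n) && all (fun x => x ^+ 2 == 1) e.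

Lemma signs_nth n e (i : 'I_n) : signs n e -> e`_i ^+ 2 = 1.
Proof.
move=> /andP[/eqP se /allP h]; apply/eqP/h/mem_nth.
by rewrite se.
Qed.

Lemma signs_cons n x e : x ^+ 2 = 1 -> signs n e -> signs n.+1 (x :: e).
Proof. by move=> x1 /andP[se he]; rewrite /signs/= eqSS se he x1 eqxx. Qed.

Lemma le_rad_mean n F G : (forall e, signs n e -> F e <= G e) ->
  rad_mean n F <= rad_mean n G.
Proof.
elim: n F G => [|n IH] F G FG /=; first exact: FG.
rewrite ler_pM2r ?invr_gt0//; apply: lerD; apply: IH => e he; apply: FG.
  exact: signs_cons (expr1n _ _) he.
by apply: signs_cons he; rewrite sqrrN expr1n.
Qed.

Lemma eq_rad_mean n F G : F =1 G -> rad_mean n F = rad_mean n G.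
Proof. by move=> FG; congr rad_mean; exact/funext. Qed.

Lemma rad_mean_cst n c : rad_mean n (fun=> c) = c.
Proof. by elim: n => //= n ->; lra. Qed.

Lemma rad_meanZ n c F : rad_mean n (fun e => c * F e) = c * rad_mean n F.
Proof. by elim: n F => //= n IH F; rewrite !IH; lra. Qed.

Lemma rad_meanD n F G :
  rad_mean n (fun e => F e + G e) = rad_mean n F + rad_mean n G.
Proof. by elim: n F G => //= n IH F G; rewrite !IH; lra. Qed.

Lemma rad_meanM n m F G : rad_mean n F * rad_mean m G =
  rad_mean n (fun e => rad_mean m (fun e' => F e * G e')).
Proof.
rewrite mulrC -rad_meanZ; apply: eq_rad_mean => e.
by rewrite mulrC -rad_meanZ.
Qed.

(** A random sign is sub-Gaussian. The exponent [2*x^2] in place of [x^2/2]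
    changes only constants and leaves an elementary proof: for small [x] both
    exponentials are below geometric series, and for large [x] below [expR
    `|x|]. *)
Lemma cosh_le_expR (x : R) : (expR x + expR (- x)) / 2 <= expR (2 * x ^+ 2).
Proof.
have [x2|x2] := leP (x ^+ 2) (1 / 2).
  apply: le_trans (expR_ge1Dx _).
  have x1 : `|x| < 1.
    by rewrite -(@ltr_pXn2r _ 2) ?nnegrE// real_normK ?num_real// expr1n; lra.
  have h (y : R) : y < 1 -> expR y <= (1 - y)^-1.
    move=> y1; have := expR_ge1Dx (- y); rewrite expRN => h.
    by rewrite -(invrK (expR y)) lef_pV2 ?posrE ?invr_gt0 ?expR_gt0//; lra.
  have [x1' x1''] : -1 < x /\ x < 1 by move: x1; rewrite ltr_norml => /andP[].
  have h1 := h _ x1''; have := h (- x) ltac:(lra); rewrite opprK => h2.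
  have e1 : (1 - x)^-1 + (1 + x)^-1 = 2 / (1 - x ^+ 2).
    rewrite -[_^-1]mul1r -[X in _ + X]mul1r addf_div; [|lra..].
    by congr (_ / _); lra.
  suff : 2 / (1 - x ^+ 2) <= 2 * (1 + 2 * x ^+ 2) by lra.
  rewrite ler_pdivrMr; last lra.
  by have := mulr_ge0 (sqr_ge0 x) (_ : 0 <= 1 - 2 * x ^+ 2); lra.
apply: (@le_trans _ _ (expR `|x|)).
  have a1 : expR x <= expR `|x| by rewrite ler_expR ler_norm.
  have a2 : expR (- x) <= expR `|x| by rewrite ler_expR -normrN ler_norm.
  lra.
rewrite ler_expR -real_normK ?num_real//.
have := normr_ge0 x; have : 1 / 2 < `|x| ^+ 2 by rewrite real_normK ?num_real.
nra.
Qed.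

Lemma rad_mean_linear n (y : 'I_n -> R) :
  rad_mean n (fun e => expR (\sum_(k < n) e`_k * y k)) <=
  expR (2 * \sum_(k < n) y k ^+ 2).
Proof.
elim: n y => [|n IH] y /=; first by rewrite !big_ord0 mulr0.
have h (x : R) : rad_mean n (fun e => expR (\sum_(k < n.+1) (x :: e)`_k * y k)) =
    expR (x * y ord0) *
    rad_mean n (fun e => expR (\sum_(k < n) e`_k * y (lift ord0 k))).
  rewrite -rad_meanZ; apply: eq_rad_mean => e.
  by rewrite big_ord_recl/= expRD.
rewrite (h 1) (h (-1)) mul1r mulN1r -mulrDl mulrAC big_ord_recl mulrDr expRD.
apply: ler_pM; [| |exact: cosh_le_expR|exact: IH].
- by rewrite divr_ge0// addr_ge0// expR_ge0.
- by rewrite -(rad_mean_cst n 0); apply: le_rad_mean => e _; exact: expR_ge0.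
Qed.

(** Lagrange's identity: the difference of the two sides is half a sum of
    squares. *)
Lemma sum_cauchy_schwarz n (x y : 'I_n -> R) :
  (\sum_i x i * y i) ^+ 2 <= (\sum_i x i ^+ 2) * \sum_i y i ^+ 2.
Proof.
have h : 0 <= \sum_i \sum_j (x i * y j - x j * y i) ^+ 2.
  by apply: sumr_ge0 => i _; apply: sumr_ge0 => j _; exact: sqr_ge0.
have e : \sum_i \sum_j (x i * y j - x j * y i) ^+ 2 =
    2 * ((\sum_i x i ^+ 2) * (\sum_i y i ^+ 2) - (\sum_i x i * y i) ^+ 2).
  have -> : (\sum_i x i * y i) ^+ 2 = \sum_i \sum_j (x i * y i) * (x j * y j).
    by rewrite expr2 mulr_suml; apply: eq_bigr => i _; rewrite mulr_sumr.
  have e1 : (\sum_i x i ^+ 2) * (\sum_i y i ^+ 2) = \sum_i \sum_j x i ^+ 2 * y j ^+ 2.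
    by rewrite mulr_suml; apply: eq_bigr => i _; rewrite mulr_sumr.
  have e2 : (\sum_i x i ^+ 2) * (\sum_i y i ^+ 2) = \sum_i \sum_j x j ^+ 2 * y i ^+ 2.
    by rewrite e1 exchange_big.
  transitivity (\sum_i \sum_j x i ^+ 2 * y j ^+ 2 + \sum_i \sum_j x j ^+ 2 * y i ^+ 2
     + (- 2) * \sum_i \sum_j (x i * y i) * (x j * y j)); last by rewrite -e1 -e2; lra.
  rewrite mulr_sumr -!big_split/=; apply: eq_bigr => i _.
  rewrite mulr_sumr -!big_split/=; apply: eq_bigr => j _; lra.
rewrite e in h; lra.
Qed.

(** A sub-Gaussian bound for the square of a vector-valued Rademacher sum.
    Averaging over one more sign with vector [b0] replaces the weight [A] by
    [A + 8 * A ^+ 2 * B], where [B] is the squared norm of [b0]; the weights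
    [a / (1 - 8 * a * S)] dominate this recursion. *)
Lemma rad_mean_quadratic n m (b : 'I_n -> 'I_m -> R) (s : 'I_m -> R) (a : R) :
  let S := \sum_k \sum_j b k j ^+ 2 in
  0 <= a -> 8 * a * S < 1 ->
  rad_mean n (fun e => expR (a * \sum_j (s j + \sum_(k < n) e`_k * b k j) ^+ 2)) <=
  expR (a / (1 - 8 * a * S) * (\sum_j s j ^+ 2 + S)).
Proof.
elim: n b s => [|n IH] b s S a0 aS.
  rewrite /= ler_expR /S big_ord0 mulr0 subr0 divr1 addr0.
  by under eq_bigr do rewrite big_ord0 addr0.
pose b0 := b ord0; pose b' k := b (lift ord0 k).
pose S' := \sum_k \sum_j b' k j ^+ 2; pose B := \sum_j b0 j ^+ 2.
have SE : S = B + S' by rewrite /S big_ord_recl.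
have B0 : 0 <= B by apply: sumr_ge0 => j _; exact: sqr_ge0.
have S'0 : 0 <= S'.
  by apply: sumr_ge0 => k _; apply: sumr_ge0 => j _; exact: sqr_ge0.
have aB0 : 0 <= a * B by rewrite mulr_ge0.
have aS'0 : 0 <= a * S' by rewrite mulr_ge0.
have aS' : 8 * a * S' < 1 by apply: le_lt_trans aS; rewrite SE; lra.
have h (x : R) : x ^+ 2 = 1 ->
  rad_mean n (fun e => expR (a * \sum_j (s j + \sum_(k < n.+1) (x :: e)`_k * b k j) ^+ 2)) <=
  expR (a / (1 - 8 * a * S') * (\sum_j (s j) ^+ 2 + B + S')) *
  expR (x * (a / (1 - 8 * a * S') * 2 * \sum_j s j * b0 j)).
  move=> x1; apply: le_trans (_ : _ <=
    rad_mean n (fun e => expR (a * \sum_j ((s j + x * b0 j) + \sum_(k < n) e`_k * b' k j) ^+ 2))) _.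
    apply: le_rad_mean => e _; rewrite ler_expR le_eqVlt; apply/orP; left; apply/eqP.
    by congr (_ * _); apply: eq_bigr => j _; rewrite big_ord_recl/= addrA.
  apply: le_trans (IH _ _ a0 aS') _; rewrite -expRD ler_expR.
  have -> : \sum_j (s j + x * b0 j) ^+ 2 =
     \sum_j s j ^+ 2 + B + 2 * x * \sum_j s j * b0 j.
    rewrite mulr_sumr -!big_split/=; apply: eq_bigr => j _.
    by rewrite sqrrD exprMn x1; lra.
  by rewrite -/S'; lra.
rewrite /=; set A := a / (1 - 8 * a * S') in h *.
have h1 := h 1 (expr1n _ _); have := h (- 1) ltac:(by rewrite sqrrN expr1n).
rewrite mul1r in h1; rewrite mulN1r => h2.
set Z := A * 2 * _ in h1 h2.
apply: le_trans (_ : _ <= expR (A * (\sum_j s j ^+ 2 + B + S')) * ((expR Z + expR (- Z)) / 2)) _.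
  lra.
apply: le_trans (ler_wpM2l (expR_ge0 _) (cosh_le_expR _)) _.
rewrite -expRD ler_expR.
have A0 : 0 <= A by rewrite divr_ge0//; lra.
have ZB : Z ^+ 2 <= A ^+ 2 * 4 * ((\sum_j s j ^+ 2) * B).
  have A4 : 0 <= A ^+ 2 * 4 by rewrite mulr_ge0// sqr_ge0.
  by have := ler_wpM2l A4 (sum_cauchy_schwarz s b0); rewrite /Z -/B; lra.
set X := \sum_j s j ^+ 2 in ZB *.
have X0 : 0 <= X by apply: sumr_ge0 => j _; exact: sqr_ge0.
have AA : A + 8 * A ^+ 2 * B <= a / (1 - 8 * a * S).
  have D0 : 0 < 1 - 8 * a * S by lra.
  rewrite ler_pdivlMr// /A.
  have D'0 : 0 < 1 - 8 * a * S' by lra.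
  set i := (1 - 8 * a * S')^-1.
  have iE : i * (1 - 8 * a * S') = 1 by rewrite mulVf// gt_eqF.
  have : 0 <= a * (8 * a * B * i) ^+ 2 by rewrite mulr_ge0 ?sqr_ge0.
  have -> : (a * i + 8 * (a * i) ^+ 2 * B) * (1 - 8 * a * S) =
     a * (i * (1 - 8 * a * S') + 8 * a * B * i * (i * (1 - 8 * a * S')) -
     8 * a * B * i - (8 * a * B * i) ^+ 2) by rewrite SE; lra.
  by rewrite iE; lra.
have A1 : A <= a / (1 - 8 * a * S).
  by apply: le_trans AA; rewrite lerDl mulr_ge0// mulr_ge0// sqr_ge0.
apply: (@le_trans _ _ ((A + 8 * A ^+ 2 * B) * X + A * (B + S'))); first by lra.
have BS0 : 0 <= B + S' by exact: addr_ge0.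
have := ler_wpM2r X0 AA; have := ler_wpM2r BS0 A1.
by set Q := a / (1 - 8 * a * S); rewrite SE; lra.
Qed.

End Rademacher.

(** * Likelihood ratios *)

Section IIDTonelli.
Context {d : measure_display} {T : measurableType d} {R : realType}.
Variable P : probability T R.

Lemma ge0_integral_iidS n (G : n.+1.-tuple T -> \bar R) :
  measurable_fun setT G -> (forall z, 0 <= G z)%E ->
  (\int[iid_law P n.+1]_z G z =
   \int[P]_x \int[iid_law P n]_w G (tuple_cons (x, w)))%E.
Proof.
move=> mG G0; rewrite [LHS](ge0_integral_distribution _ mG)//.
rewrite fubini_tonelli1//; last by move=> x; exact: G0.
by apply: measurableT_comp => //; exact: measurable_tuple_cons.
Qed.

Lemma measurable_slice n (G : n.+1.-tuple T -> \bar R) x :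
  measurable_fun setT G ->
  measurable_fun setT (fun w : n.-tuple T => G (tuple_cons (x, w))).
Proof.
move=> mG; apply: (measurableT_comp mG).
apply: (measurableT_comp (@measurable_tuple_cons _ T n)).
exact: measurable_fun_pair.
Qed.

Lemma measurable_tprod n (u : T -> R) : measurable_fun setT u ->
  measurable_fun setT (fun z : n.-tuple T => \prod_(v <- z) u v).
Proof.
move=> mu1; under eq_fun do rewrite big_tuple.
apply: measurable_prod => i _; apply: measurableT_comp => //.
exact: measurable_tnth.
Qed.

End IIDTonelli.

Section CameronMartin.
Context {R : realType} {d : option nat} (mu : probability (rspace R d) R).
Notation obs := ((measurableTypeR R * rspace R d)%type).
Notation gauss := (normal_prob (0%R : R) 1%R).
Let P := (gauss \x mu)%E.
Implicit Types (f : rspace R d -> R).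

Definition shift_obs f (v : obs) : obs := (f v.2 + (v.1 : R), v.2).

(** The density of the law of one observation under [f] with respect to its
    law under pure noise. *)
Definition lik1 f (v : obs) : R := expR ((v.1 : R) * f v.2 - f v.2 ^+ 2 / 2).

Lemma measurable_shift_obs f : measurable_fun setT f ->
  measurable_fun setT (shift_obs f).
Proof.
move=> mf; apply: measurable_fun_pair => //.
apply: measurable_funD; last exact: measurable_fst.
by apply: measurableT_comp mf _; exact: measurable_snd.
Qed.

Lemma measurable_lik1 f : measurable_fun setT f -> measurable_fun setT (lik1 f).
Proof.
move=> mf; have mf2 : measurable_fun setT (fun v : obs => f v.2).
  by apply: measurableT_comp mf _; exact: measurable_snd.
apply: measurableT_comp => //; apply: measurable_funB.
  by apply: measurable_funM => //; exact: measurable_fst.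
by apply: measurable_funM => //; exact: measurable_funX.
Qed.

Lemma cameron_martin1 f (h : obs -> \bar R) : measurable_fun setT f ->
  measurable_fun setT h -> (forall v, 0 <= h v)%E ->
  (\int[P]_v h (shift_obs f v) = \int[P]_v (h v * (lik1 f v)%:E))%E.
Proof.
move=> mf mh h0.
have ml := measurable_lik1 mf.
rewrite (fubini_tonelli2 (h \o shift_obs f))/=; last 2 first.
- by apply: measurableT_comp => //; exact: measurable_shift_obs.
- by move=> v; exact: h0.
rewrite (fubini_tonelli2 (fun v => h v * (lik1 f v)%:E)%E); last 2 first.
- by apply: emeasurable_funM => //; exact/measurable_EFinP.
- by move=> v; rewrite mule_ge0// lee_fin expR_ge0.
apply: eq_integral => t _.
rewrite /fubini_G -(gauss_shift (f t) (g := fun x => h (x, t))).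
- by apply: eq_integral => x _; rewrite /shift_obs/= addrC.
- apply: measurableT_comp => //; exact: measurable_fun_pair.
- by move=> x.
Qed.

Definition lik f (z : seq obs) : R := \prod_(v <- z) lik1 f v.

Lemma lik_ge0 f z : 0 <= lik f z.
Proof. by apply: prodr_ge0 => v _; exact: expR_ge0. Qed.

Lemma measurable_lik n f : measurable_fun setT f ->
  measurable_fun setT (fun z : n.-tuple obs => lik f z).
Proof. by move=> mf; apply: measurable_tprod; exact: measurable_lik1. Qed.

Lemma measurable_obs_sample n f : measurable_fun setT f ->
  measurable_fun setT (fun w : n.-tuple obs => obs_sample f w).
Proof.
move=> mf; apply/measurable_fun_tnthP => i.
rewrite (_ : _ \o _ = fun w : n.-tuple obs => shift_obs f (tnth w i)).
  by apply: measurableT_comp; [exact: measurable_shift_obs|exact: measurable_tnth].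
by apply/funext => w; rewrite /= tnth_map.
Qed.

Lemma obs_sample_cons n f x (w : n.-tuple obs) :
  obs_sample f (tuple_cons (x, w)) = tuple_cons (shift_obs f x, obs_sample f w).
Proof. exact/val_inj. Qed.

(** The laws of the sample under [f] and under pure noise have the same
    design, and given the design the noise is shifted coordinate by
    coordinate. The induction splits off one observation and applies the
    one-dimensional formula to it. *)
Lemma cameron_martin n f (g : n.-tuple obs -> \bar R) : measurable_fun setT f ->
  measurable_fun setT g -> (forall z, 0 <= g z)%E ->
  (\int[iid_law P n]_w g (obs_sample f w) =
   \int[iid_law P n]_z (g z * (lik f z)%:E))%E.
Proof.
move=> mf; have ml1 := measurable_lik1 mf.
elim: n g => [|n IH] g mg g0.
  apply: eq_integral => z _; rewrite (tuple0 z) /lik big_nil mule1.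
  by congr (g _); exact: tuple0.
have ml := @measurable_lik n f mf.
pose q (p : obs * n.-tuple obs) := (g (tuple_cons p) * (lik f p.2)%:E)%E.
have mq : measurable_fun setT q.
  apply: emeasurable_funM.
    by apply: measurableT_comp => //; exact: measurable_tuple_cons.
  by apply/measurable_EFinP; apply: measurableT_comp ml _; exact: measurable_snd.
have q0 p : (0 <= q p)%E by rewrite mule_ge0// lee_fin lik_ge0.
pose h x := (\int[iid_law P n]_w q (x, w))%E.
have mh : measurable_fun setT h.
  exact: (@measurable_fun_fubini_tonelli_F _ _ _ _ _ (iid_law P n) q).
have h0 x : (0 <= h x)%E by exact: integral_ge0.
rewrite ge0_integral_iidS//; last first.
  by apply: measurableT_comp mg _; exact: measurable_obs_sample.
transitivity (\int[P]_x h (shift_obs f x))%E.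
  apply: eq_integral => x _.
  under eq_integral do rewrite obs_sample_cons.
  rewrite (IH (fun w => g (tuple_cons (shift_obs f x, w))))//.
  exact: measurable_slice.
rewrite cameron_martin1// ge0_integral_iidS; last 2 first.
- apply: emeasurable_funM => //; apply/measurable_EFinP; exact: measurable_lik.
- by move=> z; rewrite mule_ge0// lee_fin lik_ge0.
apply: eq_integral => x _; rewrite -ge0_integralZr//.
- apply: eq_integral => w _; rewrite /q/= -muleA -EFinM; congr (_ * _%:E)%E.
  by rewrite /lik big_cons mulrC.
- by apply: measurableT_comp mq _; exact: measurable_fun_pair.
- by rewrite lee_fin expR_ge0.
Qed.

Definition design n (z : n.-tuple obs) : n.-tuple (rspace R d) :=
  [tuple of map (fun v : obs => v.2) z].

Lemma measurable_design n :
  measurable_fun setT (fun z : n.-tuple obs => design z).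
Proof.
apply/measurable_fun_tnthP => i.
rewrite (_ : _ \o _ = fun w : n.-tuple obs => (tnth w i).2).
  by apply: measurableT_comp; [exact: measurable_snd|exact: measurable_tnth].
by apply/funext => w; rewrite /= tnth_map.
Qed.

Section IntegrateNoise.
Variables (u : obs -> R) (W : rspace R d -> R).
Hypotheses (mu1 : measurable_fun setT u) (u0 : forall v, 0 <= u v).
Hypotheses (mW : measurable_fun setT W) (W0 : forall t, 0 <= W t).
Hypothesis uW : forall t, (\int[gauss]_x (u (x, t))%:E = (W t)%:E)%E.

Lemma integrate_noise1 (k : rspace R d -> \bar R) : measurable_fun setT k ->
  (forall t, 0 <= k t)%E ->
  (\int[P]_v ((u v)%:E * k v.2) = \int[P]_v ((W v.2)%:E * k v.2))%E.
Proof.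
move=> mk k0.
have mk2 : measurable_fun setT (fun v : obs => k v.2).
  by apply: measurableT_comp mk _; exact: measurable_snd.
have mW2 : measurable_fun setT (fun v : obs => W v.2).
  by apply: measurableT_comp mW _; exact: measurable_snd.
rewrite (fubini_tonelli2 (fun v => (u v)%:E * k v.2)%E); last 2 first.
- by apply: emeasurable_funM => //; exact/measurable_EFinP.
- by move=> v; rewrite mule_ge0// lee_fin.
rewrite (fubini_tonelli2 (fun v => (W v.2)%:E * k v.2)%E); last 2 first.
- by apply: emeasurable_funM => //; exact/measurable_EFinP.
- by move=> v; rewrite mule_ge0// lee_fin.
apply: eq_integral => t _; rewrite /fubini_G/=.
rewrite integral_cst//= probability_setT mule1 -uW ge0_integralZr//.
- by apply/measurable_EFinP; apply: measurableT_comp mu1 _; exact: measurable_fun_pair.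
- by move=> x _; rewrite lee_fin.
Qed.

(** The noise is integrated out given the design: [W t] is the conditional
    mean of the factor [u] of one observation at the design point [t], and the
    observations are independent. This is how conditional expectations given
    the design are expressed. *)
Lemma integrate_noise n (H : n.-tuple (rspace R d) -> \bar R) :
  measurable_fun setT H -> (forall t, 0 <= H t)%E ->
  (\int[iid_law P n]_z (H (design z) * (\prod_(v <- z) u v)%:E) =
   \int[iid_law P n]_z (H (design z) * (\prod_(v <- z) W v.2)%:E))%E.
Proof.
have mW2 : measurable_fun setT (fun v : obs => W v.2).
  by apply: measurableT_comp mW _; exact: measurable_snd.
elim: n H => [|n IH] H mH H0.
  by apply: eq_integral => z _; rewrite (tuple0 z) !big_nil.
have mHd m (H' : m.-tuple (rspace R d) -> \bar R) : measurable_fun setT H' ->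
    measurable_fun setT (fun z : m.-tuple obs => H' (design z)).
  by move=> mH'; apply: measurableT_comp mH' _; exact: measurable_design.
have p0 (u' : obs -> R) (s : seq obs) : (forall v, 0 <= u' v) ->
    0 <= \prod_(v <- s) u' v by move=> h; exact: prodr_ge0.
pose q (p : rspace R d * n.-tuple obs) :=
  (H (tuple_cons (p.1, design p.2)) * (\prod_(v <- p.2) W v.2)%:E)%E.
have mq : measurable_fun setT q.
  apply: emeasurable_funM.
    apply: measurableT_comp mH _; apply: (measurableT_comp (@measurable_tuple_cons _ _ n)).
    apply: measurable_fun_pair; first exact: measurable_fst.
    by apply: measurableT_comp; [exact: measurable_design|exact: measurable_snd].
  apply/measurable_EFinP; apply: (measurableT_comp (@measurable_tprod _ _ _ n _ mW2)).
  exact: measurable_snd.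
have q0 p : (0 <= q p)%E by rewrite mule_ge0// lee_fin p0.
pose k t := (\int[iid_law P n]_w q (t, w))%E.
have mk : measurable_fun setT k.
  exact: (@measurable_fun_fubini_tonelli_F _ _ _ _ _ (iid_law P n) q).
have k0 x : (0 <= k x)%E by exact: integral_ge0.
have dE x (w : n.-tuple obs) : design (tuple_cons (x, w)) = tuple_cons (x.2, design w).
  exact/val_inj.
rewrite !ge0_integral_iidS; last 4 first.
- by apply: emeasurable_funM; [exact: mHd|apply/measurable_EFinP; exact: measurable_tprod].
- by move=> z; rewrite mule_ge0// lee_fin p0.
- by apply: emeasurable_funM; [exact: mHd|apply/measurable_EFinP; exact: measurable_tprod].
- by move=> z; rewrite mule_ge0// lee_fin p0.
have mqt t : measurable_fun setT (fun w => q (t, w)).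
  by apply: measurableT_comp mq _; exact: measurable_fun_pair.
transitivity (\int[P]_v ((u v)%:E * k v.2))%E.
  apply: eq_integral => x _.
  have mHs := measurable_slice x.2 mH.
  rewrite -ge0_integralZl//; last by rewrite lee_fin.
  transitivity (\int[iid_law P n]_w ((u x)%:E * (H (tuple_cons (x.2, design w)) *
      (\prod_(v <- w) u v)%:E)))%E.
    by apply: eq_integral => w _; rewrite dE/= big_cons EFinM muleCA.
  rewrite !ge0_integralZl//; first 1 last.
  - apply: emeasurable_funM; first exact: (mHd _ _ mHs).
    by apply/measurable_EFinP; exact: measurable_tprod.
  - by move=> w _; rewrite mule_ge0// lee_fin p0.
  - by rewrite lee_fin.
  - by rewrite lee_fin.
  congr (_ * _)%E; exact: (IH (fun w => H (tuple_cons (x.2, w)))).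
rewrite integrate_noise1//; apply: eq_integral => x _.
rewrite -ge0_integralZl//; last by rewrite lee_fin.
by apply: eq_integral => w _; rewrite dE/= big_cons EFinM muleCA.
Qed.

End IntegrateNoise.

End CameronMartin.

(** * The random sign prior *)

Section RadMeanIntegral.
Context {d : measure_display} {T : measurableType d} {R : realType}.
Variable P : probability T R.

Lemma int_rad_mean n (F : seq R -> T -> R) :
  (forall e, signs n e -> P.-integrable setT (EFin \o F e)) ->
  P.-integrable setT (EFin \o (fun x => rad_mean n (F^~ x))).
Proof.
elim: n F => [|n IH] F iF /=; first exact: iF.
under eq_fun do rewrite mulrC.
apply: intZ; apply: intD; apply: IH => e he; apply: iF.
  exact: signs_cons (expr1n _ _) he.
by apply: signs_cons he; rewrite sqrrN expr1n.
Qed.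

Lemma Rintegral_rad_mean n (F : seq R -> T -> R) :
  (forall e, signs n e -> P.-integrable setT (EFin \o F e)) ->
  \int[P]_x (rad_mean n (F^~ x)) = rad_mean n (fun e => \int[P]_x F e x).
Proof.
elim: n F => [|n IH] F iF //=.
have i1 e : signs n e -> P.-integrable setT (EFin \o F (1 :: e)).
  by move=> he; apply: iF; exact: signs_cons (expr1n _ _) he.
have i2 e : signs n e -> P.-integrable setT (EFin \o F (- 1 :: e)).
  by move=> he; apply: iF; apply: signs_cons he; rewrite sqrrN expr1n.
have j1 := @int_rad_mean n (fun e => F (1 :: e)) i1.
have j2 := @int_rad_mean n (fun e => F (- 1 :: e)) i2.
rewrite RintegralZr//; last exact: intD.
by rewrite RintegralD// !IH.
Qed.

End RadMeanIntegral.

Lemma gauss_lik {R : realType} (a c : R) :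
  (\int[normal_prob (0%R : R) 1%R]_x (expR (x * a - c))%:E =
   (expR (a ^+ 2 / 2 - c))%:E)%E.
Proof.
transitivity (\int[normal_prob (0%R : R) 1%R]_x
    ((expR (- c))%:E * (expR (x * a))%:E))%E.
  by apply: eq_integral => x _; rewrite -EFinM -expRD addrC.
have me : measurable_fun setT (fun x : R => (expR (x * a))%:E).
  by apply/measurable_EFinP; apply: measurableT_comp => //; exact: measurable_funM.
rewrite ge0_integralZl// ?lee_fin ?expR_ge0//.
by rewrite gauss_mgf -EFinM -expRD addrC.
Qed.

Section MixtureArith.
Context {R : realType}.
Variable eta : R.
Hypothesis eta0 : 0 < eta.

(** A test with values [p] has the sum of its errors [p + (1 - p) * y]
    integrated over the sample, where [y] is the likelihood ratio; it is at
    least [1 - `|y - 1|]. The bound by a polynomial of degree two in [y] makes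
    it depend only on the first two moments of the ratio. *)
Lemma mixture_pointwise (p y : R) : 0 <= p -> p <= 1 ->
  1 - eta / 2 - 1 / (2 * eta) + (eta^-1 * y + - (2 * eta)^-1 * y ^+ 2) <=
  p + (1 - p) * y.
Proof.
move=> p0 p1.
have -> : (2 * eta)^-1 = eta^-1 / 2 by rewrite invfM mulrC.
have i0 : 0 < eta^-1 by rewrite invr_gt0.
have ie : eta^-1 * eta = 1 by rewrite mulVf// gt_eqF.
set x := y - 1.
(* the weight [eta] trades the modulus of the centred likelihood ratio for its
   square, by the arithmetic-geometric inequality *)
have am : `|x| <= eta / 2 + eta^-1 / 2 * x ^+ 2.
  have := mulr_ge0 (ltW i0) (sqr_ge0 (eta - `|x|)).
  have -> : eta^-1 * (eta - `|x|) ^+ 2 =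
     (eta^-1 * eta) * eta - 2 * (eta^-1 * eta) * `|x| + eta^-1 * `|x| ^+ 2 by lra.
  by rewrite ie real_normK ?num_real//; lra.
have h1 : - `|x| <= (1 - p) * x.
  have := ler_norm (- x); rewrite normrN => h.
  have := ler_wpM2l (_ : 0 <= 1 - p) h => /(_ ltac:(lra)).
  have := ler_piMl (normr_ge0 x) (_ : 1 - p <= 1) => /(_ ltac:(lra)); lra.
rewrite /x in am h1; lra.
Qed.

Lemma mixture_integrated (p q e : R) : q <= e * p ->
  p * (1 - eta / 2) - (e - 1) * p / (2 * eta) <=
  (1 - eta / 2 - 1 / (2 * eta)) * p + (eta^-1 * p + - (2 * eta)^-1 * q).
Proof.
move=> qe; have k0 : 0 <= (2 * eta)^-1 by rewrite invr_ge0; move: eta0; lra.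
have := ler_wpM2l k0 qe.
have -> : (2 * eta)^-1 = eta^-1 / 2 by rewrite invfM mulrC.
lra.
Qed.

End MixtureArith.

Section RademacherPrior.
Context {R : realType} {d : option nat} (mu : probability (rspace R d) R).
Notation obs := ((measurableTypeR R * rspace R d)%type).
Notation gauss := (normal_prob (0%R : R) 1%R).
Variables (N : nat) (phi : 'I_N -> rspace R d -> R).
Hypothesis phi2 : forall i, phi i \in Lfun mu 2%:E.
Hypothesis phiO : forall i j, \int[mu]_t (phi i t * phi j t) = (i == j)%:R.
Hypothesis phiN : {ae mu, forall t, \sum_i phi i t ^+ 2 = N%:R}.
Variables (n : nat) (rho delta : R).
Hypothesis delta0 : 0 < delta.
Hypothesis delta_small : delta <= 1 / 32.
Let P := (gauss \x mu)%E.
Let kappa := rho ^+ 2.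

(** The regression function with coefficients [rho] times signs; its squared
    norm is [rho ^+ 2 * N] whatever the signs. *)
Definition prior_fun (e : seq R) (t : rspace R d) : R :=
  rho * \sum_(k < N) e`_k * phi k t.

Lemma measurable_prior_fun e : measurable_fun setT (prior_fun e).
Proof.
apply: measurable_funM => //; apply: measurable_sum => k.
by apply: measurable_funM => //; exact: L2_measurable (phi2 k).
Qed.

Definition gram (k m : 'I_N) (ts : seq (rspace R d)) : R :=
  \sum_(t <- ts) phi k t * phi m t.

(** The squared Frobenius norm of [kappa] times the unnormalised empirical
    Gram matrix. *)
Definition gram_norm (ts : seq (rspace R d)) : R :=
  kappa ^+ 2 * \sum_k \sum_m gram k m ts ^+ 2.

(** The designs on which the empirical Gram matrix is small enough for the
    conditional second moment of the likelihood ratio to be close to one. *)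
Definition good_design : set (n.-tuple (rspace R d)) :=
  [set ts | gram_norm ts <= delta].

Let good (z : n.-tuple obs) : R := \1_good_design (design z).

Lemma measurable_gram_design k m :
  measurable_fun setT (fun z : n.-tuple obs => gram k m (design z)).
Proof.
have mg : measurable_fun setT (fun ts : n.-tuple (rspace R d) => gram k m ts).
  apply: measurable_lsum.
  by apply: measurable_funM; [exact: L2_measurable (phi2 k)|exact: L2_measurable (phi2 m)].
exact: measurableT_comp mg (@measurable_design R d n).
Qed.

Lemma measurable_gram_norm :
  measurable_fun setT (fun ts : n.-tuple (rspace R d) => gram_norm ts).
Proof.
apply: measurable_funM => //; apply: measurable_sum => k; apply: measurable_sum => m.
apply: measurable_funX; apply: measurable_lsum.
by apply: measurable_funM; [exact: L2_measurable (phi2 k)|exact: L2_measurable (phi2 m)].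
Qed.

Lemma measurable_good_design : measurable good_design.
Proof.
rewrite (_ : good_design = setT `&`
   (fun ts : n.-tuple (rspace R d) => gram_norm ts) @^-1` `]-oo, delta]%classic).
  by apply: measurable_gram_norm => //; exact: measurable_itv.
by rewrite setTI; apply/seteqP; split => ts /=; rewrite in_itv.
Qed.

Let mgoodd : measurable_fun setT
  (fun ts : n.-tuple (rspace R d) => (\1_good_design ts : R)%:E).
Proof. by apply/measurable_EFinP; apply: measurable_indic; exact: measurable_good_design. Qed.

Let goodd0 (ts : n.-tuple (rspace R d)) : (0 <= (\1_good_design ts : R)%:E)%E.
Proof. by rewrite lee_fin. Qed.

Let mgood : measurable_fun setT good.
Proof.
apply/measurable_EFinP; apply: (measurableT_comp mgoodd).
exact: measurable_design.
Qed.

Let good01 z : 0 <= good z <= 1.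
Proof. by rewrite /good indicE; case: (_ \in _); rewrite !lexx ler01. Qed.

Let igood : (iid_law P n).-integrable setT (EFin \o good).
Proof. exact: int01. Qed.

Lemma lik_mean f : measurable_fun setT f ->
  (\int[iid_law P n]_z (lik f z)%:E = 1)%E.
Proof.
move=> mf; have := @cameron_martin _ _ mu n f (fun=> 1%E) mf (@measurable_cst _ _ _ _ _ _) (fun=> lee01).
rewrite integral_cst//= probability_setT mule1 => ->.
by apply: eq_integral => z _; rewrite mul1e.
Qed.

Lemma lik_int f : measurable_fun setT f ->
  (iid_law P n).-integrable setT (EFin \o (fun z => lik f z)).
Proof.
move=> mf; apply/integrableP; split.
  by apply/measurable_EFinP; exact: measurable_lik.
rewrite (eq_integral (fun z : n.-tuple obs => (lik f z)%:E)).
  by rewrite lik_mean// ltry.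
by move=> z _; rewrite /= ger0_norm// lik_ge0.
Qed.

(** Goodness depends on the design only, and given the design a likelihood
    ratio has mean one. *)
Lemma good_lik_mean e :
  (\int[iid_law P n]_z ((good z)%:E * (lik (prior_fun e) z)%:E) =
   \int[iid_law P n]_z (good z)%:E)%E.
Proof.
have mf := measurable_prior_fun e.
rewrite (@integrate_noise _ _ mu (lik1 (prior_fun e)) (fun=> 1) _ _ _ _ _ n
  (fun ts => (\1_good_design ts : R)%:E))//.
- by apply: eq_integral => z _; rewrite big1 ?mule1.
- exact: measurable_lik1.
- by move=> v; exact: expR_ge0.
- by move=> t; rewrite (gauss_lik (prior_fun e t) (prior_fun e t ^+ 2 / 2)) subrr expR0.
Qed.

(** Given the design, the product of two Gaussian likelihood ratios has mean
    the exponential of the inner product of the two shifts. *)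
Lemma good_lik2_mean e e' :
  (\int[iid_law P n]_z ((good z)%:E *
     (lik (prior_fun e) z * lik (prior_fun e') z)%:E) =
   \int[iid_law P n]_z ((good z)%:E *
     (expR (\sum_(m < N) e'`_m * (kappa * \sum_(k < N) e`_k * gram k m (design z))))%:E))%E.
Proof.
have mf := measurable_prior_fun e; have mf' := measurable_prior_fun e'.
pose g := prior_fun e; pose g' := prior_fun e'.
transitivity (\int[iid_law P n]_z ((good z)%:E *
    (\prod_(v <- z) (lik1 g v * lik1 g' v))%:E))%E.
  by apply: eq_integral => z _; rewrite /lik big_split.
rewrite (@integrate_noise _ _ mu (fun v => lik1 g v * lik1 g' v)
  (fun t => expR (g t * g' t)) _ _ _ _ _ n
  (fun ts => (\1_good_design ts : R)%:E))//; first last.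
- move=> t; transitivity (\int[gauss]_x
     (expR (x * (g t + g' t) - (g t ^+ 2 + g' t ^+ 2) / 2))%:E)%E.
    by apply: eq_integral => x _; rewrite /lik1 -expRD/=; congr (expR _)%:E; lra.
  by rewrite gauss_lik; congr (expR _)%:E; lra.
- by apply: measurableT_comp => //; exact: measurable_funM.
- by move=> v; rewrite mulr_ge0// expR_ge0.
- by apply: measurable_funM; exact: measurable_lik1.
apply: eq_integral => z _; congr (_ * _%:E)%E.
rewrite -expR_sum; congr expR.
under [RHS]eq_bigr do under eq_bigr do rewrite /gram big_map.
transitivity (\sum_(v <- z) \sum_(m < N) e'`_m * (kappa * \sum_(k < N) e`_k * (phi k v.2 * phi m v.2))).
  apply: eq_bigr => v _.
  transitivity (\sum_(m < N) kappa *
      ((\sum_(k < N) e`_k * phi k v.2) * (e'`_m * phi m v.2))).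
    by rewrite -mulr_sumr -mulr_sumr /g /g' /prior_fun mulrACA -expr2.
  apply: eq_bigr => m _; rewrite mulr_suml mulr_sumr [in RHS]mulr_sumr mulr_sumr.
  by apply: eq_bigr => k _; lra.
rewrite exchange_big/=; apply: eq_bigr => m _.
rewrite -mulr_sumr -mulr_sumr exchange_big/=; congr (_ * (_ * _)).
by apply: eq_bigr => k _; rewrite -mulr_sumr.
Qed.

(** A crude bound, which only serves to prove integrability. *)
Lemma gram_exponent_le ts e e' : gram_norm ts <= delta -> signs N e -> signs N e' ->
  \sum_(m < N) e'`_m * (kappa * \sum_(k < N) e`_k * gram k m ts) <= N%:R * N%:R.
Proof.
move=> hts he he'.
have g1 k m : `|kappa * gram k m ts| <= 1.
  rewrite -(@ler_pXn2r _ 2) ?nnegrE// real_normK ?num_real// expr1n exprMn.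
  apply: (@le_trans _ _ (gram_norm ts)); last by apply: le_trans hts _; apply: le_trans delta_small _; lra.
  apply: ler_wpM2l; first exact: sqr_ge0.
  rewrite (bigD1 k)//= (bigD1 m)//= -addrA lerDl addr_ge0// sumr_ge0// => i _.
    exact: sqr_ge0.
  by apply: sumr_ge0 => j _; exact: sqr_ge0.
have s1 e0 (k : 'I_N) : signs N e0 -> `|e0`_k| = 1.
  move=> h0; apply/eqP; rewrite -(@eqrXn2 _ 2) ?nnegrE//.
  by rewrite real_normK ?num_real// (signs_nth k h0) expr1n.
have c1 : N%:R = \sum_(k < N) (1 : R) by rewrite sumr_const card_ord.
apply: le_trans (ler_norm _) _; apply: le_trans (ler_norm_sum _ _ _) _.
rewrite {2}c1 mulr_sumr; apply: ler_sum => m _; rewrite normrM s1// mul1r mulr1.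
rewrite mulr_sumr; apply: le_trans (ler_norm_sum _ _ _) _.
rewrite c1; apply: ler_sum => k _.
by rewrite mulrCA normrM s1// mul1r.
Qed.

Lemma good_lik2_int e e' : signs N e -> signs N e' ->
  (iid_law P n).-integrable setT (EFin \o (fun z =>
     good z * (lik (prior_fun e) z * lik (prior_fun e') z))).
Proof.
move=> he he'.
have mf := measurable_prior_fun e; have mf' := measurable_prior_fun e'.
apply/integrableP; split.
  apply/measurable_EFinP; apply: measurable_funM => //.
  by apply: measurable_funM; exact: measurable_lik.
rewrite (eq_integral (fun z : n.-tuple obs => (good z)%:E *
    (lik (prior_fun e) z * lik (prior_fun e') z)%:E)%E); last first.
  move=> z _; rewrite /= ger0_norm// !mulr_ge0 ?lik_ge0//.
rewrite good_lik2_mean.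
apply: (@le_lt_trans _ _ (\int[iid_law P n]_z (expR (N%:R * N%:R))%:E)%E); last first.
  by rewrite integral_cst//= probability_setT mule1 ltry.
apply: ge0_le_integral => //=.
- move=> z _; rewrite mule_ge0// lee_fin ?expR_ge0//.
- apply: emeasurable_funM; first exact/measurable_EFinP.
  apply/measurable_EFinP; apply: measurableT_comp => //.
  apply: measurable_sum => m; apply: measurable_funM => //; apply: measurable_funM => //.
  apply: measurable_sum => k; apply: measurable_funM => //.
  exact: measurable_gram_design.
- move=> z _; rewrite -EFinM lee_fin /good indicE.
  case: (boolP (_ \in _)) => [|_]; last by rewrite mul0r expR_ge0.
  by rewrite inE mul1r ler_expR => /gram_exponent_le; exact.
Qed.

(** Averaging over [e'] makes the exponent quadratic in [e], and averaging
    over [e] then bounds it by a multiple of the squared Frobenius norm. The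
    constant [1 / 32] keeps the denominator of [rad_mean_quadratic] at least
    [1 / 2]. *)
Lemma rad_mean_gram ts : gram_norm ts <= delta ->
  rad_mean N (fun e => rad_mean N (fun e' =>
    expR (\sum_(m < N) e'`_m * (kappa * \sum_(k < N) e`_k * gram k m ts)))) <=
  expR (4 * delta).
Proof.
move=> hts; set S := \sum_k \sum_m gram k m ts ^+ 2.
have S0 : 0 <= kappa ^+ 2 * S.
  apply: mulr_ge0; first exact: sqr_ge0.
  by apply: sumr_ge0 => k _; apply: sumr_ge0 => m _; exact: sqr_ge0.
have Sd : kappa ^+ 2 * S <= delta by [].
apply: (@le_trans _ _ (rad_mean N (fun e : seq R => expR ((2 * kappa ^+ 2) *
    \sum_(m < N) (0 + \sum_(k < N) e`_k * gram k m ts) ^+ 2)))).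
  apply: le_rad_mean => e _; apply: le_trans (rad_mean_linear _) _.
  rewrite ler_expR -mulrA; apply: ler_wpM2l => //.
  rewrite mulr_sumr le_eqVlt; apply/orP; left; apply/eqP.
  by apply: eq_bigr => m _; rewrite add0r exprMn.
have a0 : 0 <= 2 * kappa ^+ 2 by rewrite mulr_ge0// sqr_ge0.
have aS : 8 * (2 * kappa ^+ 2) * S < 1 by move: delta_small; lra.
apply: le_trans (rad_mean_quadratic (fun=> 0) a0 aS) _.
rewrite ler_expR -/S big1 ?add0r; last by move=> m _; rewrite expr0n.
have D0 : 0 < 1 - 8 * (2 * kappa ^+ 2) * S by lra.
rewrite mulrAC ler_pdivrMr//.
have := mulr_ge0 (ltW delta0) (_ : 0 <= 1 / 2 - 16 * (kappa ^+ 2 * S)).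
by move: delta_small => ?; move=> /(_ ltac:(lra)); lra.
Qed.

Let Pgood := \int[iid_law P n]_z good z.

Let Lbar (z : n.-tuple obs) := rad_mean N (fun e => lik (prior_fun e) z).

Let iGL e : (iid_law P n).-integrable setT
  (EFin \o (fun z => good z * lik (prior_fun e) z)).
Proof.
apply: (le_integrable measurableT) (lik_int (measurable_prior_fun e)).
  apply/measurable_EFinP; apply: measurable_funM => //.
  by apply: measurable_lik; exact: measurable_prior_fun.
move=> z _ /=; have /andP[g0 g1] := good01 z.
rewrite lee_fin normrM ger0_norm//; have := normr_ge0 (lik (prior_fun e) z).
by move=> h; have := ler_wpM2r h g1; lra.
Qed.

Lemma good_Lbar : \int[iid_law P n]_z (good z * Lbar z) = Pgood.
Proof.
rewrite /Lbar; under eq_Rintegral do rewrite -rad_meanZ.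
rewrite (Rintegral_rad_mean (F := fun e z => good z * lik (prior_fun e) z)).
  rewrite -[RHS](rad_mean_cst N); apply: eq_rad_mean => e.
  transitivity (fine (\int[iid_law P n]_z
      ((good z)%:E * (lik (prior_fun e) z)%:E)))%E; last by rewrite good_lik_mean.
  by congr fine; apply: eq_integral.
by move=> e _.
Qed.

Let G2 e e' (z : n.-tuple obs) :=
  good z * (lik (prior_fun e) z * lik (prior_fun e') z).

Let Lbar2E z : good z * Lbar z ^+ 2 =
  rad_mean N (fun e => rad_mean N (fun e' => G2 e e' z)).
Proof.
rewrite expr2 rad_meanM -rad_meanZ; apply: eq_rad_mean => e.
by rewrite -rad_meanZ.
Qed.

Let iLbar2 : (iid_law P n).-integrable setT (EFin \o (fun z => good z * Lbar z ^+ 2)).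
Proof.
rewrite (funext Lbar2E).
apply: (int_rad_mean (F := fun e z => rad_mean N (fun e' => G2 e e' z))) => e he.
apply: (int_rad_mean (F := fun e' z => G2 e e' z)) => e' he'.
exact: good_lik2_int.
Qed.

Let X2 e e' (z : n.-tuple obs) := good z *
  expR (\sum_(m < N) e'`_m * (kappa * \sum_(k < N) e`_k * gram k m (design z))).

Let iX2 e e' : signs N e -> signs N e' ->
  (iid_law P n).-integrable setT (EFin \o X2 e e').
Proof.
move=> he he'.
apply: (le_integrable measurableT) (L2_int (L2_cst (iid_law P n) (expR (N%:R * N%:R)))).
  apply/measurable_EFinP; apply: measurable_funM => //; apply: measurableT_comp => //.
  apply: measurable_sum => m; apply: measurable_funM => //; apply: measurable_funM => //.
  apply: measurable_sum => k; apply: measurable_funM => //.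
  exact: measurable_gram_design.
move=> z _ /=; rewrite lee_fin !ger0_norm ?expR_ge0//; last first.
  by rewrite mulr_ge0 ?expR_ge0//; have /andP[] := good01 z.
rewrite /X2 /good indicE; case: (boolP (_ \in _)) => [|_]; last by rewrite mul0r expR_ge0.
by rewrite inE mul1r ler_expR => /gram_exponent_le; exact.
Qed.

(** The second moment of the averaged likelihood ratio is a double average
    over independent sign vectors, exchanged with the integral over the
    sample. *)
Lemma good_Lbar2 : \int[iid_law P n]_z (good z * Lbar z ^+ 2) <=
  expR (4 * delta) * Pgood.
Proof.
under eq_Rintegral do rewrite Lbar2E.
rewrite (Rintegral_rad_mean (F := fun e z => rad_mean N (fun e' => G2 e e' z))); last first.
  move=> e he; apply: (int_rad_mean (F := fun e' z => G2 e e' z)) => e' he'.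
  exact: good_lik2_int.
apply: (@le_trans _ _ (\int[iid_law P n]_z
    (rad_mean N (fun e => rad_mean N (fun e' => X2 e e' z))))).
  rewrite (Rintegral_rad_mean (F := fun e z => rad_mean N (fun e' => X2 e e' z))); last first.
    move=> e he; apply: (int_rad_mean (F := fun e' z => X2 e e' z)) => e' he'.
    exact: iX2.
  apply: le_rad_mean => e he.
  rewrite (Rintegral_rad_mean (F := fun e' z => G2 e e' z)); last first.
    by move=> e' he'; exact: good_lik2_int.
  rewrite (Rintegral_rad_mean (F := fun e' z => X2 e e' z)); last first.
    by move=> e' he'; exact: iX2.
  apply: le_rad_mean => e' he'; rewrite le_eqVlt; apply/orP; left; apply/eqP.
  rewrite /Rintegral; congr fine.
  transitivity (\int[iid_law P n]_z ((good z)%:E *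
     (lik (prior_fun e) z * lik (prior_fun e') z)%:E))%E; first exact: eq_integral.
  by rewrite good_lik2_mean; exact: eq_integral.
rewrite -RintegralZl//; apply: le_Rintegral => //.
- apply: (int_rad_mean (F := fun e z => rad_mean N (fun e' => X2 e e' z))) => e he.
  by apply: (int_rad_mean (F := fun e' z => X2 e e' z)) => e' he'; exact: iX2.
- exact: intZ.
move=> z _; rewrite /X2.
under eq_rad_mean do rewrite rad_meanZ.
rewrite rad_meanZ mulrC.
rewrite /good indicE; case: (boolP (_ \in _)) => [|_]; last by rewrite !mulr0.
by rewrite inE !mulr1 => /rad_mean_gram.
Qed.

(** The diagonal entries of the Gram matrix have mean [n], the others mean
    zero; the fluctuations are summed by [phi_energy]. *)
Lemma gram_norm_mean :
  \int[iid_law P n]_z gram_norm (design z) <=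
  kappa ^+ 2 * (n%:R * N%:R ^+ 2 + n%:R ^+ 2 * N%:R).
Proof.
pose q k m (v : obs) : R := phi k v.2 * phi m v.2.
have q2 k m : q k m \in Lfun P 2%:E.
  exact: (L2_snd gauss (mul_phi_L2 phi2 phiN m (phi2 k))).
have gq k m (z : n.-tuple obs) : gram k m (design z) = \sum_(v <- z) q k m v.
  by rewrite /gram big_map.
have i1 k m := L2_intM (L2_lsum n (q2 k m)) (L2_lsum n (q2 k m)).
have -> : \int[iid_law P n]_z gram_norm (design z) = kappa ^+ 2 * \sum_k \sum_m
    \int[iid_law P n]_z ((\sum_(v <- z) q k m v) * (\sum_(v <- z) q k m v)).
  transitivity (\int[iid_law P n]_z (kappa ^+ 2 * \sum_k \sum_m
      ((\sum_(v <- z) q k m v) * (\sum_(v <- z) q k m v)))).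
    apply: eq_Rintegral => z _; rewrite /gram_norm; congr (_ * _).
    by apply: eq_bigr => k _; apply: eq_bigr => m _; rewrite gq expr2.
  have i2 k := int_sum (index_enum 'I_N) (i1 k).
  rewrite RintegralZl//; last exact: (int_sum _ i2).
  rewrite Rintegral_sum//; congr (_ * _); apply: eq_bigr => k _.
  by rewrite Rintegral_sum.
apply: ler_wpM2l; first exact: sqr_ge0.
have e1 k m : \int[P]_v q k m v = (k == m)%:R.
  by rewrite (Rintegral_snd gauss (L2_intM (phi2 k) (phi2 m))).
have e2 k m : \int[P]_v (q k m v * q k m v) =
    \int[mu]_t ((phi k t * phi m t) * (phi k t * phi m t)).
  rewrite (Rintegral_snd gauss (g := fun t => (phi k t * phi m t) * (phi k t * phi m t)))//.
  by apply: L2_intM; exact: (mul_phi_L2 phi2 phiN m (phi2 k)).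
apply: (@le_trans _ _ (\sum_k \sum_m (n%:R *
   \int[mu]_t ((phi k t * phi m t) * (phi k t * phi m t)) +
   n%:R ^+ 2 * (k == m)%:R))).
  apply: ler_sum => k _; apply: ler_sum => m _.
  rewrite Rintegral_lsumM// e1 e2 lerD2l.
  case: (k == m); last by rewrite !mulr0.
  by rewrite !mulr1 expr2; apply: ler_wpM2l => //; rewrite gerBl.
under eq_bigr do rewrite big_split/= -!mulr_sumr (phi_energy phi2 phiN (phi2 _)).
rewrite big_split/= -!mulr_sumr.
have -> : \sum_k \int[mu]_t (phi k t * phi k t) = N%:R.
  under eq_bigr do rewrite phiO eqxx.
  by rewrite sumr_const card_ord.
by rewrite sum_delta -expr2.
Qed.

(** Markov's inequality for the squared Frobenius norm. *)
Lemma Pgood_ge :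
  1 - kappa ^+ 2 * (n%:R * N%:R ^+ 2 + n%:R ^+ 2 * N%:R) / delta <= Pgood.
Proof.
have q2 k m : (fun v : obs => phi k v.2 * phi m v.2) \in Lfun P 2%:E.
  exact: (L2_snd gauss (mul_phi_L2 phi2 phiN m (phi2 k))).
have ig : (iid_law P n).-integrable setT (EFin \o (fun z => gram_norm (design z))).
  apply: intZ; apply: int_sum => k; apply: int_sum => m.
  have := L2_intM (L2_lsum n (q2 k m)) (L2_lsum n (q2 k m)).
  congr (_.-integrable _ _); apply/funext => z /=; congr (_%:E).
  by rewrite /gram big_map expr2.
have i1 := L2_int (L2_cst (iid_law P n) 1).
have i2 := intZ (- delta^-1) ig.
have -> : 1 - kappa ^+ 2 * (n%:R * N%:R ^+ 2 + n%:R ^+ 2 * N%:R) / delta =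
   1 + - delta^-1 * (kappa ^+ 2 * (n%:R * N%:R ^+ 2 + n%:R ^+ 2 * N%:R)) by lra.
apply: (@le_trans _ _ (\int[iid_law P n]_z (1 + - delta^-1 * gram_norm (design z)))).
  rewrite RintegralD// RintegralZl// Rintegral_1 lerD2l !mulNr lerN2.
  apply: ler_wpM2l; [by rewrite invr_ge0 ltW|exact: gram_norm_mean].
apply: le_Rintegral => //; first exact: intD.
move=> z _; rewrite /good indicE.
have g0 : 0 <= gram_norm (design z).
  apply: mulr_ge0; first exact: sqr_ge0.
  by apply: sumr_ge0 => k _; apply: sumr_ge0 => m _; exact: sqr_ge0.
have d1 : 0 < delta^-1 by rewrite invr_gt0.
case: (boolP (_ \in _)) => [_|].
  by have := mulr_ge0 (ltW d1) g0; rewrite mulNr mulr1n; lra.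
rewrite notin_setE/= => /negP; rewrite -ltNge => hg.
have : delta^-1 * delta <= delta^-1 * gram_norm (design z).
  by apply: ler_wpM2l; exact: ltW.
by rewrite mulVf ?gt_eqF// mulNr; lra.
Qed.

Lemma Pgood_le1 : Pgood <= 1.
Proof.
rewrite -[leRHS](Rintegral_1 (iid_law P n)); apply: le_Rintegral => //.
  exact: L2_int (L2_cst _ _).
by move=> z _; have /andP[] := good01 z.
Qed.

(** The largest sum of errors over the support of the prior is at least its
    average over the prior. By the Cameron-Martin formula this average is an
    integral over pure noise, which may be restricted to the good designs as
    its integrand is nonnegative. *)
Lemma bayes_lower_bound (psi : n.-tuple obs -> R) (eta g : R) :
  is_test psi -> 0 < eta ->
  (forall e, signs N e -> \int[iid_law P n]_w psi w +
    \int[iid_law P n]_w (1 - psi (obs_sample (prior_fun e) w)) <= g) ->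
  Pgood * (1 - eta / 2) - (expR (4 * delta) - 1) * Pgood / (2 * eta) <= g.
Proof.
move=> [mpsi psi01] eta0 hg.
have ipsi : (iid_law P n).-integrable setT (EFin \o psi) by exact: int01.
have iml e : (iid_law P n).-integrable setT
    (EFin \o (fun z => (1 - psi z) * lik (prior_fun e) z)).
  apply: (le_integrable measurableT) (lik_int (measurable_prior_fun e)).
    apply/measurable_EFinP; apply: measurable_funM; first exact: measurable_funB.
    by apply: measurable_lik; exact: measurable_prior_fun.
  move=> z _ /=; have /andP[h1 h2] := psi01 z.
  rewrite lee_fin normrM ger0_norm; last lra.
  by apply: ler_piMl => //; lra.
have power e : \int[iid_law P n]_w (1 - psi (obs_sample (prior_fun e) w)) =
    \int[iid_law P n]_z ((1 - psi z) * lik (prior_fun e) z).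
  rewrite /Rintegral; congr fine.
  rewrite (@cameron_martin _ _ mu n (prior_fun e) (fun z => (1 - psi z)%:E)).
  - by apply: eq_integral => z _.
  - exact: measurable_prior_fun.
  - by apply/measurable_EFinP; exact: measurable_funB.
  - by move=> z; rewrite lee_fin subr_ge0; have /andP[] := psi01 z.
have iLb : (iid_law P n).-integrable setT (EFin \o (fun z => (1 - psi z) * Lbar z)).
  rewrite (_ : (fun z => _) = fun z : n.-tuple obs => rad_mean N
      (fun e => (1 - psi z) * lik (prior_fun e) z)).
    by apply: (int_rad_mean (F := fun e z => (1 - psi z) * lik (prior_fun e) z)).
  by apply/funext => z; rewrite rad_meanZ.
apply: (@le_trans _ _ (\int[iid_law P n]_z (psi z + (1 - psi z) * Lbar z))); last first.
  rewrite RintegralD//.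
  have -> : \int[iid_law P n]_z ((1 - psi z) * Lbar z) = rad_mean N (fun e =>
      \int[iid_law P n]_z ((1 - psi z) * lik (prior_fun e) z)).
    transitivity (\int[iid_law P n]_z (rad_mean N
        (fun e => (1 - psi z) * lik (prior_fun e) z))).
      by apply: eq_Rintegral => z _; rewrite rad_meanZ.
    exact: (Rintegral_rad_mean (F := fun e z => (1 - psi z) * lik (prior_fun e) z)).
  rewrite -[X in X + _](rad_mean_cst N) -rad_meanD -[leRHS](rad_mean_cst N).
  by apply: le_rad_mean => e he; rewrite -power; exact: hg.
have i1 := intZ (1 - eta / 2 - 1 / (2 * eta)) igood.
have iGLb : (iid_law P n).-integrable setT (EFin \o (fun z => good z * Lbar z)).
  rewrite (_ : (fun z => _) = fun z : n.-tuple obs => rad_mean N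
      (fun e => good z * lik (prior_fun e) z)).
    by apply: (int_rad_mean (F := fun e z => good z * lik (prior_fun e) z)).
  by apply/funext => z; rewrite rad_meanZ.
have i2 := intZ eta^-1 iGLb.
have i3 := intZ (- (2 * eta)^-1) iLbar2.
have i23 := intD i2 i3.
apply: (@le_trans _ _ (\int[iid_law P n]_z
    ((1 - eta / 2 - 1 / (2 * eta)) * good z +
     (eta^-1 * (good z * Lbar z) + - (2 * eta)^-1 * (good z * Lbar z ^+ 2))))).
  rewrite RintegralD// RintegralD// !RintegralZl// good_Lbar -/Pgood.
  exact: mixture_integrated good_Lbar2.
apply: le_Rintegral => //; [exact: intD|exact: intD|].
move=> z _; have /andP[p0 p1] := psi01 z.
have L0 : 0 <= Lbar z.
  by rewrite -(rad_mean_cst N 0); apply: le_rad_mean => e _; exact: lik_ge0.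
rewrite /good indicE; case: (boolP (_ \in _)) => [_|_]; last first.
  rewrite mulr0n !mul0r !mulr0 !addr0; apply: addr_ge0 => //.
  by apply: mulr_ge0 => //; rewrite subr_ge0.
by have := mixture_pointwise eta0 (Lbar z) p0 p1; rewrite mulr1n !mul1r mulr1.
Qed.

End RademacherPrior.

(** * Minimax lower bound *)

Section Errors.
Context {R : realType} {d : option nat} (mu : probability (rspace R d) R).
Notation obs := ((measurableTypeR R * rspace R d)%type).
Variables (F : set (rspace R d -> R)) (n : nat).
Hypothesis F2 : forall f, F f -> f \in Lfun mu 2%:E.
Implicit Types (psi : n.-tuple obs -> R) (f : rspace R d -> R).

Lemma expect_obs01 f psi : f \in Lfun mu 2%:E -> is_test psi ->
  0 <= expect_obs mu f psi <= 1.
Proof.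
move=> f2 [mpsi psi01]; apply/andP; split.
  by apply: Rintegral_ge0 => z _; have /andP[] := psi01 (obs_sample f z).
rewrite -[leRHS](Rintegral_1 (noise_design mu n)).
apply: le_Rintegral => //.
- apply: int01 => //.
  by apply: measurableT_comp mpsi _; apply: measurable_obs_sample; exact: L2_measurable f2.
- exact: L2_int (L2_cst _ _).
- by move=> z _; have /andP[] := psi01 (obs_sample f z).
Qed.

Lemma is_testC psi : is_test psi -> is_test (fun z => 1 - psi z).
Proof.
move=> [mpsi psi01]; split; first exact: measurable_funB.
by move=> z; have /andP[h1 h2] := psi01 z; apply/andP; split; lra.
Qed.

Lemma beta_err_ge r psi f : is_test psi -> separated_class mu F r f ->
  expect_obs mu f (fun z => 1 - psi z) <= beta_err mu F r psi.
Proof.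
move=> tpsi Ff; apply: ub_le_sup; last by exists f.
exists 1 => _ [g [Fg _] <-].
by have /andP[] := expect_obs01 (F2 Fg) (is_testC tpsi).
Qed.

Lemma beta_err_le r psi b : 0 <= b ->
  (forall f, separated_class mu F r f ->
    expect_obs mu f (fun z => 1 - psi z) <= b) ->
  beta_err mu F r psi <= b.
Proof.
move=> b0 h; rewrite /beta_err; set S := [set _ | _ in _].
have [->|/set0P S0] := eqVneq S set0; first by rewrite sup0.
by apply: ge_sup => // _ [f Ff <-]; exact: h.
Qed.

Lemma beta_err_ge0 r psi : is_test psi -> 0 <= beta_err mu F r psi.
Proof.
move=> tpsi; rewrite /beta_err; set S := [set _ | _ in _].
have [->|/set0P [x Sx]] := eqVneq S set0; first by rewrite sup0.
have [f [Ff fr] fx] := Sx.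
apply: le_trans (beta_err_ge (f := f) tpsi _) => //.
by have /andP[] := expect_obs01 (F2 Ff) (is_testC tpsi).
Qed.

Lemma zero_L2 : (fun=> 0 : R) \in Lfun mu 2%:E.
Proof. exact: L2_cst. Qed.

Lemma alpha_err01 psi : is_test psi -> 0 <= alpha_err mu psi <= 1.
Proof. by move=> tpsi; exact: expect_obs01 zero_L2 tpsi. Qed.

Lemma gamma_err_ge0 r psi : is_test psi -> 0 <= gamma_err mu F r psi.
Proof.
move=> tpsi; apply: addr_ge0; last exact: beta_err_ge0.
by have /andP[] := alpha_err01 tpsi.
Qed.

Lemma is_test_cst (x : R) : 0 <= x <= 1 -> is_test (fun _ : n.-tuple obs => x).
Proof. by move=> hx; split => //; exact: measurable_cst. Qed.

Lemma gamma_inf_le r psi : is_test psi -> gamma_inf mu F r n <= gamma_err mu F r psi.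
Proof.
move=> tpsi; apply: ge_inf; last by exists psi.
by exists 0 => _ [p tp <-]; exact: gamma_err_ge0.
Qed.

Lemma gamma_inf_ge r b : (forall psi, is_test psi -> b <= gamma_err mu F r psi) ->
  b <= gamma_inf mu F r n.
Proof.
move=> h; apply: lb_le_inf.
  exists (gamma_err mu F r (fun _ : n.-tuple obs => 0)), (fun=> 0) => //.
  by apply: is_test_cst; rewrite lexx ler01.
by move=> _ [p tp <-]; exact: h.
Qed.

Lemma gamma_inf_ge0 r : 0 <= gamma_inf mu F r n.
Proof. by apply: gamma_inf_ge => psi; exact: gamma_err_ge0. Qed.

Lemma gamma_inf_le1 r : gamma_inf mu F r n <= 1.
Proof.
have t0 : is_test (fun _ : n.-tuple obs => 0 : R).
  by apply: is_test_cst; rewrite lexx ler01.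
apply: le_trans (gamma_inf_le r t0) _.
rewrite /gamma_err /alpha_err /expect_obs Rintegral_1 add0r.
apply: beta_err_le => // f [Ff _].
by have /andP[] := expect_obs01 (F2 Ff) (is_testC t0).
Qed.

Lemma beta_inf_le r a psi : is_test psi -> alpha_err mu psi <= a ->
  beta_inf mu F r n a <= beta_err mu F r psi.
Proof.
move=> tpsi ha; apply: ge_inf; last by exists psi.
by exists 0 => _ [p [tp _] <-]; exact: beta_err_ge0.
Qed.

Lemma beta_inf_ge0 r a : 0 <= a -> 0 <= beta_inf mu F r n a.
Proof.
move=> a0; apply: lb_le_inf.
  exists (beta_err mu F r (fun _ : n.-tuple obs => 0)), (fun=> 0) => //; split.
    by apply: is_test_cst; rewrite lexx ler01.
  by rewrite /alpha_err /expect_obs Rintegral_1.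
by move=> _ [p [tp _] <-]; exact: beta_err_ge0.
Qed.

End Errors.

Section PriorClass.
Context {R : realType} {d : option nat} (mu : probability (rspace R d) R).
Context {L : choiceType} (phi : L -> rspace R d -> R) (c : L -> R).
Hypothesis hphi : orthonormal_system mu phi.
Hypothesis c0 : forall l, 0 <= c l.
Variable K : R.
Hypothesis K0 : 0 < K.
Hypothesis fA : finite_set (level_set c K).

Let s : seq L := fset_set (level_set c K).
Let N := size s.
Let fam := @subfamily R d L phi s.
Let us : uniq s. Proof. exact: fset_uniq. Qed.

Variables (rho : R) (e : seq R).
Hypothesis he : signs N e.

Let f := prior_fun fam rho e.

Let fE : f = fun t => \sum_(i < N) (rho * e`_i) * fam i t.
Proof.
by apply/funext => t; rewrite /f /prior_fun mulr_sumr; apply: eq_bigr => i _; rewrite mulrA.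
Qed.

Lemma prior_L2 : f \in Lfun mu 2%:E.
Proof. by rewrite fE; apply: L2_sum => i; apply: L2Z; exact: (subfamily_L2 hphi). Qed.

Lemma prior_fcoef l :
  fcoef mu phi f l = \sum_(i < N) (rho * e`_i) * (tnth (in_tuple s) i == l)%:R.
Proof.
rewrite /fcoef fE.
have i1 (i : 'I_N) := intZ (rho * e`_i) (L2_intM (subfamily_L2 hphi i) (hphi.1 l)).
transitivity (\int[mu]_t \sum_(i < N) (rho * e`_i) * (fam i t * phi l t)).
  by apply: eq_Rintegral => t _; rewrite mulr_suml; apply: eq_bigr => i _; rewrite mulrA.
rewrite Rintegral_sum//; apply: eq_bigr => i _; rewrite RintegralZl ?hphi.2//.
by apply: L2_intM; [exact: (subfamily_L2 hphi)|exact: hphi.1].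
Qed.

Lemma prior_fcoef_tnth i : fcoef mu phi f (tnth (in_tuple s) i) = rho * e`_i.
Proof.
rewrite prior_fcoef (bigD1 i)//= eqxx mulr1 big1 ?addr0// => j ji.
rewrite (inj_eq (elimT (tuple_uniqP (in_tuple s)) us)).
by rewrite (negbTE ji) mulr0.
Qed.

Lemma prior_fcoef_sqr l : fcoef mu phi f l ^+ 2 = if l \in s then rho ^+ 2 else 0.
Proof.
case: ifPn => [/(tnthP (in_tuple s))[i ->]|ls].
  by rewrite prior_fcoef_tnth exprMn (signs_nth i he) mulr1.
rewrite prior_fcoef big1 ?expr0n// => i _.
case: eqP => [il|_]; last by rewrite mulr0.
by move: ls; rewrite -il mem_tnth.
Qed.

Lemma prior_fourier (B : set L) t : finite_set B -> level_set c K `<=` B ->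
  fourier_sum mu phi f B t = f t.
Proof.
move=> fB AB; rewrite /fourier_sum fsbig_finite//= [in RHS]fE.
under eq_bigr do rewrite prior_fcoef mulr_suml.
rewrite exchange_big/=; apply: eq_bigr => i _.
set l := tnth (in_tuple s) i.
have lB : l \in fset_set B.
  rewrite in_fset_set// inE; apply: AB; have : l \in s by exact: mem_tnth.
  by rewrite in_fset_set// inE.
rewrite (bigD1_seq l)//=.
rewrite eqxx mulr1 big1 ?addr0// => m ml.
by rewrite eq_sym (negbTE ml) mulr0 mul0r.
Qed.

Lemma prior_energy : \int[mu]_t (f t * f t) = rho ^+ 2 * N%:R.
Proof.
have hO i j := @subfamily_orthonormal _ _ mu _ phi hphi s i j us.
have h := residual_energy (@subfamily_L2 _ _ mu _ phi hphi s) hO prior_L2.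
have e1 : \sum_(i < size s) (\int[mu]_t (f t * fam i t)) ^+ 2 = rho ^+ 2 * N%:R.
  transitivity (\sum_(i < size s) rho ^+ 2); last by rewrite sumr_const card_ord mulr_natr.
  apply: eq_bigr => i _.
  by rewrite -/(fcoef mu phi f (tnth (in_tuple s) i)) prior_fcoef_sqr mem_tnth.
rewrite e1 in h; apply/eqP; rewrite -subr_eq0 -h; apply/eqP.
rewrite -[RHS](Rintegral_1 mu); apply: eq_Rintegral => t _.
set g := f t - _; suff -> : g = 0 by rewrite mul0r.
apply/eqP; rewrite subr_eq0 {1}fE; apply/eqP.
apply: eq_bigr => i _; congr (_ * _).
by rewrite -/(fcoef mu phi f (tnth (in_tuple s) i)) prior_fcoef_tnth.
Qed.

(** The coefficients live in the level set, where [c l < K], so the weighted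
    sum is at most [rho ^+ 2 * N * K ^+ 2]. *)
Lemma prior_ellipsoid : rho ^+ 2 * N%:R * K ^+ 2 <= 1 -> ellipsoid mu phi c f.
Proof.
move=> hr; split; first exact: prior_L2.
  move=> eps eps0; exists (level_set c K); split => // B fB AB.
  have -> : (f \- fourier_sum mu phi f B)%R = (fun=> 0).
    by apply/funext => t /=; rewrite prior_fourier// subrr.
  rewrite L2_normE; last exact: L2_cst.
  by under eq_Rintegral do rewrite mul0r; rewrite Rintegral_1 sqrtr0.
apply: ge_ereal_sup => _ [X [fX _] <-].
rewrite fsbig_finite//= sumEFin lee_fin.
apply: le_trans hr.
apply: (@le_trans _ _ (\sum_(l <- fset_set X | l \in s) (rho ^+ 2 * K ^+ 2))).
  rewrite [leRHS]big_mkcond; apply: ler_sum => l _; rewrite prior_fcoef_sqr.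
  case: ifPn => [ls|_]; last by rewrite mulr0.
  rewrite mulrC; apply: ler_wpM2l; first exact: sqr_ge0.
  rewrite lerXn2r ?nnegrE ?c0//; first exact: ltW.
  by move: ls; rewrite in_fset_set// inE => /ltW.
rewrite big_const_seq iter_addr_0 -mulr_natr.
have cnt : (count (mem s) (fset_set X))%:R <= N%:R :> R.
  rewrite ler_nat -size_filter; apply: uniq_leq_size.
    by apply: filter_uniq; exact: fset_uniq.
  by move=> l; rewrite mem_filter => /andP[].
have rK0 : 0 <= rho ^+ 2 * K ^+ 2 by rewrite mulr_ge0 ?sqr_ge0.
by have := ler_wpM2l rK0 cnt; lra.
Qed.

End PriorClass.

Section LowerBound.
Context {R : realType} {d : option nat} (mu : probability (rspace R d) R).
Hypothesis hmu : is_uniform mu.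
Context {L : choiceType} (phi : L -> rspace R d -> R) (c : L -> R).
Hypothesis hphi : orthonormal_system mu phi.
Hypothesis c0 : forall l, 0 <= c l.
Variable K : R.
Hypothesis K0 : 0 < K.
Hypothesis fA : finite_set (level_set c K).
Hypothesis A2 : forall t, unit_cube R d t ->
  \sum_(l \in level_set c K) phi l t ^+ 2 = (card_level c K)%:R.

(** The Bayes bound for signs of size [r / sqrt N], which give the functions
    of the prior the norm [r]. The parameter [eta] weighs the first against
    the second moment and [delta] is the level of truncation of the design. *)
Lemma gamma_inf_lower n (r delta eta : R) : (0 < card_level c K)%N ->
  0 < r -> r * K <= 1 -> 0 < delta -> delta <= 1 / 32 -> 0 < eta -> eta <= 2 ->
  (1 - r ^+ 4 * (n%:R + n%:R ^+ 2 / (card_level c K)%:R) / delta) * (1 - eta / 2)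
    - (expR (4 * delta) - 1) / (2 * eta) <=
  gamma_inf mu (ellipsoid mu phi c) r n.
Proof.
set N := card_level c K => N0 r0 rK d0 d1 eta0 eta2.
pose s : seq L := fset_set (level_set c K).
have us : uniq s by exact: fset_uniq.
pose fam := @subfamily R d L phi s.
have fam2 i : fam i \in Lfun mu 2%:E by exact: (subfamily_L2 hphi).
have famO i j : \int[mu]_t (fam i t * fam j t) = (i == j)%:R.
  exact: (subfamily_orthonormal hphi).
have famN : {ae mu, forall t, \sum_i fam i t ^+ 2 = (size s)%:R}.
  apply: filterS (uniform_cube hmu) => t /A2.
  by rewrite fsbig_finite// big_tnth.
have NR : 0 < N%:R :> R by rewrite ltr0n.
pose rho := r / Num.sqrt N%:R.
have rho2 : rho ^+ 2 * N%:R = r ^+ 2.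
  by rewrite exprMn exprVn sqr_sqrtr ?divfK ?gt_eqF// ltW.
clearbody rho.
have EF f : ellipsoid mu phi c f -> f \in Lfun mu 2%:E by case.
have prior_in e : signs (size s) e ->
    separated_class mu (ellipsoid mu phi c) r (prior_fun fam rho e).
  move=> he; have fin : ellipsoid mu phi c (prior_fun fam rho e).
    apply: (prior_ellipsoid hphi c0 K0 fA he).
    by rewrite rho2 -exprMn expr_le1// ltW// mulr_gt0.
  split => //=; rewrite (L2_normE (EF _ fin)).
  rewrite (@prior_energy R d mu L phi c hphi K rho e he) -/N rho2 sqrtr_sqr.
  by rewrite ger0_norm// ltW.
apply: gamma_inf_ge => // psi tpsi.
have hg e : signs (size s) e ->
    \int[noise_design mu n]_w psi w + \int[noise_design mu n]_w
       (1 - psi (obs_sample (prior_fun fam rho e) w)) <=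
    gamma_err mu (ellipsoid mu phi c) r psi.
  move=> he; apply: lerD; last exact: (beta_err_ge EF tpsi (prior_in e he)).
  rewrite /alpha_err /expect_obs le_eqVlt; apply/orP; left; apply/eqP.
  by apply: eq_Rintegral => w _; rewrite obs_sample0.
have := bayes_lower_bound fam2 d0 d1 tpsi eta0 hg.
set p := \int[_]_z _ => hp.
have := Pgood_ge fam2 famO famN n rho d0; rewrite -/p.
have -> : (rho ^+ 2) ^+ 2 * (n%:R * (size s)%:R ^+ 2 + n%:R ^+ 2 * (size s)%:R) =
   r ^+ 4 * (n%:R + n%:R ^+ 2 / N%:R).
  rewrite -[size s]/N.
  have NN : N%:R / N%:R = 1 :> R by rewrite divff// gt_eqF.
  have -> : r ^+ 4 = (rho ^+ 2 * N%:R) ^+ 2 by rewrite rho2; lra.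
  transitivity ((rho ^+ 2) ^+ 2 *
      (n%:R * N%:R ^+ 2 + n%:R ^+ 2 * N%:R * (N%:R / N%:R))); last by lra.
  by rewrite NN mulr1.
set y := _ / delta => py.
have p1 : p <= 1 by exact: (Pgood_le1 fam2).
have E1 : 1 <= expR (4 * delta) by rewrite -[leLHS]expR0 ler_expR; lra.
apply: le_trans hp; apply: lerB; first by apply: ler_wpM2r => //; lra.
apply: ler_wpM2r; first by rewrite invr_ge0; lra.
by apply: ler_piMr => //; lra.
Qed.

End LowerBound.

(** * Separation rates *)

Section SlowSequence.
Context {R : realType}.
Variable q : nat -> R.
Hypothesis q0 : forall n, 0 < q n.

Fixpoint running_max n : R :=
  if n is m.+1 then Num.max (running_max m) (1 + q n) else 1 + q 0%N.

Lemma running_max_ge n k : (k <= n)%N -> 1 + q k <= running_max n.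
Proof.
elim: n => [|n IH]; first by rewrite leqn0 => /eqP ->.
rewrite leq_eqVlt => /predU1P[->|]; first by rewrite /= le_max lexx orbT.
by rewrite ltnS => /IH h; rewrite /= le_max h.
Qed.

Lemma running_max_le n A : (forall k, (k <= n)%N -> 1 + q k <= A) ->
  running_max n <= A.
Proof.
elim: n => [|n IH] h /=; first exact: h.
by rewrite ge_max h// andbT IH// => k kn; apply: h; exact: leqW.
Qed.

(** If [q] is unbounded, some sequence tends to zero so slowly that its
    product with [q] is still unbounded. The inverse square root of the
    running maximum of [q] will do, because [q] reaches its running maximum
    infinitely often. *)
Lemma slow_sequence :
  ~ (exists2 b, 0 < b & \forall n \near \oo, q n <= b) ->
  exists s : nat -> R, [/\ forall n, 0 < s n <= 1, s @ \oo --> (0 : R) &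
    forall B n0, exists2 n, (n0 <= n)%N & B <= q n * s n].
Proof.
move=> qub.
have big (A : R) : exists n, A < q n.
  apply: contra_notP qub => h; exists (Num.max 1 A); first by rewrite lt_max ltr01.
  apply: nearW => n; rewrite le_max; apply/orP; right.
  by rewrite leNgt; apply/negP => hn; apply: h; exists n.
have M1 n : 1 < running_max n.
  apply: lt_le_trans (running_max_ge (leq0n n)).
  by rewrite ltrDl.
have sM n : 0 < Num.sqrt (running_max n).
  by rewrite sqrtr_gt0; exact: (lt_trans ltr01 (M1 n)).
exists (fun n => (Num.sqrt (running_max n))^-1); split.
- move=> n; rewrite invr_gt0 sM/= invf_le1//.
  by rewrite -[leLHS]sqrtr1 (ler_sqrt _ (ltW (lt_trans ltr01 (M1 n)))) ltW.
- apply/cvgrPdist_le => e e0.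
  have [m hm] := big (e^-1 ^+ 2).
  exists m => // n /= mn; rewrite sub0r normrN ger0_norm; last by rewrite invr_ge0 ltW.
  rewrite -[leRHS]invrK lef_pV2 ?posrE ?invr_gt0//.
  have ei : 0 <= e^-1 by rewrite invr_ge0 ltW.
  rewrite -(ger0_norm ei) -sqrtr_sqr (ler_sqrt _ (ltW (lt_trans ltr01 (M1 n)))).
  by have := running_max_ge mn; have := q0 m; lra.
- move=> B n0.
  (* the first index at which [q] exceeds [A] is a record of [q]; the summand
     [running_max n0] places it after [n0] *)
  pose A := running_max n0 + 1 + 2 * B ^+ 2.
  have [n hn nmin] : exists2 n, A < q n & forall k, (k < n)%N -> q k <= A.
    pose p n := `[< A < q n >].
    have ex : exists n, p n by have [n hn] := big A; exists n; exact: asboolT.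
    case: (ex_minnP ex) => n /asboolP hn hmin; exists n => // k kn.
    rewrite leNgt; apply/negP => hk; have := hmin k (asboolT hk).
    by rewrite leqNgt kn.
  have A1 : 1 <= A by have := M1 n0; have := sqr_ge0 B; rewrite /A; lra.
  exists n.
    rewrite leqNgt; apply/negP => nn0.
    have := running_max_ge (ltnW nn0); have := sqr_ge0 B.
    by move: hn; rewrite /A; lra.
  have -> : running_max n = 1 + q n.
    apply/eqP; rewrite eq_le running_max_ge// andbT; apply: running_max_le => k.
    rewrite leq_eqVlt => /predU1P[->//|/nmin hk].
    by rewrite lerD2l; apply: ltW; exact: le_lt_trans hk hn.
  have h : 0 < Num.sqrt (1 + q n) by rewrite sqrtr_gt0; have := q0 n; lra.
  rewrite ler_pdivlMr//; apply: le_trans (ler_norm _) _.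
  have qn : 0 <= q n by exact: ltW.
  rewrite -(@ler_pXn2r _ 2) ?nnegrE// real_normK ?num_real//.
  rewrite exprMn sqr_sqrtr; last lra.
  have : A <= q n by exact: ltW.
  rewrite /A => hA; have := M1 n0 => m1.
  have B2 := sqr_ge0 B.
  apply: (@le_trans _ _ (B ^+ 2 * (2 * q n))); first by apply: ler_wpM2l => //; lra.
  by rewrite expr2 mulrA; apply: ler_wpM2r => //; lra.
Qed.

End SlowSequence.

Section Rates.
Context {R : realType} {d : option nat} (mu : probability (rspace R d) R).
Hypothesis hmu : is_uniform mu.
Context {L : choiceType} (phi : L -> rspace R d -> R) (c : L -> R).
Hypothesis hphi : orthonormal_system mu phi.
Hypothesis c0 : forall l, 0 <= c l.
Variable C : nat -> R.
Hypothesis C0 : positive_seq C.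
Hypothesis hC : asymp (fun n => C n ^+ 4 * (card_level c (C n))%:R)
                      (fun n => n%:R ^+ 2).
Hypothesis A1 : forall x : R, 0 < x -> finite_set (level_set c x).
Hypothesis A2 : forall x : R, 0 < x -> forall t, unit_cube R d t ->
  \sum_(l \in level_set c x) phi l t ^+ 2 = (card_level c x)%:R.
Hypothesis B1 : (card_level c (C n))%:R / n%:R @[n --> \oo] --> (0 : R).

Let N n := card_level c (C n).
Let F := ellipsoid mu phi c.

Let F2 f : F f -> f \in Lfun mu 2%:E. Proof. by case. Qed.

(** A vanishing cardinal is excluded because [C n ^+ 4 * N n] is of the order
    of [n ^+ 2]. *)
Lemma eventual_regime : exists a b : R, [/\ 0 < a, 1 <= b & \forall n \near \oo,
  [/\ (1 < n)%N, (0 < N n)%N, (N n <= n)%N,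
      a * n%:R ^+ 2 <= C n ^+ 4 * (N n)%:R &
      C n ^+ 4 * (N n)%:R <= b * n%:R ^+ 2]].
Proof.
have [a [b [a0 b0 hab]]] := hC.
exists a, (Num.max 1 b); split => //; first by rewrite le_max lexx.
move/cvgrPdist_le : B1 => /(_ 1 ltr01) hN.
near=> n.
have n1 : (1 < n)%N by near: n; exact: nbhs_infty_gt.
have n0 : 0 < n%:R :> R by rewrite ltr0n; exact: ltn_trans n1.
have n2 : 0 < n%:R ^+ 2 :> R by rewrite exprn_gt0.
have : a <= C n ^+ 4 * (N n)%:R / n%:R ^+ 2 <= b by near: n.
rewrite ler_pdivlMr// ler_pdivrMr// => /andP[h1 h2].
have : `|0 - (N n)%:R / n%:R| <= 1 :> R by near: n.
rewrite sub0r normrN ger0_norm ?divr_ge0// ler_pdivrMr// mul1r ler_nat => Nn.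
split => //.
- rewrite lt0n; apply/eqP => Nz; move: h1; rewrite Nz mulr0.
  by rewrite leNgt mulr_gt0.
- apply: le_trans h2 _; apply: ler_wpM2r; first exact: ltW.
  by rewrite le_max lexx orbT.
Unshelve. all: by end_near. Qed.

Lemma inv_C_cvg0 : (C n)^-1 @[n --> \oo] --> (0 : R).
Proof.
have [a [b [a0 b1 hab]]] := eventual_regime.
apply/cvgrPdist_le => e e0.
near=> n.
have [n1 N0 Nn h1 _] : [/\ (1 < n)%N, (0 < N n)%N, (N n <= n)%N,
      a * n%:R ^+ 2 <= C n ^+ 4 * (N n)%:R &
      C n ^+ 4 * (N n)%:R <= b * n%:R ^+ 2] by near: n.
have n0 : 0 < n%:R :> R by rewrite ltr0n; exact: ltn_trans n1.
have C4 : 0 <= C n ^+ 4 by rewrite exprn_ge0// ltW.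
have h2 : a * n%:R <= C n ^+ 4.
  rewrite -(ler_pM2r n0) -mulrA -expr2; apply: le_trans h1 _.
  by apply: ler_wpM2l => //; rewrite ler_nat.
have h3 : e^-1 ^+ 4 / a <= n%:R by near: n; exact: nbhs_infty_ger.
have ei : 0 < e^-1 by rewrite invr_gt0.
rewrite sub0r normrN ger0_norm; last by rewrite invr_ge0 ltW.
rewrite -[leRHS]invrK lef_pV2 ?posrE//.
rewrite -(@ler_pXn2r _ 4) ?nnegrE//; [|exact: ltW|exact: ltW].
by apply: le_trans h2; rewrite mulrC -ler_pdivrMr.
Unshelve. all: by end_near. Qed.

(** The bound [X] depends neither on a sequence of radii nor on [n]. Such
    uniformity is what the arguments along subsequences need. *)
Lemma upper_bound : exists2 k : R, 0 < k & forall eps : R, 0 < eps ->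
  exists2 X : R, 0 < X & \forall n \near \oo, forall r : R, 0 < r ->
    X <= r * C n ->
    alpha_err mu (@U_test R d L phi c C n ((r * C n) ^+ 2 / k)) <= eps /\
    beta_err mu F r (@U_test R d L phi c C n ((r * C n) ^+ 2 / k)) <= eps.
Proof.
have [a [b [a0 b1 hab]]] := eventual_regime.
have b0 : 0 < b by lra.
exists (12 * b); first by rewrite mulr_gt0.
move=> eps e0.
have ei : 0 < eps^-1 by rewrite invr_gt0.
have eie : eps^-1 * eps = 1 by rewrite mulVf// gt_eqF.
(* the first term serves the hypotheses of [test_power], the second the level,
   and the third the power *)
pose X := 2 + 12 * b * (216 * eps^-1 + 1) + 128 * (480 * (b * eps^-1)).
have bei : 0 < b * eps^-1 by exact: mulr_gt0.
have X2 : 2 <= X by rewrite /X; lra.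
exists X; first lra.
move/cvgrPdist_le : B1 => hN.
have e1 : 0 < eps / (128 * 32) by apply: divr_gt0 => //; lra.
have {}hN := hN _ e1.
near=> n => r r0 hr.
have [n1 N0 Nn _ h2] : [/\ (1 < n)%N, (0 < N n)%N, (N n <= n)%N,
      a * n%:R ^+ 2 <= C n ^+ 4 * (N n)%:R &
      C n ^+ 4 * (N n)%:R <= b * n%:R ^+ 2] by near: n.
set x := (r * C n) ^+ 2.
have Xx : X <= x.
  have rC1 : 1 <= r * C n by apply: le_trans hr; lra.
  by apply: le_trans hr _; rewrite /x expr2; apply: ler_peMr => //; lra.
have n0 : (0 < n)%N by exact: ltn_trans n1.
have x0 : 0 < x by lra.
have Hx : 216 * eps^-1 + 1 <= x / (12 * b).
  rewrite ler_pdivlMr; last by rewrite mulr_gt0.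
  by apply: le_trans Xx; rewrite /X; lra.
have H1 : 1 <= x / (12 * b) by lra.
split.
  apply: le_trans (test_level (C := C) (n := n) hmu hphi (A1 (C0 n)) (A2 (C0 n)) n0 N0 (lt_le_trans ltr01 H1)) _.
  rewrite ler_pdivrMr; last by rewrite exprn_gt0//; lra.
  apply: (@le_trans _ _ (eps * (x / (12 * b)))).
    by have := ler_wpM2l (ltW e0) Hx; lra.
  apply: ler_wpM2l; first exact: ltW.
  by rewrite expr2 ler_peMr//; lra.
apply: beta_err_le; first exact: ltW.
move=> f [Ff fr].
have x2 : 2 <= (r * C n) ^+ 2 by rewrite -/x; lra.
apply: le_trans (test_power (C := C) (n := n) hmu hphi (C0 n) (A1 (C0 n)) (A2 (C0 n)) n0 N0 Ff fr r0 b1 x2 n1 Nn h2) _.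
have hbx : 128 * (480 * (b / x)) <= eps.
  have : 128 * (480 * (b * eps^-1)) <= x by rewrite /X in Xx; lra.
  rewrite -(ler_pM2r e0) => h.
  have -> : 128 * (480 * (b / x)) = 128 * (480 * b) / x by lra.
  rewrite ler_pdivrMr//; apply: le_trans (_ : 128 * (480 * (b * (eps^-1 * eps))) <= _).
    by rewrite eie mulr1.
  by apply: le_trans (_ : 128 * (480 * (b * eps^-1)) * eps <= _); lra.
have : `|0 - (N n)%:R / n%:R| <= eps / (128 * 32) by near: n.
rewrite sub0r normrN ger0_norm ?divr_ge0// => hNn.
rewrite -/x -[size _]/(N n); lra.
Unshelve. all: by end_near. Qed.

(** As in the upper bound, the radius is quantified after [n], for use along
    subsequences. *)
Lemma lower_bound : forall eps : R, 0 < eps ->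
  exists2 X : R, 0 < X & \forall n \near \oo, forall r : R, 0 < r ->
    r * C n <= X -> 1 - eps <= gamma_inf mu F r n.
Proof.
have [a [b [a0 b1 hab]]] := eventual_regime.
move=> eps0 eps00.
(* with [eta := eps], the truncation costs at most [eps], and the weight [eta]
   and the second moment at most [eps / 2] each *)
pose eps := Num.min 1 (eps0 / 2).
have e0 : 0 < eps by rewrite lt_min ltr01 divr_gt0.
have e1 : eps <= 1 by rewrite ge_min lexx.
have e2 : 2 * eps <= eps0.
  have : eps <= eps0 / 2 by rewrite ge_min lexx orbT.
  by lra.
pose delta := eps ^+ 2 / 32.
have ee : eps ^+ 2 <= 1 by rewrite expr_le1// ltW.
have ee0 : 0 < eps ^+ 2 by rewrite exprn_gt0.
have d0 : 0 < delta by rewrite /delta; lra.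
have d1 : delta <= 1 / 32 by rewrite /delta; lra.
have hE : (expR (4 * delta) - 1) / (2 * eps) <= eps / 2.
  rewrite ler_pdivrMr; last by rewrite mulr_gt0.
  have := expR_ge1Dx (- (4 * delta)); rewrite expRN.
  have Ep := expR_gt0 (4 * delta).
  rewrite -(ler_pM2l Ep) divff ?gt_eqF// => h.
  have h8 : expR (4 * delta) * (1 - eps ^+ 2 / 8) <= 1 by move: h; rewrite /delta; lra.
  have : expR (4 * delta) <= 2.
    have := ler_wpM2l (ltW Ep) (_ : 1 / 2 <= 1 - eps ^+ 2 / 8) => /(_ ltac:(lra)); lra.
  move=> hE2; have := ler_wpM2r (ltW ee0) hE2; lra.
pose X := Num.min 1 (a * delta * eps / 2).
have ade : 0 < a * delta * eps by rewrite !mulr_gt0.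
have X0 : 0 < X by rewrite lt_min ltr01 divr_gt0.
have X1 : X <= 1 by rewrite ge_min lexx.
have Xa : 2 * X <= a * delta * eps.
  have : X <= a * delta * eps / 2 by rewrite ge_min lexx orbT.
  by lra.
exists X => //.
near=> n => r r0 hr.
have [n1 N0 Nn h1 _] : [/\ (1 < n)%N, (0 < N n)%N, (N n <= n)%N,
      a * n%:R ^+ 2 <= C n ^+ 4 * (N n)%:R &
      C n ^+ 4 * (N n)%:R <= b * n%:R ^+ 2] by near: n.
have rC0 : 0 < r * C n by rewrite mulr_gt0.
have eps2 : eps <= 2 by lra.
apply: le_trans (gamma_inf_lower hmu hphi c0 (C0 n) (A1 (C0 n)) (A2 (C0 n)) n N0 r0
  (le_trans hr X1) d0 d1 e0 eps2).
have NR : 0 < (N n)%:R :> R by rewrite ltr0n.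
have NnR : (N n)%:R <= n%:R :> R by rewrite ler_nat.
have nR : 0 < n%:R :> R by lra.
have hy : r ^+ 4 * (n%:R + n%:R ^+ 2 / (N n)%:R) / delta <= eps.
  rewrite ler_pdivrMr//.
  have s1 : n%:R + n%:R ^+ 2 / (N n)%:R <= 2 * (n%:R ^+ 2 / (N n)%:R) :> R.
    have : n%:R <= n%:R ^+ 2 / (N n)%:R :> R.
      by rewrite ler_pdivlMr// expr2; apply: ler_wpM2l => //; exact: ltW.
    by lra.
  have s2 : a * (n%:R ^+ 2 / (N n)%:R) <= C n ^+ 4 by rewrite mulrA ler_pdivrMr.
  have s3 : r ^+ 4 * C n ^+ 4 <= X.
    rewrite -exprMn; apply: (@le_trans _ _ (X ^+ 4)).
      by rewrite lerXn2r ?nnegrE// ltW.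
    by rewrite exprS ler_piMr ?exprn_ile1// ltW.
  have r4 : 0 <= r ^+ 4 by rewrite exprn_ge0// ltW.
  rewrite -(ler_pM2l a0).
  have t1 := ler_wpM2l r4 s1; have t2 := ler_wpM2l r4 s2.
  have t3 := ler_wpM2l (ltW a0) t1; lra.
have := mulr_ge0 (_ : 0 <= eps - r ^+ 4 * (n%:R + n%:R ^+ 2 / (N n)%:R) / delta)
   (_ : 0 <= 1 - eps / 2) => /(_ ltac:(lra) ltac:(lra)).
rewrite -/(N n).
have := sqr_ge0 eps; lra.
Unshelve. all: by end_near. Qed.

Let test n H := @U_test R d L phi c C n H.

Let is_test_U n H : is_test (@test n H).
Proof. exact: (U_test_is_test (C := C) (n := n) hmu hphi (A1 (C0 n)) (A2 (C0 n))). Qed.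

(** The thresholds are multiples of [(r n * C n) ^+ 2], with a constant that
    depends only on the implicit constants in the definition of [C]. *)
Lemma consistent_tests : exists2 k : R, 0 < k & forall r : nat -> R,
  positive_seq r -> r n * C n @[n --> \oo] --> +oo ->
  forall eps, 0 < eps -> \forall n \near \oo,
    alpha_err mu (@test n ((r n * C n) ^+ 2 / k)) <= eps /\
    beta_err mu F (r n) (@test n ((r n * C n) ^+ 2 / k)) <= eps.
Proof.
have [k k0 h] := upper_bound; exists k => // r r0 /cvgryPge rC eps e0.
have [X X0 hX] := h _ e0.
near=> n.
have hn : forall r : R, 0 < r -> X <= r * C n ->
    alpha_err mu (@U_test R d L phi c C n ((r * C n) ^+ 2 / k)) <= eps /\
    beta_err mu F r (@U_test R d L phi c C n ((r * C n) ^+ 2 / k)) <= eps.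
  by near: n.
apply: hn => //; near: n; exact: rC.
Unshelve. all: by end_near. Qed.

Lemma gamma_inf_cvg0 r : positive_seq r -> r n * C n @[n --> \oo] --> +oo ->
  gamma_inf mu F (r n) n @[n --> \oo] --> (0 : R).
Proof.
move=> r0 rC; have [k k0 h] := consistent_tests.
apply/cvgrPdist_le => e e0.
have e2 : 0 < e / 2 by rewrite divr_gt0.
near=> n.
rewrite sub0r normrN ger0_norm; last exact: gamma_inf_ge0.
apply: le_trans (gamma_inf_le F2 (r n) (is_test_U n ((r n * C n) ^+ 2 / k))) _.
have [h1 h2] : alpha_err mu (@test n ((r n * C n) ^+ 2 / k)) <= e / 2 /\
    beta_err mu F (r n) (@test n ((r n * C n) ^+ 2 / k)) <= e / 2.
  by near: n; exact: h.
by rewrite /gamma_err (splitr e) lerD.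
Unshelve. all: by end_near. Qed.

Lemma beta_inf_cvg0 r a : positive_seq r -> r n * C n @[n --> \oo] --> +oo ->
  0 < a -> beta_inf mu F (r n) n a @[n --> \oo] --> (0 : R).
Proof.
move=> r0 rC a0; have [k k0 h] := consistent_tests.
apply/cvgrPdist_le => e e0.
have ea0 : 0 < Num.min e a by rewrite lt_min e0 a0.
near=> n.
rewrite sub0r normrN ger0_norm; last by apply: beta_inf_ge0 => //; exact: ltW.
have [h1 h2] : alpha_err mu (@test n ((r n * C n) ^+ 2 / k)) <= Num.min e a /\
    beta_err mu F (r n) (@test n ((r n * C n) ^+ 2 / k)) <= Num.min e a.
  by near: n; exact: h.
have ha : alpha_err mu (@test n ((r n * C n) ^+ 2 / k)) <= a.
  by apply: le_trans h1 _; rewrite ge_min lexx orbT.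
apply: le_trans (beta_inf_le F2 (r n) (is_test_U n _) ha) _.
by apply: le_trans h2 _; rewrite ge_min lexx.
Unshelve. all: by end_near. Qed.

Lemma gamma_inf_cvg1 r : positive_seq r -> r n * C n @[n --> \oo] --> (0 : R) ->
  gamma_inf mu F (r n) n @[n --> \oo] --> (1 : R).
Proof.
move=> r0 /cvgrPdist_le rC; apply/cvgrPdist_le => e e0.
have [X X0 hX] := lower_bound e0.
have {}rC := rC _ X0.
near=> n.
have rX : r n * C n <= X.
  have : `|0 - r n * C n| <= X by near: n.
  by rewrite sub0r normrN; apply: le_trans; exact: ler_norm.
have hn : forall r : R, 0 < r -> r * C n <= X -> 1 - e <= gamma_inf mu F r n.
  by near: n.
have := hn _ (r0 n) rX; have := gamma_inf_le1 n F2 (r n) => h1 h2.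
rewrite ger0_norm; last by rewrite subr_ge0.
lra.
Unshelve. all: by end_near. Qed.

Lemma cvgy_of_ratio rs r : positive_seq r -> positive_seq rs ->
  asymp rs (fun n => (C n)^-1) -> r n / rs n @[n --> \oo] --> +oo ->
  r n * C n @[n --> \oo] --> +oo.
Proof.
move=> r0 rs0 [a [b [a0 _ hab]]] hr; apply/cvgryPge => A.
move/cvgryPge : hr => /(_ (`|A| / a)) hr; near=> n.
have h : `|A| / a <= r n / rs n by near: n.
have /andP[h2 _] : a <= rs n / (C n)^-1 <= b by near: n.
rewrite invrK in h2; apply: le_trans (ler_norm A) _.
have -> : r n * C n = (r n / rs n) * (rs n * C n).
  by rewrite mulrA divfK// gt_eqF.
have rr : 0 <= r n / rs n by rewrite divr_ge0// ltW.
by apply: le_trans (ler_wpM2l rr h2); rewrite -ler_pdivrMr.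
Unshelve. all: by end_near. Qed.

Lemma separation_rate_of_asymp rs : positive_seq rs ->
  asymp rs (fun n => (C n)^-1) -> is_separation_rate mu F rs.
Proof.
move=> rs0 has; have [a [b [a0 b0 hab]]] := has.
have {}hab : \forall n \near \oo, a <= rs n * C n <= b.
  by apply: filterS hab => n; rewrite invrK.
have mulE (r : nat -> R) n : r n * C n = (r n / rs n) * (rs n * C n).
  by rewrite mulrA divfK// gt_eqF.
have rsC n : 0 < rs n * C n by rewrite mulr_gt0.
split => //.
- move/cvgrPdist_le : inv_C_cvg0 => hi; apply/cvgrPdist_le => e e0.
  have eb : 0 < e / b by rewrite divr_gt0.
  have {}hi := hi _ eb.
  near=> n.
  have : `|0 - (C n)^-1| <= e / b by near: n.
  have Ci : 0 < (C n)^-1 by rewrite invr_gt0.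
  rewrite !sub0r !normrN (ger0_norm (ltW Ci)) (ger0_norm (ltW (rs0 n))) => h.
  have /andP[_ h2] : a <= rs n * C n <= b by near: n.
  have -> : rs n = (rs n * C n) * (C n)^-1 by rewrite mulfK// gt_eqF.
  apply: le_trans (ler_wpM2r (ltW Ci) h2) _.
  by apply: le_trans (ler_wpM2l (ltW b0) h) _; rewrite mulrC divfK// gt_eqF.
- move=> r r0 _ /cvgrPdist_le hr; apply: gamma_inf_cvg1 => //.
  apply/cvgrPdist_le => e e0.
  have eb : 0 < e / b by rewrite divr_gt0.
  have {}hr := hr _ eb.
  near=> n.
  have rr : 0 < r n / rs n by rewrite divr_gt0.
  have : `|0 - r n / rs n| <= e / b by near: n.
  have rC : 0 < r n * C n by rewrite mulr_gt0.
  rewrite !sub0r !normrN (ger0_norm (ltW rr)) (ger0_norm (ltW rC)) => h.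
  have /andP[_ h2] : a <= rs n * C n <= b by near: n.
  rewrite mulE; apply: le_trans (ler_wpM2l (ltW rr) h2) _.
  by apply: le_trans (ler_wpM2r (ltW b0) h) _; rewrite divfK// gt_eqF.
- move=> r r0 _ hr.
  have rC := cvgy_of_ratio r0 rs0 has hr.
  split; first exact: gamma_inf_cvg0.
  by move=> al /andP[al0 _]; exact: beta_inf_cvg0.
Unshelve. all: by end_near. Qed.

(** Otherwise the radii [rs n * s n] with [s] slow are negligible with respect
    to [rs], so the minimax error tends to one; yet infinitely often they are
    so far above [1 / C n] that the test has total error at most [1 / 4]. *)
Lemma separation_rate_bounded rs : positive_seq rs -> is_separation_rate mu F rs ->
  exists2 b, 0 < b & \forall n \near \oo, rs n * C n <= b.
Proof.
move=> rs0 [_ rs_cvg hlow _]; apply: contrapT => hb.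
have q0 n : 0 < rs n * C n by rewrite mulr_gt0.
have [s [s01 s_cvg hs]] := slow_sequence q0 hb.
have r0 : positive_seq (fun n => rs n * s n).
  by move=> n; rewrite mulr_gt0//; have /andP[] := s01 n.
have r_cvg : rs n * s n @[n --> \oo] --> (0 : R).
  by rewrite -[0 : R](mulr0 0); exact: cvgM.
have rr : rs n * s n / rs n @[n --> \oo] --> (0 : R).
  by under eq_fun do rewrite mulrAC divff ?gt_eqF// mul1r.
have /cvgrPdist_lt /(_ (1 / 2) ltac:(lra)) hg := hlow _ r0 r_cvg rr.
have [k k0 hup] := upper_bound.
have [X X0 hX] := hup (1 / 8) ltac:(lra).
have [m _ hm] : \forall n \near \oo, `|1 - gamma_inf mu F (rs n * s n) n| < 1 / 2 /\
   forall r : R, 0 < r -> X <= r * C n ->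
    alpha_err mu (@U_test R d L phi c C n ((r * C n) ^+ 2 / k)) <= 1 / 8 /\
    beta_err mu F r (@U_test R d L phi c C n ((r * C n) ^+ 2 / k)) <= 1 / 8.
  by near=> n; split; near: n.
have [n mn Xn] := hs X m.
have [h1 h2] := hm _ mn.
have Xn' : X <= rs n * s n * C n by rewrite mulrAC.
have [h3 h4] := h2 _ (r0 n) Xn'.
have := gamma_inf_le F2 (rs n * s n) (is_test_U n ((rs n * s n * C n) ^+ 2 / k)).
rewrite /gamma_err => h5.
have := ler_norm (1 - gamma_inf mu F (rs n * s n) n).
by rewrite -/(@test _ _) in h3 h4; lra.
Unshelve. all: by end_near. Qed.

(** Otherwise the radii [rs n / s n] with [s] slow dominate [rs], so the
    minimax error tends to zero; yet infinitely often they are so far below [1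
    / C n] that it is at least [1 / 2]. *)
Lemma separation_rate_bounded_below rs : positive_seq rs ->
  is_separation_rate mu F rs ->
  exists2 b, 0 < b & \forall n \near \oo, (rs n * C n)^-1 <= b.
Proof.
move=> rs0 [_ rs_cvg _ hup]; apply: contrapT => hb.
have q0 n : 0 < (rs n * C n)^-1 by rewrite invr_gt0 mulr_gt0.
have [s [s01 s_cvg hs]] := slow_sequence q0 hb.
(* the lower barrier [Num.sqrt (rs n)] keeps [rs n / s' n] tending to zero *)
pose s' n := Num.max (s n) (Num.sqrt (rs n)).
have sq0 n : 0 < Num.sqrt (rs n) by rewrite sqrtr_gt0.
have s'0 n : 0 < s' n by rewrite lt_max sq0 orbT.
have sq_cvg : Num.sqrt (rs n) @[n --> \oo] --> (0 : R).
  apply/cvgrPdist_le => e e0; move/cvgrPdist_le : rs_cvg => rs_cvg.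
  have {}rs_cvg := rs_cvg (e ^+ 2) ltac:(by rewrite exprn_gt0).
  near=> n.
  have : `|0 - rs n| <= e ^+ 2 by near: n.
  rewrite !sub0r !normrN (ger0_norm (ltW (rs0 n))) (ger0_norm (ltW (sq0 n))) => h.
  by rewrite -(ger0_norm (ltW e0)) -sqrtr_sqr ler_wsqrtr.
have s'_cvg : s' n @[n --> \oo] --> (0 : R).
  apply/cvgrPdist_le => e e0.
  move/cvgrPdist_le : s_cvg => /(_ e e0) h1.
  move/cvgrPdist_le : sq_cvg => /(_ e e0) h2.
  near=> n.
  have : `|0 - s n| <= e by near: n.
  have : `|0 - Num.sqrt (rs n)| <= e by near: n.
  have /andP[sn0 _] := s01 n.
  rewrite !sub0r !normrN (ger0_norm (ltW (sq0 n))) (ger0_norm (ltW sn0)) (ger0_norm (ltW (s'0 n))) => g1 g2.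
  by rewrite ge_max g1 g2.
have r0 : positive_seq (fun n => rs n / s' n) by move=> n; rewrite divr_gt0.
have r_cvg : rs n / s' n @[n --> \oo] --> (0 : R).
  apply/cvgrPdist_le => e e0; move/cvgrPdist_le : sq_cvg => /(_ e e0) h2.
  near=> n.
  have : `|0 - Num.sqrt (rs n)| <= e by near: n.
  have rn := r0 n.
  rewrite !sub0r !normrN (ger0_norm (ltW (sq0 n))) (ger0_norm (ltW rn)).
  apply: le_trans; rewrite ler_pdivrMr//.
  rewrite -{1}(sqr_sqrtr (ltW (rs0 n))) expr2 ler_wpM2l ?(ltW (sq0 n))//.
  by rewrite le_max lexx orbT.
have rr : rs n / s' n / rs n @[n --> \oo] --> +oo.
  apply/cvgryPge => A.
  have Ai0 : 0 < (`|A| + 1)^-1 by rewrite invr_gt0 ltr_wpDl.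
  move/cvgrPdist_le : s'_cvg => /(_ _ Ai0) h.
  near=> n.
  have : `|0 - s' n| <= (`|A| + 1)^-1 by near: n.
  rewrite sub0r normrN (ger0_norm (ltW (s'0 n))) => g.
  rewrite mulrAC divff ?gt_eqF// mul1r.
  apply: le_trans (_ : `|A| + 1 <= _).
    by apply: le_trans (ler_norm A) _; rewrite lerDl.
  by rewrite -[leLHS]invrK lef_pV2 ?posrE.
have [/cvgrPdist_lt /(_ (1 / 4) ltac:(lra)) hg _] := hup _ r0 r_cvg rr.
have half0 : 0 < 1 / 2 :> R by lra.
have [X X0 hX] := lower_bound half0.
have [m _ hm] : \forall n \near \oo, `|0 - gamma_inf mu F (rs n / s' n) n| < 1 / 4 /\
   forall r : R, 0 < r -> r * C n <= X -> 1 - 1 / 2 <= gamma_inf mu F r n.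
  by near=> n; split; near: n.
have [n mn Xn] := hs X^-1 m.
have [h1 h2] := hm _ mn.
have Xn' : rs n / s' n * C n <= X.
  rewrite mulrAC ler_pdivrMr//.
  have qn : 0 < rs n * C n by rewrite mulr_gt0.
  have hx : X^-1 <= (rs n * C n)^-1 * s' n.
    apply: le_trans Xn _; apply: ler_wpM2l; first exact: ltW.
    by rewrite le_max lexx.
  have := ler_wpM2l (ltW X0) (ler_wpM2l (ltW qn) hx).
  by rewrite mulrCA divff ?gt_eqF// mulr1 mulVKf// gt_eqF.
have := h2 _ (r0 n) Xn'.
by have := ler_norm (- (0 - gamma_inf mu F (rs n / s' n) n)); rewrite normrN; lra.
Unshelve. all: by end_near. Qed.

Lemma asymp_of_separation_rate rs : positive_seq rs ->
  is_separation_rate mu F rs -> asymp rs (fun n => (C n)^-1).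
Proof.
move=> rs0 hrs.
have [b b0 hb] := separation_rate_bounded rs0 hrs.
have [a a0 ha] := separation_rate_bounded_below rs0 hrs.
exists a^-1, b; split => //; first by rewrite invr_gt0.
near=> n; rewrite invrK.
have qn : 0 < rs n * C n by rewrite mulr_gt0.
have h1 : (rs n * C n)^-1 <= a by near: n.
have h2 : rs n * C n <= b by near: n.
rewrite h2 andbT -[leRHS]invrK lef_pV2 ?posrE ?invr_gt0//.
Unshelve. all: by end_near. Qed.

Lemma consistent_threshold rs r : positive_seq r -> positive_seq rs ->
  asymp rs (fun n => (C n)^-1) -> r n / rs n @[n --> \oo] --> +oo ->
  exists H : nat -> R, H @ \oo --> +oo /\
    gamma_err mu F (r n) (@U_test R d L phi c C n (H n)) @[n --> \oo] --> (0 : R).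
Proof.
move=> r0 rs0 has hr; have rC := cvgy_of_ratio r0 rs0 has hr.
have [k k0 h] := consistent_tests.
exists (fun n => (r n * C n) ^+ 2 / k); split.
  apply/cvgryPge => A; move/cvgryPge : rC => rC.
  near=> n.
  have h1 : 1 <= r n * C n by near: n; exact: rC.
  have h2 : `|A| * k <= r n * C n by near: n; exact: rC.
  apply: le_trans (ler_norm A) _; rewrite ler_pdivlMr//.
  by apply: le_trans h2 _; rewrite expr2; apply: ler_peMr => //; lra.
apply/cvgrPdist_le => e e0.
have e2 : 0 < e / 2 by rewrite divr_gt0.
near=> n.
rewrite sub0r normrN ger0_norm; last by apply: gamma_err_ge0 => //; exact: is_test_U.
have [h1 h2] : alpha_err mu (@test n ((r n * C n) ^+ 2 / k)) <= e / 2 /\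
    beta_err mu F (r n) (@test n ((r n * C n) ^+ 2 / k)) <= e / 2.
  by near: n; exact: h.
by rewrite /gamma_err (splitr e) lerD.
Unshelve. all: by end_near. Qed.

End Rates.

Theorem corollary1 (R : realType) (d : option nat) (hd : dim_ge1 d)
  (mu : probability (rspace R d) R) (hmu : is_uniform mu)
  (L : choiceType) (hL : ([set: L] #= [set: nat])%card)
  (phi : L -> rspace R d -> R) (hphi : orthonormal_system mu phi)
  (c : L -> R) (hc : forall l, 0 <= c l)
  (C : nat -> R) (hC0 : positive_seq C)
  (hC : asymp (fun n => C n ^+ 4 * (card_level c (C n))%:R)
              (fun n => n%:R ^+ 2))
  (A1 : forall x : R, 0 < x -> finite_set (level_set c x))
  (A2 : forall x : R, 0 < x -> forall t, unit_cube R d t ->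
     \sum_(l \in level_set c x) phi l t ^+ 2 = (card_level c x)%:R)
  (A3 : exists2 p : R, 4 < p &
     (ereal_sup [set (\int[mu]_t (`|f t| `^ p)%:E)%E
                | f in ellipsoid mu phi c] < +oo)%E)
  (B1 : (card_level c (C n))%:R / n%:R @[n --> \oo] --> (0 : R))
  (B2 : forall b : R, 0 < b ->
     asymp (fun n => (card_level c (C n))%:R : R)
           (fun n => (card_level c (b * C n))%:R)) :
  (forall rs : nat -> R, positive_seq rs ->
     is_separation_rate mu (ellipsoid mu phi c) rs <->
     asymp rs (fun n => (C n)^-1)) /\
  (forall rs r : nat -> R,
     is_separation_rate mu (ellipsoid mu phi c) rs ->
     positive_seq r -> r @ \oo --> 0 ->
     r n / rs n @[n --> \oo] --> +oo ->
     exists H : nat -> R, H @ \oo --> +oo /\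
       gamma_err mu (ellipsoid mu phi c) (r n) (@U_test R d L phi c C n (H n))
         @[n --> \oo] --> (0 : R)).
Proof.
split=> [rs rs0|rs r hrs r0 _ hr].
  split; first exact: (asymp_of_separation_rate hmu hphi hc hC0 hC A1 A2 B1 rs0).
  exact: (separation_rate_of_asymp hmu hphi hc hC0 hC A1 A2 B1 rs0).
have rs0 : positive_seq rs by case: hrs.
apply: (consistent_threshold hmu hphi hC0 hC A1 A2 B1 r0 rs0) => //.
exact: (asymp_of_separation_rate hmu hphi hc hC0 hC A1 A2 B1 rs0).
Qed.
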